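(* Let $G$ be a semimartingale on $[0,T]$ with $\mathbb{E}[\sup_{0\le t\le T}|G_t|]<\infty$ (i.e. $G\in\mathcal{S}^1$) and $G\in\mathcal{H}^1_{loc}$. Let $G=N+D$ be its canonical decomposition, where $N$ is a local martingale started at zero and $D$ is a predictable finite-variation process, and let $D^+$ (resp. $D^-$) denote the increasing (resp. decreasing) component of $D$, i.e. $D-D_0=D^+-D^-$ with $D^+,D^-$ adapted increasing processes such that $\int|dD_s|=D^++D^-$. Let $S$ be the Snell envelope of $G$, with Doob–Meyer decomposition $S=M^*-A$, where $M^*$ is a uniformly integrable martingale started at zero and $A$ is a predictable, increasing process of integrable variation. Then $A$ is, as a measure, absolutely continuous with respect to $D^-$ almost surely on $[0,T]$, and $\mu$, defined by $$\mu_t:=\frac{dA_t}{dD^-_t},\qquad 0\le t\le T,$$ satisfies $0\le\mu_t\le1$ almost surely.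
   Context: Fix $T\in(0,\infty]$ and a filtered probability space $(\Omega,\mathcal{F},\mathbb{F}=(\mathcal{F}_t)_{0\le t\le T},\mathbb{P})$ with $\mathbb{F}$ right-continuous and complete, $\mathcal{F}=\mathcal{F}_T$, and $\mathcal{F}_0$ trivial. If $T=\infty$, then $\mathcal{F}_\infty=\sigma(\cup_{0\le t<\infty}\mathcal{F}_t)$ and $G_\infty=\liminf_{t\to\infty}G_t$. All processes are adapted and c\`adl\`ag. For stopping times $\sigma_1\le\sigma_2$ a.s., $\mathcal{T}_{\sigma_1,\sigma_2}$ is the set of stopping times $\tau$ with $\mathbb{P}(\sigma_1\le\tau\le\sigma_2)=1$. The Snell envelope $S$ of $G$ is the minimal c\`adl\`ag supermartingale dominating $G$; it satisfies $S_\sigma=\operatorname{ess\,sup}_{\tau\in\mathcal{T}_{\sigma,T}}\mathbb{E}[G_\tau\mid\mathcal{F}_\sigma]$ a.s. for every $\sigma\in\mathcal{T}_{0,T}$. Under $\mathbb{E}[\sup_{0\le t\le T}|G_t|]<\infty$, $S$ is of class (D), so it has a unique Doob–Meyer decomposition $S=M^*-A$ as in the claim (here $A$ is not required to start at zero), and the semimartingale $G$ is special, so it has a unique canonical decomposition. For a special semimartingale $X$ with canonical decomposition $X=\bar B+\bar I$ ($\bar B$ a local martingale started at zero, $\bar I$ predictable of finite variation), set $\|X\|_{\mathcal{H}^1}=\mathbb{E}[\sup_{0\le t\le T}|\bar B_t|]+\mathbb{E}\big[\int_0^T|d\bar I_s|\big]$, and write $X\in\mathcal{H}^1$ if this is finite.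 $X\in\mathcal{H}^1_{loc}$ means that there is a sequence of stopping times $\sigma_n$ increasing to infinity a.s. such that each stopped process $X^{\sigma_n}$ belongs to $\mathcal{H}^1$. A process of finite variation is identified with its (random) Lebesgue–Stieltjes signed measure on the time axis. *)

(* Defs.v *)
From HB Require Import structures.
From mathcomp Require Import all_boot all_order all_algebra.
From mathcomp Require Import all_classical all_reals all_analysis.

Set Implicit Arguments.
Unset Strict Implicit.
Unset Printing Implicit Defensive.

Import Order.TTheory GRing.Theory Num.Theory.
Import numFieldNormedType.Exports.

Local Open Scope classical_set_scope.
Local Open Scope ring_scope.

(** Time runs over [0, T] with T : \bar R, so that a process and a filtration
    are indexed by \bar R and the time +oo is included when T = +oo; only the
    indices in [0, T] are meaningful.  Measurability, (super)martingale
    properties and domination concern all of [0, T].  Path properties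
    (regularity, monotonicity, variation) and decompositions concern the finite
    times of [0, T]: when T = +oo a local martingale or a process of finite
    variation has no terminal value in general, and G need not have a left
    limit at +oo. *)

Section times.
Context {R : realType}.
Variable T : \bar R.

Definition times : set (\bar R) := [set t | (0 <= t)%E /\ (t <= T)%E].

Definition finite_times : set R := [set r | 0 <= r /\ (r%:E <= T)%E].

End times.

Section processes.
Context {R : realType} {d : measure_display} {Omega : measurableType d}.
Variables (T : \bar R) (F : \bar R -> set (set Omega)).
Variable P : probability Omega R.

Definition usual_filtration : Prop :=
  [/\ (forall t, times T t ->
         sigma_algebra [set: Omega] (F t) /\ F t `<=` measurable),
      (forall s t, times T s -> times T t -> (s <= t)%E -> F s `<=` F t),
      (forall s, times T s -> (s < T)%E ->
         F s = \bigcap_(t in [set t | (s < t)%E /\ (t <= T)%E]) F t) &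
      (forall N, P.-negligible N -> F 0%E N)].

(* The sigma-algebra of the probability space is F_T; for T = +oo it is generated
   by the F_t with t finite. *)
Definition terminal_sigma_algebra : Prop :=
  F T = measurable /\
  (T = +oo%E ->
   F T = <<s \bigcup_(t in [set t | (0 <= t)%E /\ (t < +oo)%E]) F t >>).

Definition initially_trivial : Prop :=
  forall B, F 0%E B -> P B = 0%E \/ P B = 1%E.

Definition measurable_wrt (H : set (set Omega)) (Z : Omega -> R) : Prop :=
  forall B : set R, measurable B -> H (Z @^-1` B).

(* Z is a version of E[Y | H] *)
Definition cond_exp (H : set (set Omega)) (Y Z : Omega -> R) : Prop :=
  [/\ measurable_wrt H Z,
      P.-integrable [set: Omega] (EFin \o Z) &
      forall B, H B ->
        (\int[P]_(w in B) (Z w)%:E = \int[P]_(w in B) (Y w)%:E)%E].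

Implicit Types X V G S M N A D L I : \bar R -> Omega -> R.

Definition adapted X : Prop :=
  forall t, times T t -> measurable_wrt (F t) (X t).

Definition cadlag_paths X : Prop :=
  \forall w \ae P, forall r : R, finite_times T r ->
    ((r%:E < T)%E -> X x%:E w @[x --> r^'+] --> X r%:E w) /\
    (0 < r -> cvg (X x%:E w @[x --> r^'-])).

Definition cadlag_process X : Prop := adapted X /\ cadlag_paths X.

Definition integrable_process X : Prop :=
  forall t, times T t -> P.-integrable [set: Omega] (EFin \o X t).

Definition martingale X : Prop :=
  [/\ adapted X, integrable_process X &
      forall s t, times T s -> times T t -> (s <= t)%E ->
        cond_exp (F s) (X t) (X s)].

Definition supermartingale X : Prop :=
  [/\ adapted X, integrable_process X &
      forall s t, times T s -> times T t -> (s <= t)%E ->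
        exists2 Z, cond_exp (F s) (X t) Z & \forall w \ae P, Z w <= X s w].

Definition uniformly_integrable X : Prop :=
  forall e : R, 0 < e -> exists c : R, forall t, times T t ->
    (\int[P]_(w in [set w : Omega | (c <= `|X t w|)%R]) (`|X t w|%R)%:E <= e%:E)%E.

(* Values larger than T are allowed; a stopping time enters below only through
   its minimum with the times of [0, T]. *)
Definition stopping_time (sigma : Omega -> \bar R) : Prop :=
  (forall w, 0 <= sigma w)%E /\
  forall t, times T t -> F t [set w | (sigma w <= t)%E].

Definition stopped X (sigma : Omega -> \bar R) : \bar R -> Omega -> R :=
  fun t w => X (Order.min t (sigma w)) w.

(* For T < +oo, convergence to +oo forces sigma n w > T for large n. *)
Definition localizing (sigma : nat -> Omega -> \bar R) : Prop :=
  (forall n, stopping_time (sigma n)) /\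
  \forall w \ae P, nondecreasing_seq (sigma ^~ w) /\
    sigma n w @[n --> \oo] --> +oo%E.

Definition local_martingale X : Prop :=
  cadlag_process X /\
  exists2 sigma, localizing sigma & forall n, martingale (stopped X (sigma n)).

Definition started_at_zero X : Prop := \forall w \ae P, X 0%E w = 0.

Definition increasing X : Prop :=
  \forall w \ae P, forall r s, finite_times T r -> finite_times T s ->
    r <= s -> X r%:E w <= X s%:E w.

(* the variation of the path on ]0, r] *)
Definition path_variation X (w : Omega) (r : R) : \bar R :=
  total_variation 0 r (fun x => X x%:E w).

Definition finite_variation X : Prop :=
  \forall w \ae P, forall r, finite_times T r -> (path_variation X w r < +oo)%E.

Definition whole_variation X (w : Omega) : \bar R :=
  ereal_sup [set path_variation X w r | r in finite_times T].

Definition running_sup X (w : Omega) : \bar R :=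
  ereal_sup [set (`|X t w|)%:E | t in times T].

Definition predictable_rectangles : set (set (\bar R * Omega)) :=
  [set C | (exists2 B, F 0%E B & C = [set 0%E] `*` B) \/
           (exists s t B, [/\ (0 <= s)%E, (s < t)%E, (t <= T)%E, F s B &
              C = [set u | (s < u)%E /\ (u <= t)%E] `*` B])].

Definition predictable_sets : set (set (\bar R * Omega)) :=
  <<s times T `*` [set: Omega], predictable_rectangles >>.

Definition predictable X : Prop :=
  forall B : set R, measurable B ->
    predictable_sets [set u | times T u.1 /\ B (X u.1 u.2)].

Definition semimartingale X : Prop :=
  cadlag_process X /\
  exists M V, [/\ local_martingale M, cadlag_process V, finite_variation V &
    \forall w \ae P, forall r, finite_times T r ->
      X r%:E w = M r%:E w + V r%:E w].

Definition canonical_decomposition X L I : Prop :=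
  [/\ local_martingale L, started_at_zero L,
      (cadlag_process I /\ predictable I), finite_variation I &
      \forall w \ae P, forall r, finite_times T r ->
        X r%:E w = L r%:E w + I r%:E w].

Definition in_S1 X : Prop := (\int[P]_w running_sup X w < +oo)%E.

Definition in_H1 X : Prop :=
  exists L I, canonical_decomposition X L I /\
    (\int[P]_w running_sup L w + \int[P]_w whole_variation I w < +oo)%E.

Definition in_H1_loc X : Prop :=
  exists2 sigma, localizing sigma & forall n, in_H1 (stopped X (sigma n)).

Definition terminal_value X : Prop :=
  T = +oo%E -> \forall w \ae P,
    (X +oo%E w)%:E = limf_einf (fun r : R => (X r%:E w)%:E) (pinfty_nbhs R).

Definition variation_components D Dp Dm : Prop :=
  [/\ cadlag_process Dp, cadlag_process Dm, increasing Dp, increasing Dm &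
      \forall w \ae P, forall r, finite_times T r ->
        D r%:E w - D 0%E w = Dp r%:E w - Dm r%:E w /\
        path_variation D w r = (Dp r%:E w + Dm r%:E w)%:E].

Definition dominates V X : Prop :=
  \forall w \ae P, forall t, times T t -> X t w <= V t w.

Definition snell_envelope G S : Prop :=
  [/\ cadlag_process S, supermartingale S, dominates S G &
      forall V, cadlag_process V -> supermartingale V -> dominates V G ->
        dominates V S].

Definition doob_meyer_decomposition S M A : Prop :=
  [/\ (cadlag_process M /\ martingale M /\ uniformly_integrable M),
      started_at_zero M,
      (cadlag_process A /\ predictable A), increasing A &
      (\int[P]_w whole_variation A w < +oo)%E /\
      \forall w \ae P, forall r, finite_times T r ->
        S r%:E w = M r%:E w - A r%:E w].

(* The path extended to R by its value at 0 before 0 and by its value at T after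
   T: its Lebesgue-Stieltjes measure is carried by ]0, T] (by ]0, +oo[ if
   T = +oo), without any mass at time 0. *)
Definition extended_path X (w : Omega) : R -> R :=
  fun x => X (Order.min T (Order.max 0%E x%:E)) w.

End processes.

(* nu is the Lebesgue-Stieltjes measure of f; being a charge, it is finite. *)
Definition stieltjes_charge {R : realType} (f : cumulative R R)
    (nu : {charge set (measurableTypeR R) -> \bar R}) : Prop :=
  forall B : set (measurableTypeR R), measurable B ->
    nu B = lebesgue_stieltjes_measure f B.

(* Main.v *)
Require Import Defs.
From HB Require Import structures.
From mathcomp Require Import all_boot all_order all_algebra.
From mathcomp Require Import all_classical all_reals all_analysis.
From mathcomp Require Import measurable_realfun zify lra.

(** Idea.  Write [dA <= dDm] for the claim: the increments of [A] are almost
    surely at most those of [Dm].  Once it is known, the Lebesgue-Stieltjes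
    measures of the two paths are ordered, so the first is absolutely continuous
    with a derivative between 0 and 1 ([stieltjes_le], [Radon_Nikodym_le1]).

    The claim comes from the minimality of the Snell envelope [S].  Assume at
    first that everything is integrable, fix [u < v], let [m] be the increase of
    [Dm] since a fixed earlier time, and let [X] be the right-continuous
    martingale of the conditional expectations of [S_v + m_v].  On [[u, v]] the
    supermartingale [X - m] dominates [G]: from a time [x] up to [v] the process
    [G = N + D] loses in mean at most the increase of [m], and [S_v >= G_v].
    Replacing [S] by [min (S, X - m)] on [[u, v)] gives a supermartingale above
    [G], so [S_u <= X_u - m_u] ([snell_le]).  Integrated over an event of [F_u],
    where [S = M - A] with a martingale [M], this says that the mean increase of
    [A] from [u] to [v] is at most that of [m].  The right-continuous version of
    the conditional expectations is Doob's, by upcrossings ([cadlag_version]).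

    In general [N] is only a local martingale and [m] need not be integrable, so
    one stops at a time [tau] before which [N] is a martingale and the variation
    of [D] is below a level.  The competitor must still dominate [G] after
    [tau]; this is paid for by adding [2 Gam] when [tau <= v], where [Gam] is an
    integrable bound of [|G|].  The value of [m] at [tau] is integrable because
    the last jump of the variation of [D] is a jump of [D]
    ([total_variation_jump]), and there [D] is [G] minus a stopped martingale.
    So, in mean over the events of [F_u], the stopped [A] increases at most as
    much as [m + j], where [j] jumps by [2 Gam] at [tau] ([increment_le]).

    This inequality of measures on rectangles extends to predictable sets and to
    predictable integrands ([mass_le_predictable], [integral_levels_le]).  Here
    [P(dw) dA(w)] is handled as the image of a product measure under the time
    change of [A].  Both [A] and [Dm] are predictable, the latter because the
    variation of [D] at [y] is a limit of quantities known just before [y] and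
    of [D_y] ([variation_grid_left], [predictable_of_left]).  Hence a function of
    [k = m - A] that is positive exactly where [k < 0] may be integrated; by
    convexity, the mean of a function of [k_t] that is positive exactly where
    [k_t < 0] is at most the mean of [j_t] ([stopped_domination]).  As the level
    grows, [tau] passes [t], the mean of [j_t] tends to 0, and [k_t >= 0] almost
    surely ([drift_increment_le]).  Rational times and right-continuity give all
    times at once ([drift_le_all_times]). *)

Set Implicit Arguments.
Unset Strict Implicit.
Unset Printing Implicit Defensive.

Import Order.TTheory GRing.Theory Num.Theory.
Import numFieldNormedType.Exports.

Local Open Scope classical_set_scope.
Local Open Scope ring_scope.

(** * Expectations over an event *)

Section expectation.
Context {R : realType} {d : measure_display} {Omega : measurableType d}.
Variable P : probability Omega R.
Implicit Types (X Y Z : Omega -> R) (B C : set Omega).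

Local Notation intg X := (P.-integrable [set: Omega] (EFin \o X)).
Local Notation E := (Rintegral P).

Lemma intg_measurable X : intg X -> measurable_fun setT X.
Proof. by move=> /measurable_int /measurable_EFinP. Qed.

Lemma intgS X B : intg X -> measurable B -> P.-integrable B (EFin \o X).
Proof. by move=> iX mB; apply: (integrableS measurableT) => //. Qed.

Lemma intgD X Y : intg X -> intg Y -> intg (fun w => X w + Y w).
Proof. by move=> iX iY; exact: (integrableD measurableT iX iY). Qed.

Lemma intgB X Y : intg X -> intg Y -> intg (fun w => X w - Y w).
Proof. by move=> iX iY; exact: (integrableB measurableT iX iY). Qed.

Lemma intgZ (c : R) X : intg X -> intg (fun w => c * X w).
Proof. by move=> iX; exact: (integrableZl measurableT c iX). Qed.

Lemma intg_norm X : intg X -> intg (fun w => `|X w|).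
Proof. exact: integrable_norm. Qed.

Lemma intg_cst (c : R) : intg (fun=> c).
Proof. exact: finite_measure_integrable_cst. Qed.

Lemma intg_le X Y : measurable_fun setT X -> intg Y ->
  (\forall w \ae P, `|X w| <= `|Y w|) -> intg X.
Proof.
move=> mX iY XY; apply/integrableP; split; first exact/measurable_EFinP.
have /integrableP[mY] := iY; apply: le_lt_trans.
apply: ae_ge0_le_integral => //.
- by do 2 apply: measurableT_comp => //.
- by apply: measurableT_comp.
- by apply: filterS XY => w h _; rewrite lee_fin.
Qed.

Lemma intg_eq_ae X Y : measurable_fun setT X -> intg Y ->
  (\forall w \ae P, X w = Y w) -> intg X.
Proof. by move=> mX iY XY; apply: intg_le mX iY _; apply: filterS XY => w ->. Qed.

Lemma intg_bounded X (c : R) : measurable_fun setT X ->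
  (\forall w \ae P, `|X w| <= c) -> intg X.
Proof.
move=> mX Xc; apply: (intg_le mX (intg_cst c)); apply: filterS Xc => w h.
exact: le_trans h (ler_norm _).
Qed.

Lemma intg_restrict X C : measurable C -> intg X -> intg (X \_ C).
Proof.
move=> mC iX; apply: (intg_le _ iX); last first.
  by apply: aeW => w; rewrite patchE; case: ifP; rewrite ?normr0.
apply/(measurable_restrictT _ mC); apply: measurable_funTS.
exact: intg_measurable.
Qed.

Lemma E_D X Y B : intg X -> intg Y -> measurable B ->
  E B (fun w => X w + Y w) = E B X + E B Y.
Proof. by move=> iX iY mB; rewrite RintegralD//; apply: intgS. Qed.

Lemma E_B X Y B : intg X -> intg Y -> measurable B ->
  E B (fun w => X w - Y w) = E B X - E B Y.
Proof. by move=> iX iY mB; rewrite RintegralB//; apply: intgS. Qed.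

Lemma E_Z c X B : intg X -> measurable B -> E B (fun w => c * X w) = c * E B X.
Proof. by move=> iX mB; rewrite RintegralZl//; apply: intgS. Qed.

Lemma E_cst (c : R) B : measurable B -> E B (fun=> c) = c * fine (P B).
Proof. by move=> mB; rewrite Rintegral_cst. Qed.

Lemma E_restrict X B C : E B (X \_ C) = E (B `&` C) X.
Proof. by rewrite Rintegral_mkcondr. Qed.

Lemma E_mkcond X B : E B X = E setT (X \_ B).
Proof. by rewrite Rintegral_mkcond. Qed.

Lemma E_split X B C : intg X -> measurable B -> measurable C ->
  E B X = E (B `&` C) X + E (B `\` C) X.
Proof.
move=> iX mB mC; rewrite -Rintegral_setU.
- by rewrite setUIDK.
- exact: measurableI.
- exact: measurableD.
- by apply: intgS => //; rewrite setUIDK.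
- by apply/disj_setPS => w [[_ ?] [_]].
Qed.

Lemma E_ge0 X B : (forall w, B w -> 0 <= X w) -> 0 <= E B X.
Proof. exact: Rintegral_ge0. Qed.

Lemma E_le_ae X Y B : measurable B -> intg X -> intg Y ->
  (\forall w \ae P, B w -> X w <= Y w) -> E B X <= E B Y.
Proof.
move=> mB iX iY XY.
rewrite -subr_ge0 -E_B// E_mkcond.
have iXY := intg_restrict mB (intgB iY iX).
set f := _ \_ B in iXY *.
have -> : E setT f = E setT (fun w => `|f w|).
  congr fine; apply: ae_eq_integral => //.
  - by apply/measurable_EFinP; exact: intg_measurable.
  - by do 2 apply: measurableT_comp => //; exact: intg_measurable.
  apply: filterS XY => w h _; congr EFin.
  rewrite ger0_norm// /f patchE; case: ifPn => // /set_mem /h.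
  by rewrite subr_ge0.
by apply: E_ge0.
Qed.

Lemma E_le X Y B : measurable B -> intg X -> intg Y ->
  (forall w, B w -> X w <= Y w) -> E B X <= E B Y.
Proof. by move=> mB iX iY XY; apply: E_le_ae => //; apply: aeW. Qed.

Lemma E_eq_ae X Y B : measurable B -> intg X -> intg Y ->
  (\forall w \ae P, B w -> X w = Y w) -> E B X = E B Y.
Proof.
move=> mB iX iY XY; apply/eqP; rewrite eq_le.
by apply/andP; split; apply: E_le_ae => //; apply: filterS XY => w h /h ->.
Qed.

Lemma E_norm X B : measurable B -> intg X -> `|E B X| <= E B (fun w => `|X w|).
Proof. by move=> mB iX; apply: le_normr_Rintegral => //; exact: intgS. Qed.

Lemma E_subset X B C : measurable B -> measurable C -> B `<=` C -> intg X ->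
  (forall w, 0 <= X w) -> E B X <= E C X.
Proof.
move=> mB mC BC iX X0; rewrite (E_split (B := C) iX mC mB).
have -> : C `&` B = B by apply/setIidPr.
by rewrite lerDl E_ge0.
Qed.

Lemma EFin_E X B : measurable B -> intg X ->
  (E B X)%:E = (\int[P]_(w in B) (X w)%:E)%E.
Proof.
by move=> mB iX; rewrite /Rintegral fineK//; apply: integrable_fin_num => //; exact: intgS.
Qed.

Lemma E_eq0_ae X : intg X -> (forall w, 0 <= X w) -> E setT X <= 0 ->
  \forall w \ae P, X w = 0.
Proof.
move=> iX X0 EX0.
have /(ae_eq_integral_abs P measurableT) : measurable_fun setT (EFin \o X).
  by apply/measurable_EFinP; exact: intg_measurable.
have -> : (\int[P]_x `|(EFin \o X) x|)%E = (\int[P]_x (X x)%:E)%E.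
  by apply: eq_integral => w _; rewrite /= ger0_norm.
rewrite -EFin_E//.
have -> : E setT X = 0 by apply/eqP; rewrite eq_le EX0 E_ge0.
by move=> /iffLR /(_ erefl); apply: filterS => w /(_ I) /= [].
Qed.

Lemma E_dominated (X_ : nat -> Omega -> R) X Y B : measurable B ->
  (forall k, measurable_fun setT (X_ k)) -> measurable_fun setT X -> intg Y ->
  (\forall w \ae P, X_ ^~ w @ \oo --> X w) ->
  (\forall w \ae P, forall k, `|X_ k w| <= Y w) ->
  intg X /\ E B (X_ k) @[k --> \oo] --> E B X.
Proof.
move=> mB mX_ mX iY cX leY.
have [||||| iX _ _] := @dominated_convergence _ _ _ P setT measurableT
  (fun k => EFin \o X_ k) (EFin \o X) (EFin \o Y).
- by move=> k; exact/measurable_EFinP.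
- exact/measurable_EFinP.
- by apply: filterS cX => w h _; apply/fine_cvgP; split; [exact: nearW|].
- exact: iY.
- by apply: filterS leY => w h k _; rewrite lee_fin.
split; first exact: iX.
have [||||| _ _ c] := @dominated_convergence _ _ _ P B mB
  (fun k => EFin \o X_ k) (EFin \o X) (EFin \o Y).
- by move=> k; apply: measurable_funTS; exact/measurable_EFinP.
- by apply: measurable_funTS; exact/measurable_EFinP.
- by apply: filterS cX => w h _; apply/fine_cvgP; split; [exact: nearW|].
- exact: intgS.
- by apply: filterS leY => w h k _; rewrite lee_fin.
apply: fine_cvg; rewrite fineK; first exact: c.
by apply: integrable_fin_num => //; exact: intgS.
Qed.

Lemma E_dominated_cvg (X_ : nat -> Omega -> R) X Y B : measurable B ->
  (forall k, measurable_fun setT (X_ k)) -> measurable_fun setT X -> intg Y ->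
  (\forall w \ae P, X_ ^~ w @ \oo --> X w) ->
  (\forall w \ae P, forall k, `|X_ k w| <= Y w) ->
  E B (X_ k) @[k --> \oo] --> E B X.
Proof. by move=> mB mX_ mX iY cX leY; have [] := E_dominated mB mX_ mX iY cX leY. Qed.

Lemma fatou_intg (X_ : nat -> Omega -> R) X (M : R) :
  (forall k, intg (X_ k)) -> measurable_fun setT X ->
  (forall k, E setT (fun w => `|X_ k w|) <= M) ->
  (\forall w \ae P, X_ ^~ w @ \oo --> X w) ->
  intg X.
Proof.
move=> iX_ mX leM cX; apply/integrableP; split; first exact/measurable_EFinP.
pose f k w := `|(X_ k w)%:E|%E.
have mf k : measurable_fun setT (f k).
  by apply: measurableT_comp => //; apply/measurable_EFinP; exact: intg_measurable.
apply: (@le_lt_trans _ _ (\int[P]_w limn_einf (f ^~ w)))%E.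
  apply: ae_ge0_le_integral => //.
  - by do 2 apply: measurableT_comp => //.
  - move=> w _; rewrite limn_einf_lim; apply: lime_ge; first exact: is_cvg_einfs.
    by apply: nearW => n; apply: le_ereal_inf_tmp => _ [k _ <-]; exact: abse_ge0.
  - by apply: measurableT_comp => //; apply: measurable_fun_limn_esup => k; apply: measurableT_comp.
  - apply: filterS cX => w h _.
    have hh : f ^~ w @ \oo --> (`|(X w)%:E|)%E.
      apply: cvg_EFin; first exact: nearW.
      by rewrite /f; apply: cvg_norm.
    by have [-> _] := cvg_limn_einf_sup hh.
have h := @fatou _ _ _ P setT measurableT f mf (fun _ _ _ => abse_ge0 _).
apply: (le_lt_trans h); apply: (@le_lt_trans _ _ M%:E); last exact: ltry.
rewrite limn_einf_lim; apply: lime_le; first exact: is_cvg_einfs.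
apply: nearW => n; apply: (@le_trans _ _ (\int[P]_w f n w)%E).
  by apply: ereal_inf_lbound; exists n => //=.
rewrite [X in (X <= _)%E](_ : _ = (E setT (fun w => `|X_ n w|))%:E) ?lee_fin//.
rewrite EFin_E//; exact: intg_norm.
Qed.

Lemma measurable_set_lt X Y : measurable_fun setT X -> measurable_fun setT Y ->
  measurable [set w | X w < Y w].
Proof.
move=> mX mY; rewrite (_ : mkset _ = setT `&` (fun w => X w < Y w) @^-1` [set true]).
  by apply: measurable_fun_ltr.
by rewrite setTI; apply/seteqP; split=> w /=.
Qed.

Lemma measurable_set_le X Y : measurable_fun setT X -> measurable_fun setT Y ->
  measurable [set w | X w <= Y w].
Proof.
move=> mX mY; rewrite (_ : mkset _ = ~` [set w | Y w < X w]).
  by apply: measurableC; exact: measurable_set_lt.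
by apply/seteqP; split=> w /=; rewrite leNgt => /negP.
Qed.

End expectation.

(** * Uniform integrability *)

Section uniform_integrability.
Context {R : realType} {d : measure_display} {Omega : measurableType d}.
Variable P : probability Omega R.
Implicit Types (X Y Z : Omega -> R) (B C : set Omega).

Local Notation intg X := (P.-integrable [set: Omega] (EFin \o X)).
Local Notation E := (Rintegral P).

Definition clip (c x : R) : R := Num.max (- c) (Num.min c x).

Lemma clip_bound (c x : R) : 0 <= c -> `|clip c x| <= c.
Proof.
move=> c0; rewrite ler_norml /clip le_max lexx /= ge_max ge_min lexx /= andbT.
lra.
Qed.

Lemma clip_id (c x : R) : `|x| <= c -> clip c x = x.
Proof. by rewrite ler_norml /clip => /andP[h1 h2]; rewrite (min_idPr h2) (max_idPr h1). Qed.

Lemma clip_dist (c x : R) : 0 <= c -> `|x - clip c x| <= `|x|.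
Proof.
move=> c0; have [xc|xc] := leP `|x| c; first by rewrite clip_id// subrr normr0.
rewrite /clip; case: (ltP c x) => h1.
  rewrite (max_idPr _) ?ger0_norm; lra.
case: (leP (-c) x) => h2; first by rewrite subrr normr0.
rewrite !ler0_norm; lra.
Qed.

Lemma clip_lipschitz (c x y : R) : `|clip c x - clip c y| <= `|x - y|.
Proof.
have lip_max (a u v : R) : `|Num.max a u - Num.max a v| <= `|u - v|.
  have := ler_norm (u - v); have := ler_norm (v - u); rewrite (distrC v) ler_norml.
  by case: (leP a u) => ?; case: (leP a v) => ? ? ?; apply/andP; split; lra.
have lip_min (a u v : R) : `|Num.min a u - Num.min a v| <= `|u - v|.
  have := ler_norm (u - v); have := ler_norm (v - u); rewrite (distrC v) ler_norml.
  by case: (leP a u) => ?; case: (leP a v) => ? ? ?; apply/andP; split; lra.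
exact: le_trans (lip_max _ _ _) (lip_min _ _ _).
Qed.

Lemma measurable_clip (c : R) X : measurable_fun setT X ->
  measurable_fun setT (fun w => clip c (X w)).
Proof.
move=> mX; apply: measurable_maxr; first exact: measurable_cst.
by apply: measurable_minr => //; exact: measurable_cst.
Qed.

Lemma cvg_clip (c : R) (x_ : nat -> R) (x : R) :
  x_ @ \oo --> x -> (fun k => clip c (x_ k)) @ \oo --> clip c x.
Proof.
move=> cx; apply/cvgrPdist_le => e e0.
have := cx => /cvgrPdist_le /(_ _ e0); apply: filterS => k; apply: le_trans.
exact: clip_lipschitz.
Qed.

Lemma measurable_norm_gt X (c : R) : measurable_fun setT X ->
  measurable [set w | c < `|X w|].
Proof.
move=> mX; apply: measurable_set_lt; first exact: measurable_cst.
exact: measurableT_comp.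
Qed.

Lemma markov_le X (c : R) : 0 < c -> intg X ->
  c * fine (P [set w | c < `|X w|]) <= E setT (fun w => `|X w|).
Proof.
move=> c0 iX; have mC := measurable_norm_gt c (intg_measurable iX).
rewrite -E_cst//; apply: (@le_trans _ _ (E [set w | c < `|X w|] (fun w => `|X w|))).
  apply: E_le => //; [exact: intg_cst|exact: intg_norm|].
  by move=> w /ltW.
by apply: E_subset => //; exact: intg_norm.
Qed.

Lemma uniform_absolute_continuity Y (e : R) : intg Y -> 0 < e ->
  exists2 dl : R, 0 < dl & forall B, measurable B -> fine (P B) < dl ->
    E B (fun w => `|Y w|) < e.
Proof.
move=> iY e0; have [dl [dl0 h]] := integral_normr_continuous iY e0.
exists dl => // B mB PB; apply: h => //.
rewrite -[ltLHS]fineK ?lte_fin//; exact: fin_num_measure.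
Qed.

(** The tails of each [X_ k] are those of conditional expectations of one
    integrable [Y]; by Markov they are uniformly small, so one can clip at a
    level that serves all [k] and use dominated convergence. *)
Lemma E_cvg_dominated_tails (X_ : nat -> Omega -> R) X Y :
  (forall k, intg (X_ k)) -> measurable_fun setT X -> intg Y ->
  (forall (k : nat) (c : R), 0 < c -> E [set w | c < `|X_ k w|] (fun w => `|X_ k w|) <=
                        E [set w | c < `|X_ k w|] (fun w => `|Y w|)) ->
  (\forall w \ae P, X_ ^~ w @ \oo --> X w) ->
  intg X /\ forall B, measurable B -> E B (X_ k) @[k --> \oo] --> E B X.
Proof.
move=> iX_ mX iY tail cX.
have mgt k c := measurable_norm_gt c (intg_measurable (iX_ k)).
pose M := 1 + E setT (fun w => `|Y w|).
have M0 : 0 < M by rewrite /M ltr_pwDl// E_ge0.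
have leM k : E setT (fun w => `|X_ k w|) <= M.
  rewrite (E_split (C := [set w | 1 < `|X_ k w|]) (intg_norm (iX_ k)) measurableT)//.
  rewrite addrC lerD//.
    apply: (@le_trans _ _ (E (~` [set w | 1 < `|X_ k w|]) (fun=> 1))).
      rewrite setTD; apply: E_le => //; [exact: measurableC|exact: intg_norm|exact: intg_cst|].
      by move=> w /= /negP; rewrite -leNgt.
    rewrite E_cst ?mul1r; last exact: measurableC.
    rewrite -lee_fin fineK; last by apply: fin_num_measure; exact: measurableC.
    by apply: probability_le1; exact: measurableC.
  rewrite setTI; apply: le_trans (tail k 1 ltr01) _.
  by apply: E_subset => //; exact: intg_norm.
have iX : intg X by exact: (fatou_intg (M := M) iX_ mX leM cX).
split=> // B mB.
apply/cvgrPdist_le => /= e e0.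
have e3 : 0 < e / 3 by rewrite divr_gt0.
have [dl dl0 ac] := uniform_absolute_continuity iY e3.
have iclip (c : R) Z : 0 <= c -> measurable_fun setT Z -> intg (fun w => clip c (Z w)).
  move=> c0 mZ; apply: (@intg_bounded _ _ _ _ _ c); first exact: measurable_clip.
  by apply: aeW => w; exact: clip_bound.
have cc : E setT (fun w => `|X w - clip k%:R (X w)|) @[k --> \oo] --> E setT (fun=> (0:R)).
  apply: (E_dominated_cvg (Y := fun w => `|X w|)) => //.
  - move=> k; apply: measurableT_comp => //; apply: measurable_funB => //.
    exact: measurable_clip.
  - exact: intg_norm.
  - apply: aeW => w; apply: cvg_near_cst.
    near=> k; rewrite clip_id ?subrr ?normr0//.
    by near: k; exact: nbhs_infty_ger.
  - by apply: aeW => w k; rewrite normr_id; exact: clip_dist.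
have {}cc : \forall k \near \oo, E setT (fun w => `|X w - clip k%:R (X w)|) <= e / 3.
  have := cc; rewrite E_cst// mul0r => /cvgrPdist_le /(_ _ e3); apply: filterS => k.
  by rewrite sub0r normrN; apply: le_trans; exact: ler_norm.
have [n [n1 n2 n3]] : exists n : nat, [/\ (0 < n)%N, M < dl * n%:R &
    E setT (fun w => `|X w - clip n%:R (X w)|) <= e / 3].
  near \oo => n; exists n; split.
  - by near: n; exact: nbhs_infty_gt.
  - rewrite mulrC -ltr_pdivrMr//; near: n; exact: nbhs_infty_gtr.
  - by near: n.
have n0 : (0 : R) < n%:R by rewrite ltr0n.
set c : R := n%:R in n2 n3 n0 *.
have mXk k := intg_measurable (iX_ k).
have tl k : E setT (fun w => `|X_ k w - clip c (X_ k w)|) <= e / 3.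
  have -> : E setT (fun w => `|X_ k w - clip c (X_ k w)|) =
            E [set w | c < `|X_ k w|] (fun w => `|X_ k w - clip c (X_ k w)|).
    rewrite [RHS]Rintegral_mkcond; apply: eq_Rintegral => w _.
    rewrite patchE; case: ifPn => // /negP; rewrite inE /= => /negP.
    by rewrite -leNgt => /clip_id ->; rewrite subrr normr0.
  have iXc : intg (fun w => `|X_ k w - clip c (X_ k w)|).
    apply: intg_norm; apply: intgB => //; apply: iclip => //; exact: ltW.
  apply: (@le_trans _ _ (E [set w | c < `|X_ k w|] (fun w => `|X_ k w|))).
    by apply: E_le => //; [exact: intg_norm|move=> w _; apply: clip_dist; exact: ltW].
  apply: le_trans (tail k c n0) _; apply: ltW; apply: ac => //.
  rewrite -(ltr_pM2l n0); apply: le_lt_trans (markov_le n0 (iX_ k)) _.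
  by apply: le_lt_trans (leM k) _; rewrite mulrC.
have cb : E B (fun w => clip c (X_ k w)) @[k --> \oo] --> E B (fun w => clip c (X w)).
  apply: (E_dominated_cvg (Y := fun=> c)) => //.
  - by move=> k; exact: measurable_clip.
  - exact: measurable_clip.
  - exact: intg_cst.
  - by apply: filterS cX => w h; exact: cvg_clip.
  - by apply: aeW => w k; apply: clip_bound; exact: ltW.
have sub Z : intg Z -> `|E B Z - E B (fun w => clip c (Z w))| <= E setT (fun w => `|Z w - clip c (Z w)|).
  move=> iZ; have iZc : intg (fun w => clip c (Z w)).
    by apply: (iclip c Z (ltW n0)); exact: intg_measurable iZ.
  rewrite -E_B//; apply: le_trans (E_norm mB (intgB iZ iZc)) _.
  by apply: E_subset => //; apply: intg_norm; exact: intgB.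
have := cb => /cvgrPdist_le /(_ _ e3); apply: filterS => k hk.
have h1 := le_trans (sub _ iX) n3; have h2 := le_trans (sub _ (iX_ k)) (tl k).
move: h1 h2 hk; rewrite !ler_norml; move=> /andP[? ?] /andP[? ?] /andP[? ?].
by apply/andP; split; lra.
Unshelve. all: by end_near.
Qed.

End uniform_integrability.

(** * Sub-sigma-algebras and conditional expectation *)

Section sub_sigma_algebra.
Context {R : realType} {d : measure_display} {Omega : measurableType d}.
Variable P : probability Omega R.
Implicit Types (X Y Z : Omega -> R) (B C : set Omega).

Local Notation intg X := (P.-integrable [set: Omega] (EFin \o X)).
Local Notation E := (Rintegral P).

Variable H : set (set Omega).
Hypothesis sH : sigma_algebra [set: Omega] H.

Lemma salgebra0 : H set0. Proof. by case: sH. Qed.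

Lemma salgebraC B : H B -> H (~` B).
Proof. by case: sH => _ h _ /h; rewrite setTD. Qed.

Lemma salgebraT : H setT.
Proof. by rewrite -setC0; apply: salgebraC; exact: salgebra0. Qed.

Lemma salgebra_bigcup (B : nat -> set Omega) : (forall n, H (B n)) -> H (\bigcup_n B n).
Proof. by case: sH => _ _; exact. Qed.

Lemma salgebraU B C : H B -> H C -> H (B `|` C).
Proof.
by move=> hB hC; rewrite -bigcup2E; apply: salgebra_bigcup => -[|[|n]] //=; exact: salgebra0.
Qed.

Lemma salgebraI B C : H B -> H C -> H (B `&` C).
Proof.
move=> hB hC; rewrite -[X in H X]setCK setCI; apply: salgebraC.
by apply: salgebraU; exact: salgebraC.
Qed.

Lemma salgebraD B C : H B -> H C -> H (B `\` C).
Proof. by move=> hB hC; rewrite setDE; apply: salgebraI => //; exact: salgebraC. Qed.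

Local Notation OmegaH := (g_sigma_algebraType H).

Lemma measurableH B : (measurable : set (set OmegaH)) B <-> H B.
Proof. by rewrite [X in X B]measurable_g_measurableTypeE. Qed.

(** Measurability with respect to [H] is measurability on [Omega] seen as the
    measurable type with sigma-algebra [H]; this gives access to the general
    closure properties of measurable functions. *)
Lemma measurable_wrtP X :
  measurable_wrt H X <-> measurable_fun (setT : set OmegaH) (X : OmegaH -> R).
Proof.
split=> [h _ B mB|h B mB].
  by rewrite setTI; apply/measurableH; exact: h.
by apply/measurableH; rewrite -[X in _ X]setTI; apply: h.
Qed.

Lemma measurable_wrt_cvg (X_ : nat -> Omega -> R) X :
  (forall k, measurable_wrt H (X_ k)) -> (forall w, X_ ^~ w @ \oo --> X w) ->
  measurable_wrt H X.
Proof.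
move=> hX cX; apply/measurable_wrtP.
apply: (@measurable_fun_cvg _ OmegaH R setT X_ X) => // k.
by apply/measurable_wrtP; exact: hX.
Qed.

Lemma measurable_wrt_restrict X C : H C -> measurable_wrt H X ->
  measurable_wrt H (X \_ C).
Proof.
move=> HC hX; apply/measurable_wrtP.
apply/(@measurable_restrictT _ _ OmegaH _ C X); first exact/measurableH.
by apply: measurable_funTS; apply/measurable_wrtP.
Qed.

Lemma measurable_wrt_cst (c : R) : measurable_wrt H (fun=> c).
Proof. by apply/measurable_wrtP; exact: measurable_cst. Qed.

Lemma measurable_wrtD X Y : measurable_wrt H X -> measurable_wrt H Y ->
  measurable_wrt H (fun w => X w + Y w).
Proof.
by move=> /measurable_wrtP hX /measurable_wrtP hY; apply/measurable_wrtP; exact: measurable_funD.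
Qed.

Lemma measurable_wrtB X Y : measurable_wrt H X -> measurable_wrt H Y ->
  measurable_wrt H (fun w => X w - Y w).
Proof.
by move=> /measurable_wrtP hX /measurable_wrtP hY; apply/measurable_wrtP; exact: measurable_funB.
Qed.

Lemma measurable_wrt_min X Y : measurable_wrt H X -> measurable_wrt H Y ->
  measurable_wrt H (fun w => Num.min (X w) (Y w)).
Proof.
by move=> /measurable_wrtP hX /measurable_wrtP hY; apply/measurable_wrtP; exact: measurable_minr.
Qed.

Hypothesis Hm : H `<=` measurable.

Lemma measurable_wrt_measurable X : measurable_wrt H X -> measurable_fun setT X.
Proof. by move=> h _ B mB; rewrite setTI; apply: Hm; exact: h. Qed.

Lemma measurable_wrt_lt X Y : measurable_wrt H X -> measurable_wrt H Y ->
  H [set w | X w < Y w].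
Proof.
by move=> /measurable_wrtP hX /measurable_wrtP hY; apply/measurableH; exact: measurable_set_lt.
Qed.

Lemma measurable_wrt_le X Y : measurable_wrt H X -> measurable_wrt H Y ->
  H [set w | X w <= Y w].
Proof.
by move=> /measurable_wrtP hX /measurable_wrtP hY; apply/measurableH; exact: measurable_set_le.
Qed.

(** The event [Y < X] belongs to [H], so that the comparison can be tested on it. *)
Lemma ae_le_of_E X Y : measurable_wrt H X -> measurable_wrt H Y ->
  intg X -> intg Y -> (forall B, H B -> E B X <= E B Y) ->
  \forall w \ae P, X w <= Y w.
Proof.
move=> hX hY iX iY EXY; have HB := measurable_wrt_lt hY hX.
set B := [set w | _] in HB; have mB := Hm HB.
have i1 := intg_restrict mB (intgB iX iY).
have : \forall w \ae P, ((fun w => X w - Y w) \_ B) w = 0.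
  apply: E_eq0_ae => //.
    move=> w; rewrite patchE; case: ifP => // /set_mem /=.
    by rewrite subr_ge0 => /ltW.
  by rewrite -E_mkcond E_B// subr_le0; exact: EXY.
apply: filterS => w; rewrite patchE; case: ifPn.
  by move=> _ /eqP; rewrite subr_eq0 => /eqP ->.
by move=> /negP + _; rewrite inE /B /= => /negP; rewrite -leNgt.
Qed.

Lemma measurable_idH : measurable_fun [set: Omega] (idfun : Omega -> OmegaH).
Proof. by move=> _ B mB; rewrite setTI; apply: Hm; exact/measurableH. Qed.

(** Radon-Nikodym on [Omega] with the sigma-algebra [H], for the charge that has
    density [Y]. *)
Lemma ex_cond_exp Y : intg Y -> exists Z, [/\ measurable_wrt H Z, intg Z &
  forall B, H B -> E B Z = E B Y].
Proof.
move=> iY.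
pose idH : {mfun Omega >-> OmegaH} :=
  HB.pack (idfun : Omega -> OmegaH) (isMeasurableFun.Build _ _ _ _ _ measurable_idH).
pose mu := distribution P idH.
pose nu0 := induced_charge iY.
have mOH (B : set OmegaH) : measurable B -> d.-measurable (B : set Omega).
  by move=> mB; apply: Hm; exact/measurableH.
have nu00 : nu0 set0 = 0%E by exact: charge0.
have nufin (B : set OmegaH) : measurable B -> nu0 B \is a fin_num.
  by move=> mB; apply: fin_num_measure; exact: mOH.
have nus : semi_sigma_additive (nu0 : set OmegaH -> \bar R).
  move=> F mF tF mUF; apply: charge_semi_sigma_additive => //; first by move=> n; exact: mOH.
  exact: mOH.
pose nu : {charge set OmegaH -> \bar R} :=
  HB.pack (nu0 : set OmegaH -> \bar R) (isCharge.Build _ _ _ (nu0 : set OmegaH -> \bar R) nu00 nufin nus).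
have numu : nu `<< mu.
  apply/null_content_dominatesP => B mB muB0.
  rewrite /nu /= /nu0 /induced_charge; apply: null_set_integral => //; first exact: mOH.
  by apply: measurable_funTS; exact: measurable_int iY.
have finZ w : Radon_Nikodym nu mu w \is a fin_num by exact: Radon_Nikodym_fin_num.
have /integrableP[m1 m2] := Radon_Nikodym_integrable numu.
pose Z w := fine (Radon_Nikodym nu mu w).
have ZE w : (Z w)%:E = Radon_Nikodym nu mu w by rewrite /Z fineK.
have hZ : measurable_wrt H Z.
  by apply/measurable_wrtP; apply: measurableT_comp.
exists Z.
have iZ : intg Z.
  apply/integrableP; split.
    by apply/measurable_EFinP; exact: measurable_wrt_measurable.
  move: m2; rewrite ge0_integral_distribution//; last by apply: measurableT_comp.
  congr (_ < _)%E; apply: eq_integral => w _.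
  exact: (congr1 abse (esym (ZE w))).
split => // B HB; congr fine.
transitivity (\int[P]_(w in idH @^-1` (B : set OmegaH)) ((Radon_Nikodym nu mu) \o idH) w)%E.
  by apply: eq_integral => w _; exact: ZE.
rewrite -integral_pushforward//.
- have mB : (measurable : set (set OmegaH)) B by exact/measurableH.
  exact: (esym (Radon_Nikodym_integral numu mB)).
- apply: (@eq_integrable _ _ _ P (idH @^-1` (B : set OmegaH)) (Hm HB) (EFin \o Z)).
    by move=> w _; exact: ZE.
  by apply: intgS => //; exact: Hm.
- exact/measurableH.
Qed.

Hypothesis cH : forall N, P.-negligible N -> H N.

Lemma measurable_wrt_ae_eq X Y : measurable_wrt H X ->
  (\forall w \ae P, X w = Y w) -> measurable_wrt H Y.
Proof.
move=> hX XY B mB; set N := [set w | X w = Y w].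
have HN : H (~` N) by apply: cH.
have -> : Y @^-1` B = (X @^-1` B `&` N) `|` (Y @^-1` B `&` ~` N).
  apply/seteqP; split => w /=.
    by move=> BY; have [XYw|nXY] := pselect (X w = Y w); [left; rewrite XYw|right].
  by case=> -[h //]; rewrite /N /= => <-.
apply: salgebraU => //.
  apply: salgebraI => //; first exact: hX.
  by rewrite -[N]setCK; exact: salgebraC.
by apply: cH; apply: (negligibleS (A := ~` N)) => [w []|//].
Qed.

Lemma measurable_wrt_cvg_ae (X_ : nat -> Omega -> R) X :
  (forall k, measurable_wrt H (X_ k)) ->
  (\forall w \ae P, X_ ^~ w @ \oo --> X w) -> measurable_wrt H X.
Proof.
move=> hX cX; set C := [set w | X_ ^~ w @ \oo --> X w].
have HC : H C by rewrite -[C]setCK; apply: salgebraC => //; exact: cH.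
apply: (measurable_wrt_ae_eq (X := X \_ C)).
  apply: (measurable_wrt_cvg (X_ := fun k => X_ k \_ C)) => [k|w].
    exact: measurable_wrt_restrict.
  have [Cw|nCw] := pselect (C w).
    rewrite patchE mem_set// (_ : (fun k => _) = X_ ^~ w); first exact: Cw.
    by apply/funext => k; rewrite patchE mem_set.
  rewrite patchE memNset// (_ : (fun k => _) = (fun=> 0)); first exact: cvg_cst.
  by apply/funext => k; rewrite patchE memNset.
by apply: filterS cX => w Cw; rewrite patchE mem_set.
Qed.

End sub_sigma_algebra.

(** * Upcrossings and one-sided limits *)

Section near_sides.
Context {R : realType}.
Implicit Types (u v x : R) (Q : R -> Prop).

Lemma near_rightP u Q :
  (\forall x \near u^'+, Q x) <-> exists2 v, u < v & forall x, u < x < v -> Q x.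
Proof.
split=> [[e /= e0 h]|[v uv h]].
  exists (u + e); first by rewrite ltrDl.
  move=> x /andP[ux xe]; apply: h => //=.
  by rewrite distrC ger0_norm ?subr_ge0 1?ltW// ltrBlDr addrC.
have h1 := nbhs_right_gt u; have h2 := nbhs_right_lt uv.
by apply: filterS2 h1 h2 => x h3 h4; apply: h; rewrite h3.
Qed.

Lemma near_leftP u Q :
  (\forall x \near u^'-, Q x) <-> exists2 v, v < u & forall x, v < x < u -> Q x.
Proof.
split=> [[e /= e0 h]|[v uv h]].
  exists (u - e); first by rewrite ltrBlDr ltrDl.
  move=> x /andP[ux xe]; apply: h => //=.
  by rewrite ger0_norm ?subr_ge0 1?ltW// ltrBlDr addrC -ltrBlDr.
have h1 := nbhs_left_lt u; have h2 := nbhs_left_gt uv.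
by apply: filterS2 h1 h2 => x h3 h4; apply: h; rewrite h3 h4.
Qed.

End near_sides.

Section upcrossings.
Context {R : realType}.
Variables (a b : R).
Hypothesis ab : a < b.

(** Number of passages from below [a] to above [b] completed by a finite
    sequence; [h] says whether a passage is under way. *)
Fixpoint upcrossings (h : bool) (l : seq R) : nat :=
  if l is x :: l' then
    if h then (if b < x then (upcrossings false l').+1 else upcrossings true l')
    else (if x < a then upcrossings true l' else upcrossings false l')
  else 0%N.

Lemma upcrossings_start l : (upcrossings false l <= upcrossings true l)%N.
Proof.
elim: l => //= x l IH; case: ltP => xa; case: ltP => bx //.
by have := lt_trans xa (lt_trans ab bx); rewrite ltxx.
Qed.

Lemma upcrossings_under_way l : (upcrossings true l <= (upcrossings false l).+1)%N.
Proof.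
elim: l => //= x l IH; case: ltP => bx; case: ltP => xa //.
by rewrite ltnS upcrossings_start.
Qed.

Lemma upcrossings_cons h x l : (upcrossings h l <= upcrossings h (x :: l))%N.
Proof.
case: h => /=; case: ifP => // _; first exact: upcrossings_under_way.
exact: upcrossings_start.
Qed.

Lemma upcrossings_subseq h l l' : subseq l l' -> (upcrossings h l <= upcrossings h l')%N.
Proof.
elim: l' l h => [|x l' IH] [|y l] h //.
rewrite [subseq _ _]/=; case: eqP => [->|_] sl; last first.
  exact: leq_trans (IH _ h sl) (upcrossings_cons _ _ _).
by case: h => /=; case: ifP => _; rewrite ?ltnS; exact: IH.
Qed.

Lemma upcrossings_rcons h l x y : x < a -> b < y ->
  ((upcrossings h l).+1 <= upcrossings h (l ++ [:: x; y]))%N.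
Proof.
move=> xa yb; elim: l h => [|z l IH] h /=.
  case: h => /=; last by rewrite xa yb.
  by case: ifP => //; rewrite yb.
by case: h; case: ifP => _; rewrite ?ltnS; exact: IH.
Qed.

End upcrossings.

Section regulated.
Context {R : realType}.
Variables (Q : R -> Prop) (s t : R) (f : R -> R) (c : R).
Hypothesis denseQ : forall u v, s <= u -> v <= t -> u < v -> exists2 q, Q q & u < q < v.
Hypothesis f_bounded : forall q, Q q -> 0 <= f q <= c.
Hypothesis few_upcrossings : forall a b : rat, 0 <= a -> a < b ->
  exists m, forall l : seq R, (forall q, q \in l -> Q q) -> sorted <%R l ->
    (upcrossings (ratr a) (ratr b) false (map f l) <= m)%N.

(** The exceptional sets of the upcrossing bounds are indexed by bands, so only
    countably many bands can be used. *)
Lemma rational_band (a b : R) : 0 <= a -> a < b -> exists a' b' : rat,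
  [/\ 0 <= a', a' < b', a <= ratr a' & ratr b' <= b].
Proof.
move=> a0 ab; have [a'] := rat_in_itvoo ab; rewrite in_itv /= => /andP[aa' a'b].
have [b'] := rat_in_itvoo a'b; rewrite in_itv /= => /andP[a'b' b'b].
exists a', b'; split; rewrite ?(ltW aa') ?(ltW b'b)//; last by rewrite ltr_rat in a'b'.
by rewrite -(ler_rat R) rmorph0; apply: le_trans a0 _; exact: ltW.
Qed.

(** Points with values below [a] and above [b] alternate towards [u]: a list of
    them with many upcrossings is extended at its head. *)
Lemma unbounded_upcrossings_right u a b : 0 <= a -> a < b ->
  (forall v, u < v -> exists q, [/\ Q q, u < q < v & f q < a]) ->
  (forall v, u < v -> exists q, [/\ Q q, u < q < v & b < f q]) -> False.
Proof.
move=> ra rab ra0 rb0; have [a' [b' [a0 ab aa bb]]] := rational_band ra rab.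
have [m few] := few_upcrossings a0 ab.
have fa v (uv : _) := let: ex_intro q (And3 h1 h2 h3) := ra0 v uv in
  ex_intro (fun q => [/\ Q q, _ & f q < ratr a']) q (And3 h1 h2 (lt_le_trans h3 aa)).
have fb v (uv : _) := let: ex_intro q (And3 h1 h2 h3) := rb0 v uv in
  ex_intro (fun q => [/\ Q q, _ & ratr b' < f q]) q (And3 h1 h2 (le_lt_trans bb h3)).
suff: forall k, exists l v, [/\ u < v, (forall q, q \in l -> Q q /\ v <= q),
    sorted <%R l & (k <= upcrossings (ratr a') (ratr b') false (map f l))%N].
  move=> /(_ m.+1)[l [v [uv lQ sl]]].
  have := few l _ sl; rewrite leqNgt => /(_ _)/negP h /h; apply.
  by move=> q /lQ[].
elim=> [|k [l [v [uv lQ sl kl]]]].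
  by exists [::], (u + 1); split => //; rewrite ltrDl.
have [y [Qy /andP[uy yv] fy]] := fb v uv.
have [x [Qx /andP[ux xy] fx]] := fa y uy.
exists [:: x, y & l], x; split => //.
- move=> q; rewrite !inE => /or3P[/eqP->//|/eqP->|/lQ[Qq vq]]; split => //; first exact: ltW.
  by apply: ltW; apply: lt_le_trans vq; exact: lt_trans xy yv.
- rewrite /= xy /=; case: l lQ sl {kl} => //= z l lQ ->; rewrite andbT.
  by apply: lt_le_trans yv _; have [] := lQ z (mem_head _ _).
- by rewrite /= fx fy.
Qed.

(** Here the list is extended at its end. *)
Lemma unbounded_upcrossings_left u a b : 0 <= a -> a < b ->
  (forall v, v < u -> exists q, [/\ Q q, v < q < u & f q < a]) ->
  (forall v, v < u -> exists q, [/\ Q q, v < q < u & b < f q]) -> False.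
Proof.
move=> ra rab ra0 rb0; have [a' [b' [a0 ab aa bb]]] := rational_band ra rab.
have [m few] := few_upcrossings a0 ab.
have fa v (uv : _) := let: ex_intro q (And3 h1 h2 h3) := ra0 v uv in
  ex_intro (fun q => [/\ Q q, _ & f q < ratr a']) q (And3 h1 h2 (lt_le_trans h3 aa)).
have fb v (uv : _) := let: ex_intro q (And3 h1 h2 h3) := rb0 v uv in
  ex_intro (fun q => [/\ Q q, _ & ratr b' < f q]) q (And3 h1 h2 (le_lt_trans bb h3)).
suff: forall k, exists l v, [/\ v < u, (forall q, q \in l -> Q q /\ q <= v),
    sorted <%R l & (k <= upcrossings (ratr a') (ratr b') false (map f l))%N].
  move=> /(_ m.+1)[l [v [uv lQ sl]]].
  have := few l _ sl; rewrite leqNgt => /(_ _)/negP h /h; apply.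
  by move=> q /lQ[].
elim=> [|k [l [v [uv lQ sl kl]]]].
  by exists [::], (u - 1); split => //; rewrite ltrBlDr ltrDl.
have [x [Qx /andP[vx xu] fx]] := fa v uv.
have [y [Qy /andP[xy yu] fy]] := fb x xu.
exists (l ++ [:: x; y]), y; split => //.
- move=> q; rewrite mem_cat !inE => /or3P[/lQ[Qq vq]|/eqP->|/eqP->//]; split => //; last exact: ltW.
  by apply: le_trans vq _; apply: ltW; exact: lt_trans vx xy.
- case: l lQ sl {kl} => [|z l] lQ sl /=; first by rewrite xy.
  move: sl => /= sl; rewrite cat_path sl /= xy !andbT; apply: le_lt_trans vx.
  by have [] := lQ (last z l) (mem_last _ _).
- by rewrite map_cat /=; apply: leq_trans (upcrossings_rcons false _ fx fy); rewrite ltnS.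
Qed.

(** A cluster point of [f] exists by boundedness; if [f] did not converge to it,
    [f] would pass infinitely often through a band next to it. *)
Lemma regulated_limit (W : set_system R) : ProperFilter W -> (\forall q \near W, Q q) ->
  (forall a b, 0 <= a -> a < b -> ~ (\forall q \near W, ~ f q < a) ->
     ~ (\forall q \near W, ~ b < f q) -> False) ->
  exists L : R, f @ W --> L.
Proof.
move=> FW WQ cross.
have fW : (f @ W) `[0, c]%classic.
  by apply: filterS WQ => q Qq /=; rewrite in_itv /=; exact: f_bounded.
have [L [/= L0c clL]] := segment_compact (fmap_proper_filter f FW) fW.
have L0 : 0 <= L by move: L0c; rewrite in_itv => /andP[].
have often (e : R) : 0 < e -> ~ (\forall q \near W, ~ (L - e < f q < L + e)).
  move=> e0 h.
  have [x [/= h1 h2]] := clL [set y | ~ (L - e < y < L + e)] (ball L e) h (nbhsx_ballx _ _ e0).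
  apply: h1.
  by move: h2; rewrite /ball /= ltr_distlC.
exists L; apply/cvgrPdist_le => e e0; apply: contrapT => h.
have far : ~ (\forall q \near W, ~ (L + e < f q)) \/ ~ (\forall q \near W, ~ (f q < L - e)).
  apply: contrapT => /not_orP[/contrapT h1 /contrapT h2]; apply: h.
  apply: filterS2 h1 h2 => q /negP h1 /negP h2.
  by rewrite distrC ler_distl !leNgt h1 h2.
have e2 : 0 < e / 2 by rewrite divr_gt0.
case: far => far.
  apply: (cross (L + e / 2) (L + e)) => //; [lra|lra|].
  move=> h1; apply: (often _ e2); apply: filterS h1 => q h1 /andP[_ h2].
  exact: h1.
have [Le|Le] := ltP L e.
  apply: far; apply: filterS WQ => q /f_bounded /andP[h1 _].
  by apply/negP; rewrite -leNgt; apply: le_trans h1; rewrite subr_le0 ltW.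
apply: (cross (L - e) (L - e / 2)) => //; [lra|lra|].
move=> h1; apply: (often _ e2); apply: filterS h1 => q h1 /andP[h2 _].
exact: h1.
Qed.

Lemma regulated_right u : s <= u -> u < t -> exists L : R, forall e, 0 < e ->
  exists2 v, u < v & forall q, Q q -> u < q < v -> `|f q - L| <= e.
Proof.
move=> su ut; pose W := within Q u^'+.
have Wneg (S : R -> Prop) : ~ (\forall q \near W, ~ S q) ->
    forall v, u < v -> exists q, [/\ Q q, u < q < v & S q].
  move=> h v uv; apply: contrapT => /forallNP h2; apply: h.
  rewrite /W near_withinE; apply/near_rightP; exists v => // q uq Qq Sq.
  by apply: (h2 q); split.
have FW : ProperFilter W.
  apply: Build_ProperFilter_ex.
  move=> S; rewrite /W /within /= => /near_rightP[v uv h].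
  have [q Qq /andP[h1 h2]] : exists2 q, Q q & u < q < Num.min v t.
    by apply: denseQ => //; [rewrite ge_min lexx orbT|rewrite lt_min uv].
  exists q; apply: h => //; rewrite h1 /=; apply: lt_le_trans h2 _.
  by rewrite ge_min lexx.
have [|a b a0 ab h1 h2|L fL] := regulated_limit FW.
- by rewrite /W near_withinE; apply: nearW.
- by apply: (unbounded_upcrossings_right a0 ab (Wneg _ h1) (Wneg _ h2)).
exists L => e e0; have := fL => /cvgrPdist_le /(_ _ e0).
rewrite /W near_withinE => /near_rightP[v uv h]; exists v => // q Qq uq.
by rewrite distrC; exact: h.
Qed.

Lemma regulated_left u : s < u -> u <= t -> exists L : R, forall e, 0 < e ->
  exists2 v, v < u & forall q, Q q -> v < q < u -> `|f q - L| <= e.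
Proof.
move=> su ut; pose W := within Q u^'-.
have Wneg (S : R -> Prop) : ~ (\forall q \near W, ~ S q) ->
    forall v, v < u -> exists q, [/\ Q q, v < q < u & S q].
  move=> h v uv; apply: contrapT => /forallNP h2; apply: h.
  rewrite /W near_withinE; apply/near_leftP; exists v => // q uq Qq Sq.
  by apply: (h2 q); split.
have FW : ProperFilter W.
  apply: Build_ProperFilter_ex.
  move=> S; rewrite /W /within /= => /near_leftP[v uv h].
  have [q Qq /andP[h1 h2]] : exists2 q, Q q & Num.max v s < q < u.
    by apply: denseQ => //; [rewrite le_max lexx orbT|rewrite gt_max uv].
  exists q; apply: h => //; rewrite h2 andbT; apply: le_lt_trans h1.
  by rewrite le_max lexx.
have [|a b a0 ab h1 h2|L fL] := regulated_limit FW.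
- by rewrite /W near_withinE; apply: nearW.
- by apply: (unbounded_upcrossings_left a0 ab (Wneg _ h1) (Wneg _ h2)).
exists L => e e0; have := fL => /cvgrPdist_le /(_ _ e0).
rewrite /W near_withinE => /near_leftP[v uv h]; exists v => // q Qq uq.
by rewrite distrC; exact: h.
Qed.

End regulated.

(** * Conditional expectations as right-continuous processes *)

Section almost_sure.
Context {R : realType} {d : measure_display} {Omega : measurableType d}.
Variable P : probability Omega R.

Lemma ae_forall_countable (I : countType) (Q : I -> Omega -> Prop) :
  (forall i, \forall w \ae P, Q i w) -> \forall w \ae P, forall i, Q i w.
Proof.
move=> h; have := @ae_foralln _ _ _ P
  (fun n w => if unpickle n is Some i then Q i w else True).
move=> /(_ _)/filterS; apply; last first.
  by move=> n; case: (unpickle n) => [i|]; [exact: h|exact: aeW].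
by move=> w hw i; have := hw (pickle i); rewrite pickleK.
Qed.

Lemma fine_measure_ge0 (B : set Omega) : 0 <= fine (P B).
Proof. by rewrite fine_ge0. Qed.

Lemma fine_measure_bigcup_le (A : nat -> set Omega) (c : R) :
  (forall n, measurable (A n)) -> (forall n m, (n <= m)%N -> A n `<=` A m) ->
  (forall n, fine (P (A n)) <= c) -> fine (P (\bigcup_n A n)) <= c.
Proof.
move=> mA ndA Ac; rewrite -lee_fin fineK; last first.
  by apply: fin_num_measure; exact: bigcup_measurable.
have := @nondecreasing_cvg_mu _ _ _ P A mA (bigcup_measurable (fun n _ => mA n)).
move=> /(_ _)/cvg_lim <-//; last by move=> n m nm; apply/subsetPset; exact: ndA.
apply: lime_le.
  apply: ereal_nondecreasing_is_cvgn => n m nm /=.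
  by apply: le_measure; rewrite ?inE//; exact: ndA.
apply: nearW => n /=; rewrite -[leLHS]fineK ?lee_fin//; exact: fin_num_measure.
Qed.

(** The form in which maximal and upcrossing inequalities bound the probability
    that a quantity exceeds every level. *)
Lemma negligible_small (A : nat -> set Omega) (c : R) :
  (forall n, measurable (A n)) -> (forall n, n.+1%:R * fine (P (A n)) <= c) ->
  P.-negligible (\bigcap_n A n).
Proof.
move=> mA Ac; have mB : measurable (\bigcap_n A n) by exact: bigcapT_measurable.
apply/negligibleP => //; rewrite -[LHS]fineK; last exact: fin_num_measure.
congr EFin; apply/eqP; rewrite eq_le fine_measure_ge0 andbT leNgt; apply/negP => p0.
set p := fine _ in p0.
have [n] : exists n : nat, c < n.+1%:R * p.
  near \oo => n; exists n; rewrite mulrC -ltr_pdivrMl//.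
  rewrite mulrC; near: n; case: (nbhs_infty_gtr (c / p)) => N _ hN.
  by exists N => // n /= Nn; apply: hN => /=; apply: leq_trans Nn _.
rewrite ltNge => /negP; apply; apply: le_trans (Ac n).
rewrite ler_pM2l// /p -lee_fin !fineK; [|exact: fin_num_measure..].
by apply: le_measure; rewrite ?inE//; apply: bigcap_inf.
Unshelve. all: by end_near. Qed.

End almost_sure.

Section filtration.
Context {R : realType} {d : measure_display} {Omega : measurableType d}.
Variable P : probability Omega R.
Implicit Types (X Y Z : Omega -> R) (B C : set Omega).

Local Notation intg X := (P.-integrable [set: Omega] (EFin \o X)).
Local Notation E := (Rintegral P).

(** The usual conditions, on a compact interval of finite times. *)
Definition interval_filtration (s t : R) (F : R -> set (set Omega)) : Prop :=
  [/\ (forall u, s <= u -> u <= t ->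
         sigma_algebra [set: Omega] (F u) /\ F u `<=` measurable),
      (forall u v, s <= u -> u <= v -> v <= t -> F u `<=` F v),
      (forall u, s <= u -> u < t -> forall B,
         (forall v, u < v -> v <= t -> F v B) -> F u B) &
      (forall B, P.-negligible B -> F s B)].

Section interval_filtration_theory.
Variables (s t : R) (F : R -> set (set Omega)).
Hypothesis filF : interval_filtration s t F.

Lemma filtration_measurable u B : s <= u -> u <= t -> F u B -> measurable B.
Proof. by move=> su ut; have [+ _ _ _] := filF => /(_ _ su ut)[_]; exact. Qed.

Lemma filtration_salgebra u : s <= u -> u <= t -> sigma_algebra setT (F u).
Proof. by move=> su ut; have [+ _ _ _] := filF => /(_ _ su ut)[]. Qed.

Lemma filtration_le u v : s <= u -> u <= v -> v <= t -> F u `<=` F v.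
Proof. by have [_ + _ _] := filF; exact. Qed.

Lemma filtration_sub u v : s <= u -> u <= v -> v <= t -> interval_filtration u v F.
Proof.
have [h1 h2 h3 h4] := filF; move=> su uv vt; split.
- by move=> x ux xv; apply: h1; [exact: le_trans ux|exact: le_trans vt].
- by move=> x y ux xy yv; apply: h2 => //; [exact: le_trans ux|exact: le_trans vt].
- move=> x ux xv B hB; apply: h3; [exact: le_trans ux|exact: lt_le_trans vt|].
  move=> y xy yt; have [yv|vy] := leP y v; first exact: hB.
  apply: (h2 v y) => //; [exact: le_trans uv|exact: ltW|exact: hB].
- by move=> N nN; apply: (h2 s u) => //; [exact: le_trans vt|exact: h4].
Qed.

End interval_filtration_theory.

Section nonnegative.
Variables (s t : R) (F : R -> set (set Omega)) (Y : Omega -> R) (X : R -> Omega -> R).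
Hypothesis filF : interval_filtration s t F.
Hypothesis iY : intg Y.
Hypothesis hX : forall u, s <= u -> u <= t -> measurable_wrt (F u) (X u).
Hypothesis iX : forall u, s <= u -> u <= t -> intg (X u).
Hypothesis X0 : forall u w, s <= u -> u <= t -> 0 <= X u w.
Hypothesis EX : forall u, s <= u -> u <= t -> forall B, F u B -> E B (X u) = E B Y.

Let st (l : seq R) := forall q, q \in l -> s <= q /\ q <= t.

Let mF := filtration_measurable filF.
Let salF := filtration_salgebra filF.
Let monoF := filtration_le filF.

Let mX u : s <= u -> u <= t -> measurable_fun setT (X u).
Proof. by move=> su ut; exact: intg_measurable (iX su ut). Qed.

Let F_lt u c : s <= u -> u <= t -> F u [set w | X u w < c].
Proof.
move=> su ut; have := hX su ut (measurable_itv (`]-oo, c[)).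
by congr (F u _); apply/seteqP; split => w /=; rewrite in_itv.
Qed.

Let F_gt u c : s <= u -> u <= t -> F u [set w | c < X u w].
Proof.
move=> su ut; have := hX su ut (measurable_itv (`]c, +oo[)).
by congr (F u _); apply/seteqP; split => w /=; rewrite in_itv /= andbT.
Qed.

Section bound.
Variables (a b : R).
Hypothesis a0 : 0 <= a.

Let U h l w : R := (upcrossings a b h [seq X q w | q <- l])%:R.

Lemma measurable_upcrossings h l : st l -> measurable_fun setT (U h l).
Proof.
elim: l h => [|q l IH] h stl; first exact: measurable_cst.
have [sq qt] : s <= q /\ q <= t by apply: stl; exact: mem_head.
have {}IH h' : measurable_fun setT (U h' l).
  by apply: IH => q' ql; apply: stl; rewrite inE ql orbT.
case: h; rewrite /U /=.
  rewrite [X in measurable_fun _ X](_ : _ =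
    fun w => if b < X q w then U false l w + 1 else U true l w); last first.
    by apply/funext => w; case: ifP => //; rewrite -natr1.
  apply: measurable_fun_ifT => //; last exact: measurable_funD.
  by apply: measurable_fun_ltr => //; exact: mX.
rewrite [X in measurable_fun _ X](_ : _ =
  fun w => if X q w < a then U true l w else U false l w); last first.
  by apply/funext => w; case: ifP.
apply: measurable_fun_ifT => //.
by apply: measurable_fun_ltr => //; exact: mX.
Qed.

Lemma upcrossings_size h l : (upcrossings a b h l <= size l)%N.
Proof.
by elim: l h => //= x l IH [|]; case: ifP => _; rewrite ?ltnS//; exact: leqW.
Qed.

Lemma intg_upcrossings h l : st l -> intg (U h l).
Proof.
move=> stl; apply: (@intg_bounded _ _ _ _ _ (size l)%:R).
  exact: measurable_upcrossings.
apply: aeW => w; rewrite ger0_norm ?ler0n// ler_nat.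
by apply: leq_trans (upcrossings_size _ _) _; rewrite size_map.
Qed.

(** The value of the remaining passages, each worth [b - a], for someone who is
    under way is at most the current value [X q]; otherwise it is at most [a].
    Starting a passage below [a] or ending one above [b] respects these bounds. *)
Lemma E_upcrossings q l B : st (q :: l) -> path <%R q l -> F q B ->
  (b - a) * E B (U false (q :: l)) <= E B (fun=> a) /\
  (b - a) * E B (U true (q :: l)) <= E B (X q).
Proof.
elim: l q B => [|q' l IH] q B stl pl FB.
  have [sq qt] : s <= q /\ q <= t by apply: stl; exact: mem_head.
  have mB := mF sq qt FB.
  split.
    rewrite (_ : U false [:: q] = fun=> 0); last first.
      by apply/funext => w; rewrite /U /=; case: ifP.
    by rewrite !E_cst// mul0r mulr0 mulr_ge0// fine_measure_ge0.
  have FC := F_gt b sq qt; have mC := mF sq qt FC.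
  rewrite (E_split (C := [set w | b < X q w]) (intg_upcrossings true stl) mB mC).
  rewrite (E_split (C := [set w | b < X q w]) (iX sq qt) mB mC) mulrDr lerD//.
    rewrite -E_Z; [|exact: intg_upcrossings|exact: measurableI].
    apply: E_le; [exact: measurableI|apply: intgZ; exact: intg_upcrossings|exact: iX|].
    move=> w [_ /= bX]; rewrite /U /= bX mulr1; apply: le_trans (ltW bX).
    by rewrite gerBl.
  rewrite -E_Z; [|exact: intg_upcrossings|exact: measurableD].
  apply: E_le; [exact: measurableD|apply: intgZ; exact: intg_upcrossings|exact: iX|].
  move=> w [_ /= /negP/negbTE bX]; rewrite /U /= bX mulr0; exact: X0.
have [sq qt] : s <= q /\ q <= t by apply: stl; exact: mem_head.
have stl' : st (q' :: l) by move=> q'' h; apply: stl; rewrite inE h orbT.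
have [sq' qt'] : s <= q' /\ q' <= t by apply: stl'; exact: mem_head.
have mB := mF sq qt FB.
move: pl => /= /andP[qq' pl].
have FF C : F q C -> F q' C by apply: monoF => //; exact: ltW.
have EXX C : F q C -> E C (X q') = E C (X q).
  by move=> FC; rewrite !EX//; exact: FF.
have iU h := intg_upcrossings h stl.
split.
  have FC := F_lt a sq qt; have mC := mF sq qt FC.
  have FI := salgebraI (salF sq qt) FB FC; have FD := salgebraD (salF sq qt) FB FC.
  rewrite (E_split (C := [set w | X q w < a]) (iU false) mB mC).
  rewrite (E_split (C := [set w | X q w < a]) (intg_cst P a) mB mC) mulrDr lerD//.
    rewrite (_ : E _ _ = E (B `&` [set w | X q w < a]) (U true (q' :: l))); last first.
      by apply: eq_Rintegral => w /set_mem[_ /= h]; rewrite /U /= h.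
    apply: (le_trans (IH q' _ stl' pl (FF _ FI)).2); rewrite EXX//.
    apply: E_le; [exact: measurableI|exact: iX|exact: intg_cst|].
    by move=> w [_ /ltW].
  rewrite (_ : E _ _ = E (B `\` [set w | X q w < a]) (U false (q' :: l))); last first.
    by apply: eq_Rintegral => w /set_mem[_ /= /negP/negbTE h]; rewrite /U /= h.
  exact: (IH q' _ stl' pl (FF _ FD)).1.
have FC := F_gt b sq qt; have mC := mF sq qt FC.
have FI := salgebraI (salF sq qt) FB FC; have FD := salgebraD (salF sq qt) FB FC.
rewrite (E_split (C := [set w | b < X q w]) (iU true) mB mC).
rewrite (E_split (C := [set w | b < X q w]) (iX sq qt) mB mC) mulrDr lerD//.
  have mI : measurable (B `&` [set w | b < X q w]) by exact: measurableI.
  rewrite (_ : E _ _ = E (B `&` [set w | b < X q w]) (fun w => U false (q' :: l) w + 1)); last first.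
    by apply: eq_Rintegral => w /set_mem[_ /= h]; rewrite /U /= h -natr1.
  rewrite E_D//; [|exact: intg_upcrossings|exact: intg_cst].
  have h1 := (IH q' _ stl' pl (FF _ FI)).1.
  rewrite mulrDr; apply: (@le_trans _ _ (E (B `&` [set w | b < X q w]) (fun=> b))).
    by rewrite (_ : E _ (fun=> b) = E (B `&` [set w | b < X q w]) (fun=> a) +
      (b - a) * E (B `&` [set w | b < X q w]) (fun=> 1)) ?lerD2r// !E_cst//; lra.
  by apply: E_le => //; [exact: intg_cst|exact: iX|move=> w [_ /ltW]].
rewrite (_ : E _ _ = E (B `\` [set w | b < X q w]) (U true (q' :: l))); last first.
  by apply: eq_Rintegral => w /set_mem[_ /= /negP/negbTE h]; rewrite /U /= h.
by rewrite -EXX//; exact: (IH q' _ stl' pl (FF _ FD)).2.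
Qed.

End bound.

(** Either the first value exceeds [c], or the induction hypothesis applies on
    the event that it does not, where [X q] and [X q'] have the same mean. *)
Lemma doob_maximal_inequality (c : R) q l B : 0 < c -> st (q :: l) -> path <%R q l -> F q B ->
  measurable [set w | has (fun q' => c < X q' w) (q :: l)] /\
  c * fine (P (B `&` [set w | has (fun q' => c < X q' w) (q :: l)])) <= E B (X q).
Proof.
move=> c0; elim: l q B => [|q' l IH] q B stl pl FB.
  have [sq qt] : s <= q /\ q <= t by apply: stl; exact: mem_head.
  have mB := mF sq qt FB.
  have mC := mF sq qt (F_gt c sq qt).
  rewrite (_ : [set w | _] = [set w | c < X q w]); last first.
    by apply/seteqP; split => w /=; rewrite orbF.
  split => //; rewrite -E_cst; last exact: measurableI.
  rewrite (E_split (C := [set w | c < X q w]) (iX sq qt) mB mC) -[leLHS]addr0 lerD//.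
    apply: E_le; [exact: measurableI|exact: intg_cst|exact: iX|by move=> w [_ /ltW]].
  by apply: E_ge0 => w _; exact: X0.
have [sq qt] : s <= q /\ q <= t by apply: stl; exact: mem_head.
have stl' : st (q' :: l) by move=> q'' h; apply: stl; rewrite inE h orbT.
have [sq' qt'] : s <= q' /\ q' <= t by apply: stl'; exact: mem_head.
have mB := mF sq qt FB.
move: pl => /= /andP[qq' pl].
have FF C : F q C -> F q' C by apply: monoF => //; exact: ltW.
have FC := F_gt c sq qt; have mC := mF sq qt FC.
have FI := salgebraI (salF sq qt) FB FC; have FD := salgebraD (salF sq qt) FB FC.
have [mM IHM] := IH q' _ stl' pl (FF _ FD).
set M' := [set w | has _ _] in mM IHM.
rewrite (_ : [set w | _] = [set w | c < X q w] `|` M'); last first.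
  apply/seteqP; split => w /=; first by move=> /orP[]; [left|right].
  by case=> h; apply/orP; [left|right].
split; first exact: measurableU.
have mU : measurable (B `&` ([set w | c < X q w] `|` M')).
  by apply: measurableI => //; exact: measurableU.
rewrite -E_cst// (E_split (C := [set w | c < X q w]) (intg_cst P c) mU mC).
rewrite (E_split (C := [set w | c < X q w]) (iX sq qt) mB mC) lerD//.
  rewrite (_ : _ `&` _ `&` _ = B `&` [set w | c < X q w]); last first.
    by apply/seteqP; split => w [h1 h2]; split=> //; [case: h1|split => //; left].
  apply: E_le; [exact: measurableI|exact: intg_cst|exact: iX|by move=> w [_ /ltW]].
rewrite (_ : _ `\` _ = (B `\` [set w | c < X q w]) `&` M'); last first.
  apply/seteqP; split => w.
    by move=> [[Bw [h1|h1]] h2].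
  by move=> [[h1 h2] h3]; split => //; split => //; right.
rewrite E_cst; last by apply: measurableI => //; exact: measurableD.
apply: le_trans IHM _; rewrite EX ?EX//; exact: FF.
Qed.

End nonnegative.

End filtration.

Section cadlag_conditional_expectation.
Context {R : realType} {d : measure_display} {Omega : measurableType d}.
Variable P : probability Omega R.
Implicit Types (Y Z : Omega -> R) (B C : set Omega).

Local Notation intg X := (P.-integrable [set: Omega] (EFin \o X)).
Local Notation E := (Rintegral P).

Section nonnegative.
Variables (s t : R) (F : R -> set (set Omega)) (Y : Omega -> R) (X : R -> Omega -> R).
Hypothesis filF : interval_filtration P s t F.
Hypothesis iY : intg Y.
Hypothesis hX : forall u, s <= u -> u <= t -> measurable_wrt (F u) (X u).
Hypothesis iX : forall u, s <= u -> u <= t -> intg (X u).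
Hypothesis X0 : forall u w, s <= u -> u <= t -> 0 <= X u w.
Hypothesis EX : forall u, s <= u -> u <= t -> forall B, F u B -> E B (X u) = E B Y.

Let mF := filtration_measurable filF.
Let salF := filtration_salgebra filF.
Let monoF := filtration_le filF.

Section grid.
Variable qn : nat -> R.
Hypothesis qn_st : forall n, s <= qn n <= t.

Let Q q := exists n, q = qn n.
Let L n : seq R := sort <=%O (undup [seq qn i | i <- iota 0 n]).

Let mem_L n q : (q \in L n) = (q \in [seq qn i | i <- iota 0 n]).
Proof. by rewrite mem_sort mem_undup. Qed.

Let sorted_L n : sorted <%R (L n).
Proof. by rewrite sort_lt_sorted undup_uniq. Qed.

Let st_L n q : q \in L n -> s <= q /\ q <= t.
Proof. by rewrite mem_L => /mapP[i _ ->]; apply/andP; exact: qn_st. Qed.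

Let subseq_L (l : seq R) n : sorted <%R l -> {subset l <= L n} -> subseq l (L n).
Proof.
move=> sl lL; rewrite (_ : l = [seq q <- L n | q \in l]); first exact: filter_subseq.
apply: lt_sorted_eq => //.
  by apply: (subseq_lt_sorted (filter_subseq _ _)); exact: sorted_L.
by move=> q; rewrite mem_filter; case: (boolP (q \in l)) => //= /lL ->.
Qed.

Let subset_L n m : (n <= m)%N -> {subset L n <= L m}.
Proof.
move=> nm q; rewrite !mem_L => /mapP[i]; rewrite mem_iota /= add0n => ni ->.
by apply/mapP; exists i => //; rewrite mem_iota add0n /= (leq_trans ni).
Qed.

Let finite_L (l : seq R) : (forall q, q \in l -> Q q) -> exists n, {subset l <= L n}.
Proof.
elim: l => [|q l IH] lQ; first by exists 0%N.
have [|n ln] := IH; first by move=> q' h; apply: lQ; rewrite inE h orbT.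
have [m qm] := lQ q (mem_head _ _).
exists (maxn n m.+1) => q'; rewrite inE => /orP[/eqP ->|/ln].
  by rewrite mem_L qm; apply: map_f; rewrite mem_iota /= add0n leq_max ltnSn orbT.
exact/subset_L/leq_maxl.
Qed.

(** The maximal inequality does not depend on the number of grid points. *)
Lemma ae_bounded_on_grid : \forall w \ae P, exists c, forall q, Q q -> X q w <= c.
Proof.
pose A k n := [set w | has (fun q => (k.+1%:R : R) < X q w) (L n)].
have mA k n : measurable (A k n) /\ k.+1%:R * fine (P (A k n)) <= E setT Y.
  have := sorted_L n; have := @st_L n; rewrite /A; case: (L n) => [|q l] stl pl.
    rewrite (_ : [set w | _] = set0); last by apply/seteqP; split.
    split; first exact: measurable0.
    rewrite measure0 mulr0; have := @E_ge0 _ _ _ P (X s) setT.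
    have [st|ts] := leP s t; last first.
      by have := qn_st 0; move=> /andP[h1 h2]; have := le_trans h1 h2; rewrite leNgt ts.
    rewrite EX//; last exact: (salgebraT (salF (lexx s) st)).
    by apply; move=> w _; exact: X0.
  have [sq qt] : s <= q /\ q <= t by apply: stl; exact: mem_head.
  have FT : F q setT by apply: salgebraT; exact: salF.
  have [h1 h2] := doob_maximal_inequality filF hX iX X0 EX (ltr0Sn _ k) stl pl FT.
  by split=> //; move: h2; rewrite setTI EX.
have mU k : measurable (\bigcup_n A k n) by apply: bigcup_measurable => n _; exact: (mA k n).1.
have neg : P.-negligible (\bigcap_k \bigcup_n A k n).
  apply: (@negligible_small _ _ _ _ _ (E setT Y)) => // k.
  rewrite -ler_pdivlMl//; apply: fine_measure_bigcup_le.
  - by move=> n; exact: (mA k n).1.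
  - move=> n m nm w /= /hasP[q qL h]; apply/hasP; exists q => //; exact: subset_L qL.
  - by move=> n; rewrite ler_pdivlMl//; exact: (mA k n).2.
apply: negligibleS neg => w /= h k _; apply: contrapT => h2; apply: h.
exists k.+1%:R => q [n qn_]; rewrite leNgt; apply/negP => h3; apply: h2.
exists n.+1 => //; apply/hasP; exists q => //.
by rewrite mem_L qn_; apply: map_f; rewrite mem_iota /= add0n ltnSn.
Qed.

(** The upcrossing inequality is uniform in the grid as well. *)
Lemma ae_few_upcrossings_on_grid : \forall w \ae P, forall a b : rat, 0 <= a -> a < b ->
  exists m, forall l : seq R, (forall q, q \in l -> Q q) -> sorted <%R l ->
    (upcrossings (ratr a) (ratr b) false [seq X q w | q <- l] <= m)%N.
Proof.
suff : \forall w \ae P, forall p : rat * rat, 0 <= p.1 -> p.1 < p.2 ->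
  exists m, forall l : seq R, (forall q, q \in l -> Q q) -> sorted <%R l ->
    (upcrossings (ratr p.1) (ratr p.2) false [seq X q w | q <- l] <= m)%N.
  by apply: filterS => w h a b; exact: (h (a, b)).
apply: ae_forall_countable => -[a' b'] /=.
have [a0|] := leP 0 a'; last by move=> _; apply: aeW => w.
have [ab|] := ltP a' b'; last by move=> _; apply: aeW => w.
set a : R := ratr a'; set b : R := ratr b'.
have {}ab : a < b by rewrite ltr_rat.
have {}a0 : 0 <= a by rewrite ler0q.
pose U n w := upcrossings a b false [seq X q w | q <- L n].
pose A k n := [set w | (k.+1%:R : R) <= (U n w)%:R].
have mU n : measurable_fun setT (fun w => (U n w)%:R : R).
  by apply: (measurable_upcrossings iX); exact: st_L.
have mA k n : measurable (A k n).
  by apply: measurable_set_le => //; exact: measurable_cst.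
have PA k n : k.+1%:R * fine (P (A k n)) <= a / (b - a).
  have iU : intg (fun w => (U n w)%:R : R) by apply: (intg_upcrossings iX); exact: st_L.
  rewrite ler_pdivlMr ?subr_gt0// mulrC -E_cst//.
  have : (b - a) * E setT (fun w => (U n w)%:R) <= a.
    have := sorted_L n; have := @st_L n; rewrite /U; case: (L n) => [|q l] stl pl.
      by rewrite /= E_cst// mul0r mulr0.
    have [sq qt] : s <= q /\ q <= t by apply: stl; exact: mem_head.
    have FT : F q setT by apply: salgebraT; exact: salF.
    have [h _] := E_upcrossings filF hX iX X0 EX b a0 stl pl FT.
    apply: le_trans h _; rewrite E_cst// -[leRHS]mulr1 ler_wpM2l//.
    by rewrite probability_setT.
  apply: le_trans; rewrite ler_pM2l ?subr_gt0//.
  apply: (@le_trans _ _ (E (A k n) (fun w => (U n w)%:R))).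
    by apply: E_le => //; exact: intg_cst.
  by apply: E_subset.
have neg : P.-negligible (\bigcap_k \bigcup_n A k n).
  apply: (@negligible_small _ _ _ _ _ (a / (b - a))) => [k|k].
    by apply: bigcup_measurable => n _; exact: mA.
  rewrite -ler_pdivlMl//; apply: fine_measure_bigcup_le => //.
  - move=> n m nm w; rewrite /A /= !ler_nat => h; apply: leq_trans h _.
    apply: upcrossings_subseq => //; apply: map_subseq; apply: subseq_L => //.
    exact: subset_L.
  - by move=> n; rewrite ler_pdivlMl//; exact: PA.
apply: negligibleS neg => w /= h k _; apply: contrapT => h2; apply: h => _ _.
exists k => l lQ sl; rewrite leqNgt; apply/negP => h3; apply: h2.
have [n ln] := finite_L lQ; exists n => //; rewrite /A /= ler_nat.
apply: leq_trans h3 _; apply: upcrossings_subseq => //; apply: map_subseq.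
exact: subseq_L.
Qed.

End grid.

(** The version is the right limit of [X] along a countable dense set.  It is
    known at time [u] because the filtration is right-continuous, and the
    conditional expectations pass to the limit by uniform integrability. *)
Lemma cadlag_version_nonneg : s < t -> exists Z : R -> Omega -> R,
  (forall u, s <= u -> u < t -> [/\ measurable_wrt (F u) (Z u), intg (Z u) &
     forall B, F u B -> E B (Z u) = E B Y]) /\
  (\forall w \ae P,
     (forall u, s <= u -> u < t -> Z x w @[x --> u^'+] --> Z u w) /\
     (forall u, s < u -> u <= t -> cvg (Z x w @[x --> u^'-]))).
Proof.
move=> st.
pose qn n : R := Num.min t (Num.max s (if unpickle n is Some q then ratr q else s)).
have qn_st n : s <= qn n <= t.
  by rewrite /qn le_min ge_min lexx le_max lexx (ltW st).
pose Q q := exists n, q = qn n.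
have denseQ u v : s <= u -> v <= t -> u < v -> exists2 q, Q q & u < q < v.
  move=> su vt uv; have [q] := rat_in_itvoo uv; rewrite in_itv /= => /andP[uq qv].
  exists (ratr q); last by rewrite uq.
  exists (pickle (q : rat)); rewrite /qn pickleK.
  rewrite max_r; last by apply: ltW; exact: le_lt_trans uq.
  by rewrite min_r//; apply: ltW; exact: lt_le_trans vt.
have Qst q : Q q -> s <= q /\ q <= t by move=> [n ->]; apply/andP; exact: qn_st.
pose regular w := (exists c, forall q, Q q -> X q w <= c) /\
  (forall a b : rat, 0 <= a -> a < b ->
  exists m, forall l : seq R, (forall q, q \in l -> Q q) -> sorted <%R l ->
    (upcrossings (ratr a) (ratr b) false [seq X q w | q <- l] <= m)%N).
have ae_reg : \forall w \ae P, regular w.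
  have h1 := ae_bounded_on_grid qn_st; have h2 := ae_few_upcrossings_on_grid qn_st.
  by apply: filterS2 h1 h2.
have Fs_reg : F s regular.
  rewrite -[X in F s X]setCK; apply: salgebraC; first by apply: salF => //; exact: ltW.
  by have [_ _ _] := filF; apply.
have Freg u : s <= u -> u <= t -> F u regular by move=> su ut; exact: monoF Fs_reg.
have [r rP] : exists r : R -> nat -> R, forall u, s <= u -> u < t -> forall k,
    Q (r u k) /\ u < r u k < Num.min t (u + k.+1%:R^-1).
  have /choice[r hr] : forall p : R * nat, exists q, s <= p.1 -> p.1 < t ->
    Q q /\ p.1 < q < Num.min t (p.1 + p.2.+1%:R^-1).
    move=> [u k] /=; have [su|us] := leP s u; last by exists 0.
    have [ut|tu] := ltP u t; last by exists 0.
    have [||q Qq uq] := @denseQ u (Num.min t (u + k.+1%:R^-1)) su.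
    - by rewrite ge_min lexx.
    - by rewrite lt_min ut ltrDl invr_gt0 ltr0Sn.
    by exists q.
  by exists (fun u k => r (u, k)) => u su ut k; exact: (hr (u, k)).
have r_near u v : s <= u -> u < t -> u < v -> \forall k \near \oo, r u k < v.
  move=> su ut uv; have vu0 : 0 < v - u by rewrite subr_gt0.
  near=> k; have [_ /andP[_ h]] := rP u su ut k; apply: (lt_trans h).
  rewrite gt_min; apply/orP; right; rewrite -ltrBrDl.
  by near: k; exact: (near_infty_natSinv_lt (PosNum vu0)).
pose Z u := (fun w => lim (X (r u k) w @[k --> \oo])) \_ regular.
have ZP u w : regular w -> s <= u -> u < t -> forall e, 0 < e ->
    exists2 v, u < v & forall q, Q q -> u < q < v -> `|X q w - Z u w| <= e.
  move=> rw su ut; have [[c Xc] few] := rw.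
  have bX q : Q q -> 0 <= X q w <= c.
    by move=> Qq; have [sq qt] := Qst q Qq; rewrite Xc// X0.
  have [l lP] := regulated_right denseQ bX few su ut.
  suff -> : Z u w = l by [].
  rewrite /Z patchE mem_set//; apply/cvg_lim => //; apply/cvgrPdist_le => e e0.
  have [v uv h] := lP e e0; have := r_near u v su ut uv; apply: filterS => k kv.
  by have [Qr /andP[ur _]] := rP u su ut k; rewrite distrC; apply: h => //; rewrite ur.
have Zcvg u w : regular w -> s <= u -> u < t -> X (r u k) w @[k --> \oo] --> Z u w.
  move=> rw su ut; apply/cvgrPdist_le => e e0.
  have [v uv h] := ZP u w rw su ut e e0; have := r_near u v su ut uv; apply: filterS => k kv.
  by have [Qr /andP[ur _]] := rP u su ut k; rewrite distrC; apply: h => //; rewrite ur.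
have mZ u : s <= u -> u < t -> measurable_wrt (F u) (Z u).
  move=> su ut B mB; have [_ _ rc _] := filF; apply: rc => // v uv vt.
  have sv : s <= v by apply: le_trans su _; exact: ltW.
  have salv := salF sv vt.
  suff : measurable_wrt (F v) (Z u) by exact.
  have [N _ rN] := r_near u v su ut uv.
  apply: (measurable_wrt_cvg salv (X_ := fun k => X (r u (k + N)%N) \_ regular)).
    move=> k; apply: (measurable_wrt_restrict salv); first exact: Freg.
    move=> C mC; have [Qr /andP[ur _]] := rP u su ut (k + N)%N; have [s1 s2] := Qst _ Qr.
    apply: (monoF s1 _ vt (hX s1 s2 mC)); apply: ltW; apply: rN => /=.
    exact: leq_addl.
  move=> w; have [rw|nrw] := pselect (regular w).
    rewrite (_ : (fun k => _) = (fun k => X (r u (k + N)%N) w)); last first.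
      by apply/funext => k; rewrite patchE mem_set.
    by rewrite (cvg_shiftn N (fun k => X (r u k) w)); exact: Zcvg.
  rewrite /Z patchE memNset// (_ : (fun k => _) = (fun=> 0)); first exact: cvg_cst.
  by apply/funext => k; rewrite patchE memNset.
exists Z; split.
  move=> u su ut.
  have sr k : s <= r u k by have [/Qst[]] := rP u su ut k.
  have rt k : r u k <= t by have [/Qst[]] := rP u su ut k.
  have mZu : measurable_fun setT (Z u).
    apply: (measurable_wrt_measurable _ (mZ u su ut)) => B; apply: mF => //; exact: ltW.
  have [iZ EZ] : intg (Z u) /\ forall B, measurable B -> E B (X (r u k)) @[k --> \oo] --> E B (Z u).
    apply: (E_cvg_dominated_tails (Y := Y)) => //.
    - by move=> k; exact: iX.
    - move=> k c c0; set C := [set w | _].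
      have FC : F (r u k) C.
        have := hX (sr k) (rt k) (measurable_itv (`]c, +oo[)).
        congr (F _ _); apply/seteqP; split => w /=; rewrite in_itv /= andbT.
          by rewrite /C /= ger0_norm// X0.
        by rewrite /C /= ger0_norm// X0.
      have mC : measurable C by exact: mF FC.
      rewrite (_ : E C (fun w => `|X (r u k) w|) = E C (X (r u k))).
        by rewrite EX//; apply: E_le => //; [exact: intg_norm|move=> w _; exact: ler_norm].
      by apply: eq_Rintegral => w _; rewrite ger0_norm// X0.
    - by apply: filterS ae_reg => w rw; exact: Zcvg.
  split => //; first exact: mZ.
  move=> B FB; have mB : measurable B by apply: mF FB => //; exact: ltW.
  apply: (cvg_unique _ (EZ B mB)) => //; apply: cvg_near_cst; apply: nearW => k.
  apply: EX => //; apply: (monoF su _ (rt k) FB).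
  by have [_ /andP[/ltW]] := rP u su ut k.
apply: filterS ae_reg => w rw; split.
  move=> u su ut; apply/cvgrPdist_le => e e0.
  have e2 : 0 < e / 2 by rewrite divr_gt0.
  have [v uv hv] := ZP u w rw su ut _ e2.
  apply/near_rightP; exists (Num.min v t); first by rewrite lt_min uv.
  move=> x; rewrite lt_min => /and3P[ux xv xt].
  have sx : s <= x by apply: le_trans su _; exact: ltW.
  have [v' xv' hv'] := ZP x w rw sx xt _ e2.
  have [||q Qq] := @denseQ x (Num.min (Num.min v v') t) sx.
  - by rewrite ge_min lexx orbT.
  - by rewrite !lt_min xv xv'.
  rewrite !lt_min -!andbA => /and4P[xq qv qv' qt].
  have h1 := hv' q Qq; have h2 := hv q Qq; move: h1 h2.
  rewrite xq qv qv' (lt_trans ux xq) => /(_ isT) h1 /(_ isT) h2.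
  rewrite distrC; apply: le_trans (ler_distD (X q w) _ _) _.
  by rewrite [e]splitr lerD// distrC.
move=> u su ut; have [[c Xc] few] := rw.
have bX q : Q q -> 0 <= X q w <= c.
  by move=> Qq; have [sq qt] := Qst q Qq; rewrite Xc// X0.
have [l lP] := regulated_left denseQ bX few su ut.
apply: (cvgP l); apply/cvgrPdist_le => e e0.
have e2 : 0 < e / 2 by rewrite divr_gt0.
have [v vu hv] := lP _ e2.
apply/near_leftP; exists (Num.max v s); first by rewrite gt_max vu.
move=> x; rewrite gt_max -!andbA => /and3P[vx sx xu].
have xt := lt_le_trans xu ut.
have [v' xv' hv'] := ZP x w rw (ltW sx) xt _ e2.
have [||q Qq] := @denseQ x (Num.min v' u) (ltW sx).
- by rewrite ge_min ut orbT.
- by rewrite lt_min xv'.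
rewrite !lt_min => /and3P[xq qv' qu].
have h1 := hv' q Qq; have h2 := hv q Qq; move: h1 h2.
rewrite xq qv' qu (lt_trans vx xq) => /(_ isT) h1 /(_ isT) h2.
apply: le_trans (ler_distD (X q w) _ _) _.
by rewrite [e]splitr lerD// distrC.
Unshelve. all: by end_near.
Qed.

End nonnegative.

(** Doob's regularization; the positive and negative parts of [Y] are treated
    separately, since the inequalities above are for nonnegative variables. *)
Lemma cadlag_version (s t : R) (F : R -> set (set Omega)) (Y : Omega -> R) :
  interval_filtration P s t F -> intg Y -> s < t -> exists Z : R -> Omega -> R,
  (forall u, s <= u -> u < t -> [/\ measurable_wrt (F u) (Z u), intg (Z u) &
     forall B, F u B -> E B (Z u) = E B Y]) /\
  (\forall w \ae P,
     (forall u, s <= u -> u < t -> Z x w @[x --> u^'+] --> Z u w) /\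
     (forall u, s < u -> u <= t -> cvg (Z x w @[x --> u^'-]))).
Proof.
move=> filF iY st.
have [cF _ _ _] := filF.
have nonneg (Y' : Omega -> R) : intg Y' -> (forall w, 0 <= Y' w) ->
    exists Z : R -> Omega -> R,
  (forall u, s <= u -> u < t -> [/\ measurable_wrt (F u) (Z u), intg (Z u) &
     forall B, F u B -> E B (Z u) = E B Y']) /\
  (\forall w \ae P,
     (forall u, s <= u -> u < t -> Z x w @[x --> u^'+] --> Z u w) /\
     (forall u, s < u -> u <= t -> cvg (Z x w @[x --> u^'-]))).
  move=> iY' Y'0.
  have /choice[X XP] : forall u, exists X : Omega -> R, s <= u -> u <= t ->
      [/\ measurable_wrt (F u) X, intg X, (forall w, 0 <= X w) &
          forall B, F u B -> E B X = E B Y'].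
    move=> u; have [su|us] := leP s u; last first.
      by exists Y'.
    have [ut|tu] := leP u t; last first.
      by exists Y'.
    have [salF mF] := cF u su ut.
    have [X [hX iX EX]] := ex_cond_exp salF mF iY'.
    have h0 : measurable_wrt (F u) (fun=> (0 : R)) by apply/(measurable_wrtP salF); exact: measurable_cst.
    have X0 : \forall w \ae P, 0 <= X w.
      apply: (ae_le_of_E salF mF h0 hX (intg_cst P 0) iX) => B FB.
      by rewrite EX// (E_cst _ _ (mF _ FB)) mul0r; apply: E_ge0.
    have hX' : measurable_wrt (F u) (fun w => Num.max (X w) 0).
      apply/(measurable_wrtP salF); apply: measurable_maxr; last exact: measurable_cst.
      exact/(measurable_wrtP salF).
    have eqX : \forall w \ae P, Num.max (X w) 0 = X w.
      by apply: filterS X0 => w /max_idPl.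
    have iX' : intg (fun w => Num.max (X w) 0).
      exact: (intg_eq_ae (measurable_wrt_measurable mF hX') iX eqX).
    exists (fun w => Num.max (X w) 0) => _ _; split => //.
      by move=> w; rewrite le_max lexx orbT.
    move=> B FB; rewrite -EX//; apply: E_eq_ae => //; first exact: mF.
    by apply: filterS eqX => w.
  apply: (cadlag_version_nonneg (X := X) filF iY') => //.
  - by move=> u su ut; have [] := XP u su ut.
  - by move=> u su ut; have [] := XP u su ut.
  - by move=> u w su ut; have [] := XP u su ut.
  - by move=> u su ut; have [] := XP u su ut.
have mY := intg_measurable iY.
have ip : intg (fun w => Num.max (Y w) 0).
  apply: intg_le (intg_norm iY) _.
    by apply: measurable_maxr => //; exact: measurable_cst.
  by apply: aeW => w; rewrite normr_id; case: (leP (Y w) 0) => h //; rewrite normr0.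
have im : intg (fun w => Num.max (Y w) 0 - Y w) by exact: intgB.
have [|Zp [hp cp]] := nonneg _ ip; first by move=> w; rewrite le_max lexx orbT.
have [|Zm [hm cm]] := nonneg _ im; first by move=> w; rewrite subr_ge0 le_max lexx.
exists (fun u w => Zp u w - Zm u w); split.
  move=> u su ut; have [m1 i1 e1] := hp u su ut; have [m2 i2 e2] := hm u su ut.
  have [salF mF] := cF u su (ltW ut).
  split; last 2 [exact: intgB].
    apply/(measurable_wrtP salF); apply: measurable_funB; exact/(measurable_wrtP salF).
  move=> B FB; have mB := mF _ FB.
  by rewrite E_B// e1// e2// E_B// opprB addrC subrK.
apply: filterS2 cp cm => w [rp lp] [rm lm]; split.
  by move=> u su ut; apply: cvgB; [exact: rp|exact: rm].
by move=> u su ut; apply: is_cvgB; [exact: lp|exact: lm].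
Qed.

End cadlag_conditional_expectation.

(** * Dyadic grids and stopping *)

Section grid.
Context {R : realType}.
Variables s t : R.
Hypothesis st : s < t.
Implicit Types (u v : R) (n : nat).

Definition grid_point n (i : int) : R := s + (t - s) * (i%:~R / 2 ^+ n).

Definition grid_index n u : int := Num.ceil ((u - s) / (t - s) * 2 ^+ n).

(** The ends of the half-open grid cell that contains [u]. *)
Definition grid_right n u : R := grid_point n (grid_index n u).

Definition grid_left n u : R := grid_point n (grid_index n u - 1).

Let h0 : 0 < t - s. Proof. by rewrite subr_gt0. Qed.
Let p0 n : 0 < 2 ^+ n :> R. Proof. by rewrite exprn_gt0. Qed.

Lemma grid_point_lt n i u : (grid_point n i < u) = (i%:~R < (u - s) / (t - s) * 2 ^+ n).
Proof.
rewrite /grid_point -ltrBrDl mulrC -ltr_pdivlMr// ltr_pdivrMr//.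
Qed.

Lemma grid_point_le n i u : (u <= grid_point n i) = ((u - s) / (t - s) * 2 ^+ n <= i%:~R).
Proof. by rewrite leNgt grid_point_lt -leNgt. Qed.

Lemma grid_left_lt n u : grid_left n u < u.
Proof. by rewrite grid_point_lt; exact: ceilB1_lt. Qed.

Lemma grid_right_ge n u : u <= grid_right n u.
Proof. by rewrite grid_point_le; exact: ceil_ge. Qed.

Lemma grid_cell n i u : grid_point n i < u -> u <= grid_point n (i + 1) ->
  grid_index n u = i + 1.
Proof.
by rewrite grid_point_lt grid_point_le => h1 h2; apply: ceil_def; rewrite addrK h1.
Qed.

Lemma grid_point0 n : grid_point n 0 = s.
Proof. by rewrite /grid_point mul0r mulr0 addr0. Qed.

Lemma grid_point_max n : grid_point n (2 ^ n)%N = t.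
Proof.
rewrite /grid_point -pmulrn natrX divff ?mulr1; first by rewrite addrC subrK.
by rewrite gt_eqF.
Qed.

Lemma le_grid_point n i j : (i <= j) -> grid_point n i <= grid_point n j.
Proof.
by move=> ij; rewrite /grid_point lerD2l ler_pM2l// ler_pM2r ?invr_gt0// ler_int.
Qed.

Lemma grid_point_ge n (i : nat) : s <= grid_point n i%:Z.
Proof. by rewrite -[leLHS](grid_point0 n); apply: le_grid_point. Qed.

Lemma grid_point_le_max n (i : nat) : (i <= 2 ^ n)%N -> grid_point n i%:Z <= t.
Proof. by move=> h; rewrite -[leRHS](grid_point_max n); apply: le_grid_point. Qed.

Lemma grid_right_le n u : u <= t -> grid_right n u <= t.
Proof.
rewrite -[X in _ <= X -> _](grid_point_max n) grid_point_le => h.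
by rewrite -[leRHS](grid_point_max n); apply: le_grid_point; rewrite ceil_le_int.
Qed.

Lemma grid_left_ge n u : s < u -> s <= grid_left n u.
Proof.
rewrite -[X in X < _ -> _](grid_point0 n) grid_point_lt => h.
rewrite -[leLHS](grid_point0 n); apply: le_grid_point.
by rewrite subr_ge0 -gtz0_ge1 ceil_gt_int.
Qed.

Lemma grid_leftE n u : grid_left n u = grid_right n u - (t - s) / 2 ^+ n.
Proof.
by rewrite /grid_left /grid_right /grid_point intrB [(_ - 1) * _]mulrBl mulrBr mul1r addrA.
Qed.

Lemma grid_right_lt n u : grid_right n u < u + (t - s) / 2 ^+ n.
Proof. by rewrite -ltrBlDr -grid_leftE grid_left_lt. Qed.

Lemma grid_step_cvg0 : (t - s) / 2 ^+ n @[n --> \oo] --> 0.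
Proof.
rewrite -[X in _ --> X](mulr0 (t - s)); apply: cvgM; first exact: cvg_cst.
rewrite (_ : (fun n => _) = (fun n => (2^-1) ^+ n)); last first.
  by apply/funext => n; rewrite exprVn.
by apply: cvg_expr; rewrite ger0_norm ?invr_ge0// invf_lt1// ltr1n.
Qed.

Lemma near_grid_right u v : u < v -> \forall n \near \oo, grid_right n u < v.
Proof.
move=> uv; have vu : 0 < v - u by rewrite subr_gt0.
have := grid_step_cvg0 => /cvgrPdist_lt /(_ _ vu); apply: filterS => n.
rewrite sub0r normrN => h; apply: lt_trans (grid_right_lt n u) _.
by rewrite -ltrBrDl; apply: le_lt_trans h; exact: ler_norm.
Qed.

Lemma near_grid_left u v : v < u -> \forall n \near \oo, v < grid_left n u.
Proof.
move=> uv; have vu : 0 < u - v by rewrite subr_gt0.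
have := grid_step_cvg0 => /cvgrPdist_lt /(_ _ vu); apply: filterS => n.
rewrite sub0r normrN => h; rewrite grid_leftE ltrBrDr.
apply: lt_le_trans (grid_right_ge n u); rewrite -ltrBrDl.
by apply: le_lt_trans h; exact: ler_norm.
Qed.

(** Cells of a level are unions of cells of the next level. *)
Lemma grid_index_refine n u : (grid_index n.+1 u <= 2 * grid_index n u) /\
  (2 * (grid_index n u - 1) <= grid_index n.+1 u - 1).
Proof.
rewrite /grid_index exprS mulrCA; set y := _ / _ * _.
have /andP[h1 h2] := ceil_itv y; split.
  by rewrite ceil_le_int intrM ler_pM2l.
have : 2 * (Num.ceil y - 1) < Num.ceil (2 * y) by rewrite ceil_gt_int intrM ltr_pM2l.
by rewrite -ltzD1 subrK.
Qed.

Lemma grid_left_refine n u : grid_left n u <= grid_left n.+1 u.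
Proof.
have [_ h] := grid_index_refine n u.
rewrite [leLHS](_ : _ = grid_point n.+1 (2 * (grid_index n u - 1))).
  exact: le_grid_point.
rewrite /grid_left /grid_point intrM exprS -mulf_div divff ?mul1r//.
Qed.

Lemma grid_index_coarsen n u v : grid_index n.+1 u = grid_index n.+1 v ->
  grid_index n u = grid_index n v.
Proof.
have [h1 h2] := grid_index_refine n u; have [h3 h4] := grid_index_refine n v.
by move=> e; rewrite e in h1 h2; lia.
Qed.

Lemma grid_index_cell n u : s < u -> u <= t -> exists2 i : nat, (i < 2 ^ n)%N &
  grid_index n u = i%:Z + 1.
Proof.
move=> su ut; have k0 : 0 < grid_index n u.
  by rewrite /grid_index ceil_gt_int mulr_gt0// divr_gt0// subr_gt0.
have k1 : grid_index n u <= (2 ^ n)%N.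
  rewrite /grid_index ceil_le_int -pmulrn natrX ger_pMl//.
  by rewrite ler_pdivrMr// mul1r lerD2r.
move: k0 k1; case: (grid_index n u) => // -[|i] // _; rewrite lez_nat => h.
by exists i => //; rewrite -PoszD addn1.
Qed.

End grid.

Section stopping.
Context {R : realType} {d : measure_display} {Omega : measurableType d}.
Variable P : probability Omega R.
Implicit Types (Y Z : Omega -> R) (B C : set Omega).

Local Notation intg X := (P.-integrable [set: Omega] (EFin \o X)).
Local Notation E := (Rintegral P).

Section one_interval.
Variables (s t : R) (F : R -> set (set Omega)) (X : R -> Omega -> R) (tau : Omega -> R).
Hypothesis st : s < t.
Hypothesis filF : interval_filtration P s t F.
Hypothesis hX : forall u, s <= u -> u <= t -> measurable_wrt (F u) (X u).
Hypothesis rX : \forall w \ae P, forall u, s <= u -> u < t -> X x w @[x --> u^'+] --> X u w.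
Hypothesis htau : forall u, s <= u -> u <= t -> F u [set w | tau w <= u].

Let mF := filtration_measurable filF.
Let salF := filtration_salgebra filF.
Let monoF := filtration_le filF.

Let st' := ltW st.

Let pt n (i : nat) := grid_point s t n i%:Z.
Let pt_ge n i : s <= pt n i := grid_point_ge st n i.
Let pt_le n i : (i <= 2 ^ n)%N -> pt n i <= t := @grid_point_le_max _ _ _ st n i.

Let cell n (i : nat) := [set w | pt n i < tau w /\ tau w <= pt n i.+1].

Lemma stopping_gt u : s <= u -> u <= t -> F u [set w | u < tau w].
Proof.
move=> su ut; rewrite (_ : mkset _ = ~` [set w | tau w <= u]).
  by apply: salgebraC; [exact: salF|exact: htau].
by apply/seteqP; split => w /=; rewrite ltNge => /negP.
Qed.

Let F_cell n i : (i < 2 ^ n)%N -> F (pt n i.+1) (cell n i).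
Proof.
move=> h; rewrite /cell (_ : mkset _ = [set w | pt n i < tau w] `&` [set w | tau w <= pt n i.+1])//.
have h1 := pt_le h; have h2 := pt_le (ltnW h).
apply: salgebraI; first exact: salF.
  apply: (monoF (pt_ge n i) _ h1); first by apply: (le_grid_point st); rewrite lez_nat.
  exact: stopping_gt.
exact: htau.
Qed.

(** On the event [s < tau] only the values of [X] between [s] and [t] enter. *)
Definition stopped_after : Omega -> R :=
  (fun w => X (Num.min t (tau w)) w) \_ [set w | s < tau w].

Let stopped_grid n : Omega -> R :=
  (fun w => X (Num.min t (grid_right s t n (tau w))) w) \_ [set w | s < tau w].

Let grid_cell_right n i w : cell n i w -> grid_right s t n (tau w) = pt n i.+1.
Proof.
move=> [h1 h2]; rewrite /grid_right (@grid_cell _ _ _ st n i%:Z) //; last by rewrite -PoszD addn1.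
by rewrite -PoszD addn1.
Qed.

Let cell_gt n i w : cell n i w -> s < tau w.
Proof. by move=> [h _]; apply: le_lt_trans h. Qed.

Let stopped_grid_cell n i w : (i < 2 ^ n)%N -> cell n i w -> stopped_grid n w = X (pt n i.+1) w.
Proof.
move=> h c; rewrite /stopped_grid patchE mem_set; last exact: cell_gt c.
by rewrite (grid_cell_right c) min_r// pt_le.
Qed.

Let stopped_grid_late n w : t < tau w -> stopped_grid n w = X t w.
Proof.
move=> tt; rewrite /stopped_grid patchE mem_set; last exact: lt_trans tt.
by rewrite min_l//; apply: le_trans (grid_right_ge st n _); exact: ltW.
Qed.

Let stopped_grid_before n w : tau w <= s -> stopped_grid n w = 0.
Proof. by move=> h; rewrite /stopped_grid patchE memNset//= ltNge h. Qed.

Let cellP n w : s < tau w -> tau w <= t -> exists2 i, (i < 2 ^ n)%N & cell n i w.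
Proof.
move=> h1 h2; have [i i2 e] := grid_index_cell st n h1 h2; exists i => //.
split; first by have := grid_left_lt st n (tau w); rewrite /grid_left e addrK.
by have := grid_right_ge st n (tau w); rewrite /grid_right e -PoszD addn1.
Qed.

Let F_stopped_grid n : measurable_wrt (F t) (stopped_grid n).
Proof.
move=> B mB; have salt := salF st' (lexx t).
have Fs : F t [set w | s < tau w] by apply: (monoF _ st') => //; exact: stopping_gt.
rewrite (_ : _ @^-1` _ =
   (\bigcup_i (if (i < 2 ^ n)%N then cell n i `&` X (pt n i.+1) @^-1` B else set0)) `|`
   ([set w | t < tau w] `&` X t @^-1` B) `|`
   ([set w | tau w <= s] `&` (fun=> (0 : R)) @^-1` B)); last first.
  apply/seteqP; split => [w /= Bw|w /=].
    have [h1|h1] := ltP s (tau w); last by right; split=> //; rewrite -(stopped_grid_before n h1).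
    left; have [h2|h2] := leP (tau w) t; last by right; split => //; rewrite -(stopped_grid_late n h2).
    by left; have [i i2 c] := cellP n h1 h2; exists i => //; rewrite i2; split => //=;
      rewrite -(stopped_grid_cell i2 c).
  move=> [[[i _]|[h Bw]]|[h Bw]]; last 2 first.
  - by rewrite (stopped_grid_late n h).
  - by rewrite (stopped_grid_before n h).
  by case: ifPn => // i2 [c Bw]; rewrite (stopped_grid_cell i2 c).
apply: (salgebraU salt); first apply: (salgebraU salt).
- apply: (salgebra_bigcup salt) => i; case: ifPn => i2; last exact: salgebra0.
  apply: (salgebraI salt); apply: (monoF (pt_ge n i.+1) (pt_le i2) (lexx t)); first exact: F_cell.
  by apply: hX => //; exact: pt_le.
- by apply: (salgebraI salt); [exact: stopping_gt|exact: hX].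
- apply: (salgebraI salt); last exact: measurable_wrt_cst.
  by apply: (monoF (lexx s) st' (lexx t)); exact: htau.
Qed.

Let stopped_grid_cvg : \forall w \ae P, stopped_grid ^~ w @ \oo --> stopped_after w.
Proof.
apply: filterS rX => w rw.
have [h1|h1] := leP (tau w) s.
  rewrite /stopped_after patchE memNset /= ?ltNge ?h1//.
  by apply: cvg_near_cst; apply: nearW => n; rewrite stopped_grid_before.
have [h2|h2] := leP t (tau w).
  rewrite /stopped_after patchE mem_set//= min_l//.
  apply: cvg_near_cst; apply: nearW => n; rewrite /stopped_grid patchE mem_set//= min_l//.
  exact: le_trans (grid_right_ge st n _).
rewrite /stopped_after patchE mem_set//= min_r ?(ltW h2)//.
apply/cvgrPdist_le => e e0.
have := rw _ (ltW h1) h2 => /cvgrPdist_le /(_ _ e0) /near_rightP[v tv hv].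
have := near_grid_right st tv; apply: filterS => n nv.
rewrite /stopped_grid patchE mem_set//= min_r; last by apply: grid_right_le => //; exact: ltW.
have := grid_right_ge st n (tau w); rewrite le_eqVlt => /orP[/eqP <-|h].
  by rewrite subrr normr0 ltW.
by apply: hv; rewrite h.
Qed.

Lemma measurable_stopped_after : measurable_wrt (F t) stopped_after.
Proof.
have salt := salF st' (lexx t).
apply: (measurable_wrt_cvg_ae salt _ (F_stopped_grid) stopped_grid_cvg).
have [_ _ _ cF] := filF => N /cF; exact: monoF.
Qed.

Section martingale.
Hypothesis iX : forall u, s <= u -> u <= t -> intg (X u).
Hypothesis EX : forall u, s <= u -> u <= t -> forall B, F u B -> E B (X u) = E B (X t).

Let E_norm_le u B : s <= u -> u <= t -> F u B ->
  E B (fun w => `|X u w|) <= E B (fun w => `|X t w|).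
Proof.
move=> su ut FB; have salu := salF su ut.
have FC : F u [set w | 0 <= X u w].
  by apply: (measurable_wrt_le salu) => //; [exact: measurable_wrt_cst|exact: hX].
have mC := mF su ut FC; have mB := mF su ut FB; have iXu := iX su ut; have iXt := iX st' (lexx t).
set C := mkset _ in FC mC.
rewrite (E_split (C := C) (intg_norm iXu) mB mC) (E_split (C := C) (intg_norm iXt) mB mC) lerD//.
  rewrite (_ : E _ _ = E (B `&` C) (X u)); last first.
    by apply: eq_Rintegral => w /set_mem[_ h]; rewrite ger0_norm.
  rewrite EX//; last exact: salgebraI.
  by apply: E_le => //; [exact: measurableI|exact: intg_norm|move=> w _; exact: ler_norm].
rewrite (_ : E _ _ = E (B `\` C) (fun w => -1 * X u w)); last first.
  apply: eq_Rintegral => w /set_mem[_ /= /negP h]; rewrite ltr0_norm ?mulN1r// ltNge//.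
have mD : measurable (B `\` C) by exact: measurableD.
rewrite E_Z// EX//; last exact: salgebraD.
rewrite -E_Z//; apply: E_le => //; [exact: intgZ|exact: intg_norm|].
by move=> w _; rewrite mulN1r -normrN; exact: ler_norm.
Qed.

Let E_cells (f : Omega -> R) C n : intg f -> measurable C ->
  E (C `&` [set w | s < tau w]) f =
  \sum_(i < 2 ^ n) E (C `&` cell n i) f + E (C `&` [set w | t < tau w]) f.
Proof.
move=> if_ mC.
suff h j : (j <= 2 ^ n)%N -> E (C `&` [set w | s < tau w]) f =
  \sum_(i < j) E (C `&` cell n i) f + E (C `&` [set w | pt n j < tau w]) f.
  by rewrite (h _ (leqnn _)) /pt grid_point_max.
have mgt i : (i <= 2 ^ n)%N -> measurable [set w | pt n i < tau w].
  by move=> i2; apply: mF (stopping_gt _ _) => //; exact: pt_le.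
elim: j => [|j IH] j2; first by rewrite big_ord0 add0r /pt grid_point0.
rewrite IH; last exact: ltnW.
rewrite big_ord_recr /= -addrA; congr (_ + _).
have mc : measurable (cell n j) by apply: mF (F_cell j2) => //; exact: pt_le.
rewrite (E_split (C := cell n j) if_ (measurableI _ _ mC (mgt _ (ltnW j2))) mc).
congr (E _ _ + E _ _).
  by apply/seteqP; split => w [h1 h2]; [split => //; case: h1|split => //; split=> //; case: h2].
apply/seteqP; split => w.
  by move=> [[h1 h2] h3]; split => //=; rewrite ltNge; apply/negP => h4; apply: h3; split.
move=> [h1 h2]; split; last by case=> _; rewrite leNgt h2.
by split => //=; apply: le_lt_trans h2; apply: (le_grid_point st); rewrite lez_nat.
Qed.

Let intg_stopped_grid n : intg (stopped_grid n).
Proof.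
have mt : measurable_fun setT (stopped_grid n).
  by apply: (measurable_wrt_measurable _ (@F_stopped_grid n)) => B; apply: mF.
pose b w := \sum_(i < 2 ^ n) `|X (pt n i.+1) w| + `|X t w|.
have ib : intg b.
  apply: intgD; last by apply: intg_norm; exact: iX.
  rewrite (_ : EFin \o _ = (fun w => \sum_(i < 2 ^ n) (`|X (pt n i.+1) w|)%:E)%E); last first.
    by apply/funext => w /=; rewrite sumEFin.
  apply: integrable_sum => //= i _; apply: intg_norm; apply: iX => //; exact: pt_le.
apply: (intg_le mt ib); apply: aeW => w.
have b0 : 0 <= b w by rewrite addr_ge0// sumr_ge0.
rewrite (ger0_norm b0).
have [h1|h1] := leP (tau w) s; first by rewrite stopped_grid_before// normr0.
have [h2|h2] := leP (tau w) t; last first.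
  by rewrite stopped_grid_late// lerDr sumr_ge0.
have [i i2 c] := cellP n h1 h2; rewrite (stopped_grid_cell i2 c) /b.
rewrite (bigD1 (Ordinal i2))//= -addrA lerDl addr_ge0// sumr_ge0//.
Qed.

Let E_stopped_grid n C : measurable C ->
  (forall i, (i < 2 ^ n)%N -> F (pt n i.+1) (C `&` cell n i)) ->
  F t (C `&` [set w | t < tau w]) ->
  E C (stopped_grid n) = E (C `&` [set w | s < tau w]) (X t) /\
  E C (fun w => `|stopped_grid n w|) <= E (C `&` [set w | s < tau w]) (fun w => `|X t w|).
Proof.
move=> mC FC Ft.
have ms : measurable [set w | s < tau w] by apply: mF (stopping_gt _ _).
have iXt := iX st' (lexx t).
have off f : (forall w, tau w <= s -> f w = 0) ->
    E C f = E (C `&` [set w | s < tau w]) f.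
  move=> f0; rewrite -E_restrict; apply: eq_Rintegral => w _.
  rewrite /=; case: ifPn => // /negP; rewrite inE /= => /negP; rewrite -leNgt.
  exact: f0.
split.
  rewrite off; last by move=> w; exact: stopped_grid_before.
  rewrite (E_cells n (intg_stopped_grid n) mC) (E_cells n iXt mC); congr (_ + _).
    apply: eq_bigr => i _; rewrite -(@EX (pt n i.+1))//; last 2 first.
    - exact: pt_le.
    - exact: FC.
    by apply: eq_Rintegral => w /set_mem[_ c]; exact: stopped_grid_cell c.
  by apply: eq_Rintegral => w /set_mem[_ c]; exact: stopped_grid_late.
rewrite off; last by move=> w h; rewrite stopped_grid_before// normr0.
rewrite (E_cells n (intg_norm (intg_stopped_grid n)) mC) (E_cells n (intg_norm iXt) mC) lerD//.
  apply: ler_sum => i _.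
  rewrite (_ : E _ _ = E (C `&` cell n i) (fun w => `|X (pt n i.+1) w|)).
    by apply: E_norm_le => //; [exact: pt_le|exact: FC].
  by apply: eq_Rintegral => w /set_mem[_ c]; rewrite (stopped_grid_cell _ c).
rewrite (_ : E _ (fun w => `|stopped_grid n w|) = E (C `&` [set w | t < tau w]) (fun w => `|X t w|))//.
by apply: eq_Rintegral => w /set_mem[_ c]; rewrite stopped_grid_late.
Qed.

(** Optional stopping: along a grid it is the martingale property on each event
    that [tau] falls in a given cell; the passage to the limit is by uniform
    integrability. *)
Lemma optional_stopping : intg stopped_after /\
  forall B, F s B -> E B stopped_after = E (B `&` [set w | s < tau w]) (X t).
Proof.
have iXt := iX st' (lexx t).
have ms : measurable [set w | s < tau w] by apply: mF (stopping_gt _ _).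
have m1 : measurable_fun setT stopped_after.
  by apply: (measurable_wrt_measurable _ measurable_stopped_after) => B; apply: mF.
have [i1 c1] : intg stopped_after /\
    forall B, measurable B -> E B (stopped_grid n) @[n --> \oo] --> E B stopped_after.
  apply: (E_cvg_dominated_tails (Y := X t)) => // n c c0.
  set C := [set w | _].
  have mC : measurable C by apply: measurable_norm_gt; exact: intg_measurable (intg_stopped_grid n).
  have gt u : s <= u -> u <= t -> F u [set w | c < `|X u w|].
    move=> su ut; have salu := salF su ut; apply/(measurableH salu).
    apply: (@measurable_norm_gt _ _ (g_sigma_algebraType (F u))).
    by apply/(measurable_wrtP salu); exact: hX.
  have [|| _ h] := @E_stopped_grid n C mC.
  - move=> i i2; have -> : C `&` cell n i = cell n i `&` [set w | c < `|X (pt n i.+1) w|].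
      apply/seteqP; split => w [h1 h2]; split => //; move: h1 h2; rewrite /C /=.
        by move=> + h; rewrite (stopped_grid_cell i2 h).
      by move=> h; rewrite (stopped_grid_cell i2 h).
    have pl := pt_le i2.
    by apply: salgebraI; [exact: salF|exact: F_cell|exact: gt].
  - have -> : C `&` [set w | t < tau w] = [set w | t < tau w] `&` [set w | c < `|X t w|].
      apply/seteqP; split => w [h1 h2]; split => //; move: h1 h2; rewrite /C /=.
        by move=> + h; rewrite (stopped_grid_late n h).
      by move=> h; rewrite (stopped_grid_late n h).
    by apply: salgebraI; [exact: salF|exact: stopping_gt|exact: gt].
  apply: le_trans h _; apply: E_subset => //; last exact: intg_norm.
  exact: measurableI.
split => // B FB; have mB := mF (lexx s) st' FB.
apply: (cvg_unique _ (c1 B mB)) => //; apply: cvg_near_cst; apply: nearW => n.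
have [|| -> //] := @E_stopped_grid n B mB.
  move=> i i2; have pl := pt_le i2; apply: salgebraI; [exact: salF| |exact: F_cell].
  exact: (monoF (lexx s) (pt_ge n i.+1) pl FB).
apply: salgebraI; [exact: salF| |exact: stopping_gt].
exact: (monoF (lexx s) st' (lexx t) FB).
Qed.

End martingale.

End one_interval.

End stopping.

(** * Minimality of the Snell envelope *)

Section competitor.
Context {R : realType} {d : measure_display} {Omega : measurableType d}.
Variable P : probability Omega R.
Implicit Types (Y Z : Omega -> R) (B C : set Omega).

Local Notation intg X := (P.-integrable [set: Omega] (EFin \o X)).
Local Notation E := (Rintegral P).

(** Only rational points are tested, because almost sure statements can be
    combined countably often only. *)
Lemma right_limit_ge0 (f : R -> R) (u v l : R) : u < v ->
  f x @[x --> u^'+] --> l -> (forall q : rat, u < ratr q < v -> 0 <= f (ratr q)) -> 0 <= l.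
Proof.
move=> uv fl fq; rewrite leNgt; apply/negP => l0.
have l2 : 0 < - l / 2 by rewrite divr_gt0// oppr_gt0.
have := fl => /cvgrPdist_le /(_ _ l2) /near_rightP[v' uv' h].
have [q] : exists q : rat, ratr q \in `]u, (Num.min v v')[ by apply: rat_in_itvoo; rewrite lt_min uv.
rewrite in_itv /= lt_min => /and3P[uq qv qv'].
have := h (ratr q); rewrite uq qv' => /(_ isT); have := fq q; rewrite uq qv => /(_ isT).
rewrite ler_norml => fq0 /andP[h1 h2]; lra.
Qed.

Lemma cvg_minr (T : Type) (W : set_system T) (f g : T -> R) (l m : R) : Filter W ->
  f @ W --> l -> g @ W --> m -> (fun x => Num.min (f x) (g x)) @ W --> Num.min l m.
Proof.
move=> FW fl gm; apply/cvgrPdist_le => e e0.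
have := fl => /cvgrPdist_le /(_ _ e0) h1; have := gm => /cvgrPdist_le /(_ _ e0) h2.
apply: filterS2 h1 h2 => x; rewrite !ler_norml => /andP[? ?] /andP[? ?].
by case: (leP l m) => ?; case: (leP (f x) (g x)) => ?; apply/andP; split; lra.
Qed.

Variables (T : \bar R) (F : \bar R -> set (set Omega)).
Hypothesis usualF : usual_filtration T F P.

Lemma usual_interval_filtration (s t : R) : 0 <= s -> s <= t -> (t%:E <= T)%E ->
  interval_filtration P s t (fun u => F u%:E).
Proof.
move=> s0 st tT; have [cF mF rF nF] := usualF.
have tm u : s <= u -> u <= t -> times T u%:E.
  move=> su ut; split; first by rewrite lee_fin (le_trans s0).
  by apply: le_trans tT; rewrite lee_fin.
split.
- by move=> u su ut; apply: cF; exact: tm.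
- move=> u v su uv vt; apply: mF.
  + by apply: tm => //; exact: le_trans vt.
  + by apply: tm => //; exact: le_trans uv.
  + by rewrite lee_fin.
- move=> u su ut B h; have tu := tm u su (ltW ut).
  rewrite rF//; last by apply: lt_le_trans tT; rewrite lte_fin.
  have late x : (t%:E < x)%E -> (x <= T)%E -> F x B.
    move=> tx xT; apply: (mF t%:E x) => //; last 2 [exact: ltW].
    + by apply: tm => //; exact: le_trans su (ltW ut).
    + by split => //; apply: le_trans (ltW tx); rewrite lee_fin (le_trans s0)// (le_trans su)// ltW.
    + by apply: h.
  move=> [r| |] [ux xT] //=.
    have [rt|tr] := leP r t; first by apply: h => //; rewrite -lte_fin.
    by apply: late => //; rewrite lte_fin.
  by apply: late => //; exact: ltry.
- move=> N nN; apply: (mF 0%E s%:E) => //; last exact: nF.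
  + by split => //; apply: le_trans tT; rewrite lee_fin (le_trans s0).
  + exact: tm.
Qed.

Lemma cond_exp_E (H : set (set Omega)) Y Z : H `<=` measurable -> intg Y ->
  cond_exp P H Y Z <->
  [/\ measurable_wrt H Z, intg Z & forall B, H B -> E B Z = E B Y].
Proof.
move=> Hm iY; split=> -[hZ iZ EZ]; split => // B HB; first by rewrite /Rintegral EZ.
by rewrite -!EFin_E ?EZ//; exact: Hm.
Qed.

Lemma supermartingaleP (V : \bar R -> Omega -> R) :
  supermartingale T F P V <->
  [/\ adapted T F V, integrable_process T P V &
      forall r v, times T r -> times T v -> (r <= v)%E ->
        forall B, F r B -> E B (V v) <= E B (V r)].
Proof.
have [cF _ _ _] := usualF.
split=> -[aV iV EV]; split => // r v tr tv rv.
  have [Z] := EV r v tr tv rv; have [salr mr] := cF r tr.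
  move=> /(cond_exp_E _ mr (iV v tv))[hZ iZ EZ] ZV B FB; rewrite -EZ//.
  apply: E_le_ae => //; [exact: mr|exact: iV|].
  by apply: filterS ZV => w.
have [salr mr] := cF r tr.
have [Z [hZ iZ EZ]] := ex_cond_exp salr mr (iV v tv).
exists Z; first exact/(cond_exp_E _ mr (iV v tv)).
apply: (ae_le_of_E salr mr) => //; [exact: aV|exact: iV|].
by move=> B FB; rewrite EZ//; exact: EV.
Qed.

Section one_interval.
Variables (G S : \bar R -> Omega -> R).
Hypothesis cG : cadlag_process T F P G.
Hypothesis snellS : snell_envelope T F P G S.
Variables (s t : R).
Hypotheses (s0 : 0 <= s) (st : s < t) (tT : (t%:E <= T)%E).
Variables (Y : Omega -> R) (c : R -> Omega -> R).
Hypothesis iY : intg Y.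
Hypothesis hc : forall u, s <= u -> u <= t -> measurable_wrt (F u%:E) (c u).
Hypothesis ic : forall u, s <= u -> u <= t -> intg (c u).
Hypothesis ndc : \forall w \ae P, forall u v, s <= u -> u <= v -> v <= t -> c u w <= c v w.
Hypothesis rc : \forall w \ae P, 
  (forall u, s <= u -> u < t -> c x w @[x --> u^'+] --> c u w) /\
  (forall u, s < u -> u <= t -> cvg (c x w @[x --> u^'-])).
Hypothesis iG : forall u, s <= u -> u < t -> intg (G u%:E).
Hypothesis SY : \forall w \ae P, S t%:E w + c t w <= Y w.
Hypothesis GY : forall u, s <= u -> u < t -> forall B, F u%:E B ->
  E B (G u%:E) <= E B (fun w => Y w - c u w).

Let filF := usual_interval_filtration s0 (ltW st) tT.

Let tm u : s <= u -> u <= t -> times T u%:E.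
Proof.
move=> su ut; split; first by rewrite lee_fin (le_trans s0).
by apply: le_trans tT; rewrite lee_fin.
Qed.

Let mF x B : times T x -> F x B -> measurable B.
Proof. by move=> tx; have [+ _ _ _] := usualF => /(_ _ tx)[_]; exact. Qed.

Let salF x : times T x -> sigma_algebra setT (F x).
Proof. by move=> tx; have [+ _ _ _] := usualF => /(_ _ tx)[]. Qed.

Section version.
Variable X : R -> Omega -> R.
Hypothesis XP : forall u, s <= u -> u < t -> [/\ measurable_wrt (F u%:E) (X u), intg (X u) &
     forall B, F u%:E B -> E B (X u) = E B Y].
Hypothesis cX : \forall w \ae P,
     (forall u, s <= u -> u < t -> X x w @[x --> u^'+] --> X u w) /\
     (forall u, s < u -> u <= t -> cvg (X x w @[x --> u^'-])).

Let Z u w := X u w - c u w.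

Let hZ u : s <= u -> u < t -> measurable_wrt (F u%:E) (Z u).
Proof.
move=> su ut; have [hX _ _] := XP su ut.
by apply: measurable_wrtB => //; [apply: salF; exact: tm su (ltW ut)|apply: hc => //; exact: ltW].
Qed.

Let iZ u : s <= u -> u < t -> intg (Z u).
Proof. by move=> su ut; have [_ iX _] := XP su ut; apply: intgB => //; apply: ic => //; exact: ltW. Qed.

Let EZ u B : s <= u -> u < t -> F u%:E B -> E B (Z u) = E B (fun w => Y w - c u w).
Proof.
move=> su ut FB; have [_ iX EX] := XP su ut; have mB := mF (tm su (ltW ut)) FB.
have icu := ic su (ltW ut).
by rewrite E_B// E_B// EX.
Qed.

(** A rival of [S] that only differs from it on [[s, t)], where it may follow the
    cheaper [Z]. *)
Definition competitor : \bar R -> Omega -> R := fun x w =>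
  if (s%:E <= x)%E && (x < t%:E)%E then Num.min (S x w) (Z (fine x) w) else S x w.

Let V := competitor.

Let V_in u w : s <= u -> u < t -> V u%:E w = Num.min (S u%:E w) (Z u w).
Proof. by move=> su ut; rewrite /V /competitor lee_fin su lte_fin ut. Qed.

Let V_out x w : ~~ ((s%:E <= x)%E && (x < t%:E)%E) -> V x w = S x w.
Proof. by rewrite /V /competitor => /negbTE ->. Qed.

Let inP x : (s%:E <= x)%E && (x < t%:E)%E -> exists u, [/\ x = u%:E, s <= u & u < t].
Proof. by case: x => [u| |] /andP[]; rewrite ?lee_fin ?lte_fin// => su ut; exists u. Qed.

Let V_le x w : V x w <= S x w.
Proof. by rewrite /V /competitor; case: ifP => // _; rewrite ge_min lexx. Qed.

Let superS : [/\ adapted T F S, integrable_process T P S &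
      forall r v, times T r -> times T v -> (r <= v)%E ->
        forall B, F r B -> E B (S v) <= E B (S r)].
Proof. by apply/supermartingaleP; have [_] := snellS. Qed.

Lemma competitor_adapted : adapted T F V.
Proof.
move=> x tx; have [aS _ _] := superS.
have [/inP[u [-> su ut]]|xo] := boolP ((s%:E <= x)%E && (x < t%:E)%E); last first.
  by rewrite (_ : V x = S x); [exact: aS|apply/funext => w; exact: V_out].
have tu := tm su (ltW ut).
rewrite (_ : V u%:E = fun w => Num.min (S u%:E w) (Z u w)); last first.
  by apply/funext => w; exact: V_in.
by apply: measurable_wrt_min; [exact: salF|exact: aS|exact: hZ].
Qed.

Lemma competitor_cadlag : cadlag_paths T P V.
Proof.
have [[_ cS] _ _ _] := snellS.
apply: filterS3 cS cX rc => w cSw [rXw lXw] [rcw lcw] r rT.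
have [h1 h2] := cSw r rT; split.
  move=> rltT; have [rs|sr] := ltP r s.
    rewrite V_out ?lee_fin ?leNgt ?rs//; apply: cvg_trans (h1 rltT).
    apply: near_eq_cvg; apply/near_rightP; exists s => // x /andP[_ xs].
    by rewrite V_out// lee_fin leNgt xs.
  have [rt|tr] := ltP r t.
    rewrite V_in//; apply: cvg_trans; last first.
      exact: (cvg_minr _ (h1 rltT) (cvgB (rXw r sr rt) (rcw r sr rt))).
    apply: near_eq_cvg; apply/near_rightP; exists t => // x /andP[rx xt].
    by rewrite V_in// (le_trans sr)// ltW.
  rewrite V_out ?lte_fin ?negb_and -?leNgt ?tr ?orbT//; apply: cvg_trans (h1 rltT).
  apply: near_eq_cvg; apply/near_rightP; exists (r + 1); first by rewrite ltrDl.
  move=> x /andP[rx _]; rewrite V_out// lte_fin negb_and -leNgt orbC.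
  by rewrite (le_trans tr)// ltW.
move=> r0; have [rs|sr] := leP r s.
  have /cvg_ex[l hl] := h2 r0. 
  apply: (cvgP l); apply: cvg_trans hl.
  apply: near_eq_cvg; apply/near_leftP; exists (r - 1); first by rewrite ltrBlDr ltrDl.
  move=> x /andP[_ xr]; rewrite V_out// lee_fin negb_and -ltNge.
  by rewrite (lt_le_trans xr).
have [rt|tr] := leP r t.
  have /cvg_ex[l1 hl1] := h2 r0; have /cvg_ex[l2 hl2] := lXw r sr rt. 
  have /cvg_ex[l3 hl3] := lcw r sr rt. 
  apply: (cvgP (Num.min l1 (l2 - l3))); apply: cvg_trans; last first.
    exact: (cvg_minr _ hl1 (cvgB hl2 hl3)).
  apply: near_eq_cvg; apply/near_leftP; exists s => // x /andP[sx xr].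
  by rewrite V_in// ?ltW// (lt_le_trans xr).
have /cvg_ex[l hl] := h2 r0. 
apply: (cvgP l); apply: cvg_trans hl.
apply: near_eq_cvg; apply/near_leftP; exists t => // x /andP[tx xr].
by rewrite V_out// lte_fin negb_and -leNgt orbC ltW.
Qed.

Lemma competitor_integrable : integrable_process T P V.
Proof.
have [aS iS ES] := superS.
move=> x tx; have mV : measurable_fun setT (V x).
    by apply: (measurable_wrt_measurable _ (competitor_adapted tx)) => B; exact: mF.
  have [/inP[u [xu su ut]]|xo] := boolP ((s%:E <= x)%E && (x < t%:E)%E); last first.
    by rewrite (_ : V x = S x); [exact: iS|apply/funext => w; exact: V_out].
  have i1 := intgD (intg_norm (iS x tx)) (intg_norm (iZ su ut)).
  apply: (intg_le mV i1); apply: aeW => w.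
  rewrite (ger0_norm (_ : 0 <= `|S x w| + _)) ?addr_ge0// xu V_in//.
  by case: (leP (S u%:E w) (Z u w)) => _; rewrite ?lerDl ?lerDr.
Qed.

Lemma competitor_supermartingale : supermartingale T F P V.
Proof.
have [aS iS ES] := superS.
apply/supermartingaleP; split.
- exact: competitor_adapted.
- exact: competitor_integrable.
move=> r v tr tv rv B FB.
have mB := mF tr FB; have iV := competitor_integrable.
have VS C : measurable C -> E C (V v) <= E C (S v).
  by move=> mC; apply: E_le => //; [exact: iV|exact: iS].
have [/inP[u [xu su ut]]|xo] := boolP ((s%:E <= r)%E && (r < t%:E)%E); last first.
  rewrite (_ : V r = S r); last by apply/funext => w; exact: V_out.
  exact: le_trans (VS B mB) (ES _ _ tr tv rv B FB).
subst r; have salr := salF tr; have iu := ltW ut.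
have hS := aS _ tr.
have FC : F u%:E [set w | S u%:E w <= Z u w] by apply: measurable_wrt_le => //; exact: hZ.
set C := mkset _ in FC; have mC := mF tr FC.
have FI := salgebraI salr FB FC; have FD := salgebraD salr FB FC.
have mD := mF tr FD.
rewrite (E_split (C := C) (iV _ tv) mB mC) (E_split (C := C) (iV _ tr) mB mC) lerD//.
  rewrite (_ : E _ (V u%:E) = E (B `&` C) (S u%:E)); last first.
    apply: eq_Rintegral => w /set_mem[_ h].
    by rewrite -[LHS]/(V u%:E w) (V_in w su ut) min_l.
  exact: le_trans (VS _ (mF tr FI)) (ES _ _ tr tv rv _ FI).
rewrite (_ : E _ (V u%:E) = E (B `\` C) (Z u)); last first.
  apply: eq_Rintegral => w /set_mem[_ /= /negP h]; rewrite -[LHS]/(V u%:E w) (V_in w su ut) min_r// ltW//.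
  by rewrite ltNge.
rewrite EZ//; have iYu := intgB iY (ic su iu).
have dec u' : u <= u' -> u' <= t ->
    E (B `\` C) (fun w => Y w - c u' w) <= E (B `\` C) (fun w => Y w - c u w).
  move=> uu' u't; apply: E_le_ae => //; first by apply: intgB => //; apply: ic => //; exact: le_trans uu'.
  by apply: filterS ndc => w h _; rewrite lerD2l lerN2; exact: h.
have [/inP[u' [xu' su' u't]]|xo] := boolP ((s%:E <= v)%E && (v < t%:E)%E).
  subst v; have uu' : u <= u' by rewrite -lee_fin.
  apply: le_trans (dec _ uu' (ltW u't)); rewrite -EZ//; last first.
    by have [_ mo _ _] := usualF; exact: (mo _ _ tr tv).
  by apply: E_le => //; [exact: iV|exact: iZ|move=> w _; rewrite V_in// ge_min lexx orbT].
have tv' : (t%:E <= v)%E.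
  move: xo; rewrite negb_and -!ltNge => /orP[vs|]; last by rewrite leNgt.
  by have := lt_le_trans vs (le_trans (su : (s%:E <= u%:E)%E) rv); rewrite ltxx.
have tt := tm (ltW st) (lexx t).
have FDt : F t%:E (B `\` C) by have [_ mo _ _] := usualF; exact: (mo _ _ tr tt).
apply: le_trans (VS _ mD) _; apply: le_trans (ES _ _ tt tv tv' _ FDt) _.
apply: le_trans (dec _ iu (lexx t)); apply: E_le_ae => //; [exact: iS| |].
  by apply: intgB => //; apply: ic => //; exact: ltW.
by apply: filterS SY => w h _; rewrite lerBrDr.
Qed.

Lemma competitor_dominates : dominates T P V G.
Proof.
have [_ _ domS _] := snellS; have [aG pG] := cG.
have ZG : \forall w \ae P, forall q : rat, s <= ratr q -> ratr q < t ->
    G (ratr q)%:E w <= Z (ratr q) w.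
  apply: ae_forall_countable => q.
  have [sq|_] := leP s (ratr q); last exact: aeW.
  have [qt|_] := ltP (ratr q) t; last exact: aeW.
  have tq := tm sq (ltW qt).
  have : \forall w \ae P, G (ratr q)%:E w <= Z (ratr q) w.
    apply: (ae_le_of_E (salF tq)) => //; [by move=> B; exact: mF|exact: aG|exact: hZ|exact: iG|exact: iZ|].
    by move=> B FB; rewrite EZ//; exact: GY.
  by apply: filterS.
near=> w => x tx.
have domSw : forall x, times T x -> G x w <= S x w by near: w; exact: domS.
have ZGw : forall q : rat, s <= ratr q -> ratr q < t -> G (ratr q)%:E w <= Z (ratr q) w.
  by near: w; exact: ZG.
have [rXw _] : (forall u, s <= u -> u < t -> X x w @[x --> u^'+] --> X u w) /\
     (forall u, s < u -> u <= t -> cvg (X x w @[x --> u^'-])) by near: w; exact: cX.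
have [rcw _] : (forall u, s <= u -> u < t -> c x w @[x --> u^'+] --> c u w) /\
     (forall u, s < u -> u <= t -> cvg (c x w @[x --> u^'-])) by near: w; exact: rc.
have pGw : forall r : R, finite_times T r ->
    ((r%:E < T)%E -> G x%:E w @[x --> r^'+] --> G r%:E w) /\
    (0 < r -> cvg (G x%:E w @[x --> r^'-])) by near: w; exact: pG.
have [/inP[u [-> su ut]]|xo] := boolP ((s%:E <= x)%E && (x < t%:E)%E); last first.
  by rewrite V_out//; exact: domSw.
have tu := tm su (ltW ut).
rewrite V_in// le_min domSw//= -subr_ge0.
have [rG _] := pGw u (conj (le_trans s0 su) (proj2 tu)).
apply: (@right_limit_ge0 (fun x => X x w - c x w - G x%:E w) u t _ ut).
  apply: cvgB; first by apply: cvgB; [exact: rXw|exact: rcw].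
  by apply: rG; apply: lt_le_trans tT; rewrite lte_fin.
move=> q /andP[uq qt]; rewrite subr_ge0; apply: ZGw => //.
by apply: ltW; exact: le_lt_trans uq.
Unshelve. all: by end_near. Qed.

Lemma snell_le_version B : F s%:E B -> E B (S s%:E) <= E B (fun w => Y w - c s w).
Proof.
move=> FB; have [_ _ _ minS] := snellS; have [_ iS _] := superS.
have ts := tm (lexx s) (ltW st).
rewrite -EZ//; apply: E_le_ae => //; [exact: mF FB|exact: iS|exact: iZ|].
have := minS V (conj competitor_adapted competitor_cadlag) competitor_supermartingale competitor_dominates.
apply: filterS => w /(_ _ ts) + _; rewrite V_in// le_min => /andP[_].
by [].
Qed.

End version.

(** [Y - c] bounds the reward from [s] on.  Up to time [t] the minimum of [S]
    with a version of the supermartingale [E[Y | F_u] - c_u] is again a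
    supermartingale above [G], so it is not below [S]. *)
Lemma snell_le B : F s%:E B -> E B (S s%:E) <= E B (fun w => Y w - c s w).
Proof.
have [X [XP cX]] := cadlag_version filF iY st.
exact: snell_le_version XP cX B.
Qed.

End one_interval.
End competitor.

(** * Random measures on the time axis *)

Section increasing_processes.
Context {R : realType} {d : measure_display} {Omega : measurableType d}.
Variable P : probability Omega R.
Implicit Types (Y Z : Omega -> R) (B C : set Omega).

Local Notation intg X := (P.-integrable [set: Omega] (EFin \o X)).
Local Notation E := (Rintegral P).

(** The paths are regular for all outcomes: exceptional ones are removed before
    this notion is used. *)
Definition increasing_process (s t : R) (a : R -> Omega -> R) : Prop :=
  [/\ (forall w, a s w = 0),
      (forall w u v, s <= u -> u <= v -> v <= t -> a u w <= a v w),
      (forall w u, s <= u -> u < t -> a x w @[x --> u^'+] --> a u w),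
      (forall u, s <= u -> u <= t -> measurable_fun setT (a u)) &
      intg (a t)].

Section time_change.
Variables (s t : R) (a : R -> Omega -> R).
Hypothesis st : s < t.
Hypothesis incr_a : increasing_process s t a.

Let st' := ltW st.
Let a_s w : a s w = 0. Proof. by case: incr_a. Qed.
Let nda w u v : s <= u -> u <= v -> v <= t -> a u w <= a v w. Proof. by case: incr_a => _ + _ _ _; exact. Qed.
Let ra w u : s <= u -> u < t -> a x w @[x --> u^'+] --> a u w. Proof. by case: incr_a => _ _ + _ _; exact. Qed.
Let ma u : s <= u -> u <= t -> measurable_fun setT (a u). Proof. by case: incr_a => _ _ _ + _; exact. Qed.

Lemma increasing_process_ge0 u w : s <= u -> u <= t -> 0 <= a u w.
Proof. by move=> su ut; rewrite -(a_s w) nda. Qed.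

Lemma increasing_process_intg u : s <= u -> u <= t -> intg (a u).
Proof.
move=> su ut; have [_ _ _ _ ia] := incr_a; apply: intg_le (ma su ut) ia _.
apply: aeW => w; rewrite !ger0_norm ?increasing_process_ge0//; exact: nda.
Qed.

(** The first time at which the path of [a] reaches a given level: a time change
    that carries Lebesgue measure on [(0, a_t]] to the measure [da].  Thus the
    measure [P(dw) da_y(w)] is the image of a product measure, and its
    measurability in [w] needs no separate argument. *)
Definition reach_time (z : Omega * R) : R :=
  inf [set u | s <= u /\ (u = t \/ u <= t /\ z.2 <= a u z.1)].

Definition time_change (z : Omega * R) : R * Omega := (reach_time z, z.1).

Definition levels : set (Omega * R) := [set z | 0 < z.2 /\ z.2 <= a t z.1].

Lemma reach_time_ge z : s <= reach_time z.
Proof. by apply: lb_le_inf; [exists t; split; [|left]|move=> u []]. Qed.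

Let lb z : has_lbound [set u | s <= u /\ (u = t \/ u <= t /\ z.2 <= a u z.1)].
Proof. by exists s => u []. Qed.

Lemma reach_time_le z : reach_time z <= t.
Proof. by apply: (ge_inf (lb _)) => //; split; [|left]. Qed.

Lemma reach_time_leP z v : s <= v -> v < t -> (reach_time z <= v) = (z.2 <= a v z.1).
Proof.
move=> sv vt; apply/idP/idP => [h|h]; last first.
  by apply: (ge_inf (lb _)) => //; split => //; right; split => //; exact: ltW.
rewrite leNgt; apply/negP => az; have e0 : 0 < (z.2 - a v z.1) / 2 by rewrite divr_gt0// subr_gt0.
have := @ra z.1 v sv vt => /cvgrPdist_le /(_ _ e0) /near_rightP[v' vv' hv].
suff : Num.min v' t <= reach_time z.
  by move=> /le_trans /(_ h); rewrite leNgt lt_min vv' vt.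
apply: lb_le_inf; first by exists t; split; [|left].
move=> u [su [->|[ut zu]]]; first by rewrite ge_min lexx orbT.
rewrite leNgt lt_min; apply/negP => /andP[uv' ut'].
have [uv|vu] := leP u v.
  by have := le_trans zu (@nda z.1 _ _ su uv (ltW vt)); rewrite leNgt az.
have := hv u; rewrite vu uv' => /(_ isT); rewrite ler_norml => /andP[h1 _]; lra.
Qed.

Lemma reach_time_le_levels z v : levels z -> s <= v -> v <= t ->
  (reach_time z <= v) = (z.2 <= a v z.1).
Proof.
move=> [z0 zt] sv; rewrite le_eqVlt => /orP[/eqP ->|]; last exact: reach_time_leP.
by rewrite reach_time_le zt.
Qed.

Lemma reach_time_gt z : levels z -> s < reach_time z.
Proof. by move=> [z0 zt]; rewrite ltNge reach_time_leP// a_s -ltNge. Qed.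

Let m2 : measurable_fun setT (snd : Omega * R -> R). Proof. exact: measurable_snd. Qed.
Let ma1 u : s <= u -> u <= t -> measurable_fun setT (fun z : Omega * R => a u z.1).
Proof. by move=> su ut; apply: measurableT_comp; [exact: ma|exact: measurable_fst]. Qed.

Lemma measurable_reach_time : measurable_fun setT reach_time.
Proof.
move=> _; apply: (measurability _ (RGenOInfty.measurableE R)) => //.
move=> _ [_ [v ->] <-]; rewrite setTI (_ : _ @^-1` _ = [set z | v < reach_time z]); last first.
  by apply/seteqP; split => z /=; rewrite in_itv /= andbT.
have [vs|sv] := ltP v s.
  rewrite (_ : mkset _ = setT); first exact: measurableT.
  by apply/seteqP; split => z //= _; exact: lt_le_trans vs (reach_time_ge z).
have [vt|tv] := ltP v t; last first.
  rewrite (_ : mkset _ = set0); first exact: measurable0.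
  by apply/seteqP; split => z //=; rewrite ltNge (le_trans (reach_time_le z)).
rewrite (_ : mkset _ = [set z : Omega * R | a v z.1 < z.2]).
  have h1 := ma1 sv (ltW vt).
  rewrite -[X in measurable X]setTI.
  rewrite (_ : mkset _ = (fun z : Omega * R => a v z.1 < z.2) @^-1` [set true]); last first.
    by apply/seteqP; split => z /=.
  by apply: measurable_fun_ltr.
by apply/seteqP; split => z /=; rewrite !ltNge reach_time_leP.
Qed.

Lemma measurable_time_change : measurable_fun setT time_change.
Proof.
by apply: measurable_fun_pair; [exact: measurable_reach_time|exact: measurable_fst].
Qed.

Lemma measurable_levels : measurable levels.
Proof.
rewrite -[X in measurable X]setTI.
rewrite (_ : levels = (fun z : Omega * R => (0 < z.2) && (z.2 <= a t z.1)) @^-1` [set true]); last first.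
  by apply/seteqP; split => z /=; [move=> [-> ->]|move=> /andP].
apply: measurable_and => //.
  by apply: measurable_fun_ltr => //; exact: measurable_cst.
by apply: measurable_fun_ler => //; exact: ma1.
Qed.

Local Notation leb := (@lebesgue_measure R).
Local Notation Pi := (P \x leb)%E.

Let pt n (i : nat) := grid_point s t n i%:Z.
Let pt_ge n i : s <= pt n i := grid_point_ge st n i.
Let pt_le n i : (i <= 2 ^ n)%N -> pt n i <= t := @grid_point_le_max _ _ _ st n i.

Let pt_lt n i j : (i <= j)%N -> pt n i <= pt n j.
Proof. by move=> ij; apply: le_grid_point. Qed.

Let slab n (f : nat -> Omega -> R) i (z : Omega * R) : R :=
  if (a (pt n i) z.1 < z.2) && (z.2 <= a (pt n i.+1) z.1) then f i z.1 else 0.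

Section step.
Variables (n : nat) (f : nat -> Omega -> R).
Hypothesis mf : forall i, (i < 2 ^ n)%N -> measurable_fun setT (f i).
Hypothesis f01 : forall i w, (i < 2 ^ n)%N -> 0 <= f i w <= 1.

Let measurable_slab i : (i < 2 ^ n)%N -> measurable_fun setT (slab n f i).
Proof.
move=> i2; apply: measurable_fun_ifT.
- apply: measurable_and.
    by apply: measurable_fun_ltr => //; apply: ma1 => //; exact: pt_le (ltnW _).
  by apply: measurable_fun_ler => //; apply: ma1 => //; exact: pt_le.
- by apply: measurableT_comp; [exact: mf|exact: measurable_fst].
- exact: measurable_cst.
Qed.

Let slab_ge0 i z : (i < 2 ^ n)%N -> 0 <= slab n f i z.
Proof. by move=> i2; rewrite /slab; case: ifP => // _; have /andP[] := f01 z.1 i2. Qed.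

Let integral_slab i : (i < 2 ^ n)%N ->
  (\int[Pi]_z (slab n f i z)%:E)%E =
  (E setT (fun w => f i w * (a (pt n i.+1) w - a (pt n i) w)))%:E.
Proof.
move=> i2; have p1 := pt_le (ltnW i2); have p2 := pt_le i2.
have i1 := increasing_process_intg (pt_ge n i) p1.
have i3 := increasing_process_intg (pt_ge n i.+1) p2.
have le_a w : a (pt n i) w <= a (pt n i.+1) w by apply: nda => //; exact: pt_lt.
have ifa : intg (fun w => f i w * (a (pt n i.+1) w - a (pt n i) w)).
  apply: (intg_le _ (intgB i3 i1)).
    apply: measurable_funM; first exact: mf.
    by apply: measurable_funB; exact: ma.
  apply: aeW => w; have /andP[f0 f1] := f01 w i2.
  by rewrite normrM ler_piMl// ger0_norm.
rewrite fubini_tonelli1//; last 2 first.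
- by apply/measurable_EFinP; exact: measurable_slab.
- by move=> z; rewrite lee_fin slab_ge0.
rewrite EFin_E//; apply: eq_integral => w _; rewrite /fubini_F.
have /andP[f0 f1] := f01 w i2.
rewrite (eq_integral (fun x : measurableTypeR R => (f i w)%:E * (\1_(`]a (pt n i) w, a (pt n i.+1) w]%classic) x)%:E)%E); last first.
  move=> x _; rewrite /slab /= indicE -EFinM; congr EFin.
  case: ifPn => h; first by rewrite mem_set ?mulr1//= in_itv.
  by rewrite memNset ?mulr0//= in_itv; apply/negP.
rewrite ge0_integralZl//; last first.
  by apply/measurable_EFinP; apply: measurable_indic; exact: measurable_itv.
rewrite integral_indic//= setIT lebesgue_measure_itv/= lte_fin EFinM; congr (_ * _)%E.
case: ltP => h; first by rewrite EFinB.
by rewrite (_ : a (pt n i.+1) w = a (pt n i) w) ?subrr//; apply/eqP; rewrite eq_le h le_a.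
Qed.

(** The levels reached in a grid cell are those between the values of [a] at its
    ends; Fubini's theorem integrates these slabs. *)
Lemma integral_levels_step (g : Omega * R -> R) :
  (forall z, levels z -> forall i, (i < 2 ^ n)%N ->
     grid_index s t n (reach_time z) = i%:Z + 1 -> g z = f i z.1) ->
  (\int[Pi]_(z in levels) (g z)%:E)%E =
  (\sum_(i < 2 ^ n) E setT (fun w => f i w * (a (pt n i.+1) w - a (pt n i) w)))%:E.
Proof.
move=> gf; rewrite integral_mkcond.
have slab_cell z i : levels z -> (i < 2 ^ n)%N ->
    (a (pt n i) z.1 < z.2) && (z.2 <= a (pt n i.+1) z.1) =
    (grid_index s t n (reach_time z) == i%:Z + 1).
  move=> lz i2; rewrite ltNge.
  rewrite -(reach_time_le_levels lz (pt_ge n i) (pt_le (ltnW i2))).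
  rewrite -(reach_time_le_levels lz (pt_ge n i.+1) (pt_le i2)).
  rewrite -ltNge; apply/andP/eqP => [[h1 h2]|h].
    by apply: grid_cell => //; rewrite -PoszD addn1.
  split.
    by have := grid_left_lt st n (reach_time z); rewrite /grid_left h addrK.
  by have := grid_right_ge st n (reach_time z); rewrite /grid_right h -PoszD addn1.
rewrite (eq_integral (fun z : Omega * measurableTypeR R => \sum_(i < 2 ^ n) (slab n f i z)%:E)%E); last first.
  move=> z _; rewrite patchE sumEFin; case: ifPn => [/set_mem lz|/negP nlz].
    have [i i2 hi] := grid_index_cell st n (reach_time_gt lz) (reach_time_le z).
    rewrite (bigD1 (Ordinal i2))//= big1 ?addr0.
      by rewrite /slab slab_cell// hi eqxx (gf z lz i i2 hi).
    move=> j ji; rewrite /slab slab_cell// hi; case: eqP => // e; exfalso.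
    by move/eqP: ji; apply; apply/val_inj => /=; lia.
  rewrite big1// => i _; rewrite /slab; case: ifP => // /andP[h1 h2]; exfalso; apply: nlz.
  apply/mem_set; split.
    by apply: le_lt_trans h1; apply: increasing_process_ge0 => //; exact: pt_le (ltnW _).
  by apply: le_trans h2 _; apply: nda => //; exact: pt_le.
rewrite ge0_integral_sum//; last 2 first.
- by move=> i; apply/measurable_EFinP; exact: measurable_slab.
- by move=> i z _; rewrite lee_fin slab_ge0.
by rewrite -sumEFin; apply: eq_bigr => i _; exact: integral_slab.
Qed.

End step.

Lemma finite_levels : (Pi levels < +oo)%E.
Proof.
rewrite -[X in (X < _)%E]mul1e -integral_cst; last exact: measurable_levels.
rewrite (integral_levels_step (n := 0) (f := fun _ _ => 1)) ?ltry// => i w _.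
by rewrite ler01 lexx.
Qed.

End time_change.

End increasing_processes.

(** * Comparison on predictable sets *)
Section comparison.
Context {R : realType} {d : measure_display} {Omega : measurableType d}.
Variable P : probability Omega R.
Implicit Types (Y Z : Omega -> R) (B : set Omega) (C : set (R * Omega)).

Local Notation intg X := (P.-integrable [set: Omega] (EFin \o X)).
Local Notation E := (Rintegral P).
Local Notation Pi := (P \x @lebesgue_measure R)%E.

Variables (s t : R) (F : R -> set (set Omega)).
Hypothesis st : s < t.
Hypothesis filF : interval_filtration P s t F.

Let st' := ltW st.

Let mF := filtration_measurable filF.
Let salF := filtration_salgebra filF.
Let monoF := filtration_le filF.

Definition clamp_time (u : R) : R := Num.max s (Num.min t u).

Lemma clamp_time_ge u : s <= clamp_time u. Proof. by rewrite le_max lexx. Qed.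

Lemma clamp_time_le u : clamp_time u <= t.
Proof. by rewrite ge_max st' ge_min lexx. Qed.

Lemma clamp_time_id u : s <= u -> u <= t -> clamp_time u = u.
Proof. by move=> su ut; rewrite /clamp_time min_r// max_r. Qed.

Lemma le_clamp_time u v : u <= v -> clamp_time u <= clamp_time v.
Proof.
move=> uv; rewrite /clamp_time ge_max !le_max lexx /= le_min !ge_min lexx uv /=.
by rewrite !orbT.
Qed.

(** Predictability in discrete time.  The grid runs over the whole line, where
    time is clamped to [[s, t]]; thus these sets form an algebra of subsets of
    [R * Omega] without any condition outside of [(s, t]]. *)
Definition grid_adapted n C : Prop := forall y,
  (forall y' w, grid_index s t n y' = grid_index s t n y -> C (y, w) -> C (y', w)) /\
  F (clamp_time (grid_left s t n y)) [set w | C (y, w)].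

Definition predictable_algebra : set (set (R * Omega)) := [set C | exists n, grid_adapted n C].

Lemma grid_adapted_le n m C : (n <= m)%N -> grid_adapted n C -> grid_adapted m C.
Proof.
move=> /subnK <-; elim: (m - n)%N => // k IH /IH {}IH y; rewrite addSn; split.
  by move=> y' w e; apply: ((IH y).1 y' w); exact: grid_index_coarsen e.
have [_ h] := IH y; apply: monoF h; [exact: clamp_time_ge| |exact: clamp_time_le].
by apply: le_clamp_time; exact: grid_left_refine.
Qed.

Lemma predictable_algebraT : predictable_algebra setT.
Proof.
exists 0%N => y; split => //; rewrite (_ : mkset _ = setT); last by apply/seteqP; split.
by apply: salgebraT; apply: salF; [exact: clamp_time_ge|exact: clamp_time_le].
Qed.

Lemma setring_predictable_algebra : setring predictable_algebra.
Proof.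
have sal n y := salF (clamp_time_ge (grid_left s t n y)) (clamp_time_le (grid_left s t n y)).
split.
- exists 0%N => y; split => //; rewrite (_ : mkset _ = set0); last by apply/seteqP; split.
  exact: salgebra0.
- move=> A B [n hA] [m hB]; exists (maxn n m).
  have {}hA := grid_adapted_le (leq_maxl n m) hA.
  have {}hB := grid_adapted_le (leq_maxr n m) hB.
  move=> y; split=> [y' w e [h|h]|]; [left; exact: (hA y).1 h|right; exact: (hB y).1 h|].
  exact: (salgebraU (sal _ _) (hA y).2 (hB y).2).
- move=> A B [n hA] [m hB]; exists (maxn n m).
  have {}hA := grid_adapted_le (leq_maxl n m) hA.
  have {}hB := grid_adapted_le (leq_maxr n m) hB.
  move=> y; split=> [y' w e [h1 h2]|].
    split; first exact: (hA y).1 h1.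
    by move=> h3; apply: h2; apply: (hB y').1 h3.
  exact: (salgebraD (sal _ _) (hA y).2 (hB y).2).
Qed.

Lemma grid_index_point n i : grid_index s t n (grid_point s t n i) = i.
Proof.
rewrite -[in RHS](subrK 1 i); apply: grid_cell => //; last by rewrite subrK.
rewrite grid_point_lt// ltNge -grid_point_le// -ltNge /grid_point.
by rewrite ltrD2l ltr_pM2l ?subr_gt0// ltr_pM2r ?invr_gt0 ?exprn_gt0// ltr_int; lia.
Qed.

Lemma grid_left_point n i : grid_left s t n (grid_point s t n i) = grid_point s t n (i - 1).
Proof. by rewrite /grid_left grid_index_point. Qed.

Lemma measurable_predictable_algebra C : predictable_algebra C -> measurable C.
Proof.
move=> [n hC].
pose slice (i : int) : set (R * Omega) :=
  `]grid_point s t n (i - 1), grid_point s t n i] `*` [set w | C (grid_point s t n i, w)].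
have mslice i : measurable (slice i).
  apply: measurableX; first exact: measurable_itv.
  by apply: mF (hC _).2; [exact: clamp_time_ge|exact: clamp_time_le].
have sliceP i : slice i `<=` C.
  move=> [y w] [/=]; rewrite in_itv /= => /andP[h1 h2].
  apply: (hC _).1; rewrite grid_index_point.
  by rewrite (grid_cell st h1) ?subrK.
rewrite (_ : C = \bigcup_(k : nat) (slice k%:Z `|` slice (- k%:Z))).
  by apply: bigcupT_measurable => k; exact: measurableU.
apply/seteqP; split => [[y w] Cyw|z [k _ []]]; [|exact: sliceP|exact: sliceP].
have slicey : slice (grid_index s t n y) (y, w).
  split => /=.
    by rewrite in_itv /=; apply/andP; split; [exact: grid_left_lt|exact: grid_right_ge].
  by apply: (hC y).1 Cyw; rewrite grid_index_point.
exists `|grid_index s t n y|%N; first by [].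
by case: (grid_index s t n y) slicey => k h; [left|right; rewrite -NegzE].
Qed.

Section mass.
Variable a : R -> Omega -> R.
Hypothesis incr_a : increasing_process P s t a.

(** The measure [P(dw) da_y(w)]. *)
Definition mass C : \bar R := Pi (levels t a `&` time_change s t a @^-1` C).

Let mThetaC C : measurable C -> measurable (time_change s t a @^-1` C).
Proof. by move=> mC; rewrite -[X in measurable X]setTI; exact: (measurable_time_change st incr_a). Qed.

Lemma mass_grid_adapted n C : grid_adapted n C ->
  mass C = (\sum_(i < 2 ^ n) E [set w | C (grid_point s t n i.+1%:Z, w)]
    (fun w => a (grid_point s t n i.+1%:Z) w - a (grid_point s t n i%:Z) w))%:E.
Proof.
move=> hC; have mC : measurable C by apply: measurable_predictable_algebra; exists n.
have mB y : measurable [set w | C (y, w)].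
  by apply: mF (hC _).2; [exact: clamp_time_ge|exact: clamp_time_le].
rewrite /mass setIC -integral_indic; [|exact: measurable_levels incr_a|exact: mThetaC].
rewrite (integral_levels_step st incr_a (n := n)
    (f := fun i => \1_[set w | C (grid_point s t n i.+1%:Z, w)])).
- congr EFin; apply: eq_bigr => i _; rewrite [RHS]E_mkcond; apply: eq_Rintegral => w _.
  by rewrite /= indicE; case: ifP => _; rewrite ?mul1r ?mul0r.
- by move=> i _; exact: measurable_indic.
- by move=> i w _; rewrite indicE; case: (_ \in _); rewrite ?lexx ?ler01.
move=> z lz i i2 e; rewrite !indicE.
have -> // : (z \in time_change s t a @^-1` C) = (z.1 \in [set w | C (grid_point s t n i.+1%:Z, w)]).
apply/idP/idP => /set_mem h; apply/mem_set.
  by apply: (hC _).1 h; rewrite grid_index_point e -PoszD addn1.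
by apply: (hC _).1 h; rewrite grid_index_point e -PoszD addn1.
Qed.

End mass.

Section compare.
Variables a b : R -> Omega -> R.
Hypothesis incr_a : increasing_process P s t a.
Hypothesis incr_b : increasing_process P s t b.
Hypothesis ab : forall u v, s <= u -> u <= v -> v <= t -> forall B, F u B ->
  E B (fun w => a v w - a u w) <= E B (fun w => b v w - b u w).

(** On a grid-adapted set the comparison is the hypothesis, cell by cell, and the
    sets for which it holds form a monotone class. *)
Lemma mass_le_predictable C : <<s predictable_algebra >> C ->
  measurable C /\ (mass a C <= mass b C)%E.
Proof.
pose G := [set C | measurable C /\ (mass a C <= mass b C)%E].
have mTh (c : R -> Omega -> R) (ic : increasing_process P s t c) (A : set (R * Omega)) :
    measurable A -> measurable (levels t c `&` time_change s t c @^-1` A).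
  move=> mA; apply: measurableI; first exact: measurable_levels ic.
  by rewrite -[X in measurable X]setTI; exact: (measurable_time_change st ic).
have monoG : monotone G.
  split => A ndA hA.
    have mU : measurable (\bigcup_i A i) by apply: bigcupT_measurable => i; exact: (hA i).1.
    have cv c : increasing_process P s t c -> (mass c \o A) k @[k --> \oo] --> mass c (\bigcup_i A i).
      move=> ic; rewrite /mass [X in _ --> Pi X](_ : _ =
          \bigcup_i (levels t c `&` time_change s t c @^-1` A i)); last first.
        by apply/seteqP; split => [z [h1 [i _ h2]]|z [i _ [h1 h2]]]; [exists i|split => //; exists i].
      apply: (@nondecreasing_cvg_mu _ _ _ Pi (fun i => levels t c `&` time_change s t c @^-1` A i)).
      - by move=> i; apply: mTh => //; exact: (hA i).1.
      - by apply: bigcupT_measurable => i; apply: mTh => //; exact: (hA i).1.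
      - move=> i j ij; apply/subsetPset => z [h1 h2]; split => //.
        by have /subsetPset := ndA i j ij; apply.
    split; first exact: mU.
    apply: (lee_cvg_to (cv a incr_a) (cv b incr_b)).
    by apply: nearW => k; exact: (hA k).2.
  have mU : measurable (\bigcap_i A i) by apply: bigcapT_measurable => i; exact: (hA i).1.
  have cv c : increasing_process P s t c -> (mass c \o A) k @[k --> \oo] --> mass c (\bigcap_i A i).
    move=> ic; rewrite /mass [X in _ --> Pi X](_ : _ =
        \bigcap_i (levels t c `&` time_change s t c @^-1` A i)); last first.
      apply/seteqP; split => [z [h1 h2] i _|z h]; first by split => //; exact: h2.
      by split => [|i _]; [have [] := h 0%N I|have [] := h i I].
    apply: (@nonincreasing_cvg_mu _ _ _ Pi (fun i => levels t c `&` time_change s t c @^-1` A i)).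
    - apply: le_lt_trans (finite_levels st ic); apply: le_measure; rewrite ?inE.
      + by apply: mTh => //; exact: (hA 0%N).1.
      + exact: measurable_levels ic.
      + exact: subIsetl.
    - by move=> i; apply: mTh => //; exact: (hA i).1.
    - by apply: bigcapT_measurable => i; apply: mTh => //; exact: (hA i).1.
    - move=> i j ij; apply/subsetPset => z [h1 h2]; split => //.
      by have /subsetPset := ndA i j ij; apply.
  split; first exact: mU.
  apply: (lee_cvg_to (cv a incr_a) (cv b incr_b)).
  by apply: nearW => k; exact: (hA k).2.
have ringG : predictable_algebra `<=` G.
  move=> A [n hA]; split; first by apply: measurable_predictable_algebra; exists n.
  rewrite !(mass_grid_adapted _ hA)// lee_fin; apply: ler_sum => i _.
  have p1 := grid_point_ge st n i.
  have p2 := grid_point_le_max st (ltn_ord i).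
  have p3 : grid_point s t n i%:Z <= grid_point s t n i.+1%:Z by apply: (le_grid_point st); rewrite lez_nat.
  apply: ab => //.
  have [_] := hA (grid_point s t n i.+1%:Z).
  rewrite grid_left_point clamp_time_id// -?addn1 ?PoszD ?addrK//.
  exact: le_trans p3 p2.
have sr := monotone_setring_sub_g_sigma_ring monoG setring_predictable_algebra ringG.
have [sr0 srD srU] := smallest_sigma_ring predictable_algebra.
suff sub : <<s predictable_algebra >> `<=` <<sr predictable_algebra >> by move=> /sub /sr.
apply: smallest_sub; last exact: sub_g_sigma_ring.
split => // A hA; apply: srD => //; apply: sub_g_sigma_ring.
exact: predictable_algebraT.
Qed.

End compare.

End comparison.

Section count_below.
Context {R : realType}.
Implicit Types x h : R.

Lemma count_below x N : 0 <= x -> x <= N%:R ->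
  \sum_(k < N) (k.+1%:R <= x)%R%:R <= x < \sum_(k < N) (k.+1%:R <= x)%R%:R + 1.
Proof.
move=> x0 xN; set c := fun M => \sum_(k < M) (k.+1%:R <= x)%R%:R : R.
have h M : [/\ c M <= x, c M <= M%:R & c M = M%:R \/ x < c M + 1].
  elim: M => [|M [IH1 IH2 IH3]]; first by rewrite /c big_ord0; split => //; left.
  have cS : c M.+1 = c M + (M.+1%:R <= x)%R%:R by rewrite /c big_ord_recr.
  rewrite cS; have [h1|h1] := leP M.+1%:R x.
    have e : c M = M%:R.
      case: IH3 => // h2; exfalso; have : x < M%:R + 1 by lra.
      by rewrite natr1 ltNge h1.
    by rewrite e natr1 lexx; split => //; left.
  rewrite addr0; split => //; first by rewrite (le_trans IH2)// ler_nat.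
  right; case: IH3 => // e; rewrite e natr1; exact: h1.
have [h1 _ h3] := h N; rewrite -/(c N) h1 /=; case: h3 => // e.
by rewrite e (le_lt_trans xN)// ltrDl.
Qed.

(** The layer cake of a number of [[0, 1]], with [N.+1] layers. *)
Lemma layers_le h N : 0 <= h -> h <= 1 ->
  \sum_(k < N.+1) N.+1%:R^-1 * (k.+1%:R / N.+1%:R <= h)%R%:R <= h <=
  \sum_(k < N.+1) N.+1%:R^-1 * (k.+1%:R / N.+1%:R <= h)%R%:R + N.+1%:R^-1.
Proof.
move=> h0 h1; have p : 0 < N.+1%:R :> R by [].
have /andP[c1 c2] : \sum_(k < N.+1) (k.+1%:R <= h * N.+1%:R)%R%:R <= h * N.+1%:R <
    \sum_(k < N.+1) (k.+1%:R <= h * N.+1%:R)%R%:R + 1.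
  by apply: count_below; [rewrite mulr_ge0|rewrite ler_piMl].
rewrite -mulr_sumr (eq_bigr (fun k : 'I_N.+1 => (k.+1%:R <= h * N.+1%:R)%R%:R)); last first.
  by move=> k _; rewrite ler_pdivrMr.
set c := \sum_(_ < _) _ in c1 c2 *; rewrite -[X in _ + X]mulr1 -mulrDr ![_^-1 * _]mulrC.
by rewrite ler_pdivrMr// c1 ler_pdivlMr// ltW.
Qed.

End count_below.

Section transfer.
Context {R : realType} {d : measure_display} {Omega : measurableType d}.
Variable P : probability Omega R.
Implicit Types (Y Z : Omega -> R) (B : set Omega) (C : set (R * Omega)).

Local Notation intg X := (P.-integrable [set: Omega] (EFin \o X)).
Local Notation E := (Rintegral P).
Local Notation Pi := (P \x @lebesgue_measure R)%E.

Variables (s t : R) (F : R -> set (set Omega)).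
Hypothesis st : s < t.
Hypothesis filF : interval_filtration P s t F.
Variables a b : R -> Omega -> R.
Hypothesis incr_a : increasing_process P s t a.
Hypothesis incr_b : increasing_process P s t b.
Hypothesis ab : forall u v, s <= u -> u <= v -> v <= t -> forall B, F u B ->
  E B (fun w => a v w - a u w) <= E B (fun w => b v w - b u w).
Variable H : R * Omega -> R.
Hypothesis H01 : forall z, 0 <= H z <= 1.
Hypothesis predH : forall c, 0 < c -> c <= 1 ->
  <<s predictable_algebra s t F >> [set z | c <= H z].

Let layer N (k : nat) : set (R * Omega) := [set z | k.+1%:R / N.+1%:R <= H z].

Let layer_pred N k : (k <= N)%N -> <<s predictable_algebra s t F >> (layer N k).
Proof.
move=> kN; apply: predH; first by rewrite divr_gt0.
by rewrite ler_pdivrMr// mul1r ler_nat.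
Qed.

Let mlayer N k : (k <= N)%N -> measurable (layer N k).
Proof. by move=> kN; have [] := mass_le_predictable st filF incr_a incr_b ab (layer_pred kN). Qed.

Lemma measurable_of_layers : measurable_fun setT H.
Proof.
move=> _; apply: (measurability _ (RGenCInfty.measurableE R)) => //.
move=> _ [_ [c ->] <-]; rewrite setTI (_ : _ @^-1` _ = [set z | c <= H z]); last first.
  by apply/seteqP; split => z /=; rewrite in_itv /= andbT.
have [c0|c0] := leP c 0.
  rewrite (_ : mkset _ = setT); first exact: measurableT.
  by apply/seteqP; split => z //= _; apply: le_trans c0 _; have /andP[] := H01 z.
have [c1|c1] := leP c 1.
  by have [] := mass_le_predictable st filF incr_a incr_b ab (predH c0 c1).
rewrite (_ : mkset _ = set0); first exact: measurable0.
apply/seteqP; split => z //= h; have /andP[_ h1] := H01 z.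
by have := lt_le_trans c1 (le_trans h h1); rewrite ltxx.
Qed.

Let measurable_layers c (ic : increasing_process P s t c) C : measurable C ->
  measurable (time_change s t c @^-1` C).
Proof. by move=> mC; rewrite -[X in measurable X]setTI; exact: (measurable_time_change st ic). Qed.

Let integral_layers c (ic : increasing_process P s t c) N :
  (\int[Pi]_(z in levels t c) (\sum_(k < N.+1) N.+1%:R^-1 *
      (k.+1%:R / N.+1%:R <= H (time_change s t c z))%R%:R)%:E =
   \sum_(k < N.+1) (N.+1%:R^-1)%:E * mass P s t c (layer N k))%E.
Proof.
have mL := measurable_levels st ic.
have mTl (k : 'I_N.+1) : measurable (time_change s t c @^-1` layer N k).
  by apply: (measurable_layers ic); apply: mlayer; rewrite -ltnS.
rewrite (eq_integral (fun z : Omega * measurableTypeR R => \sum_(k < N.+1)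
    (N.+1%:R^-1)%:E * (\1_(time_change s t c @^-1` layer N k) z)%:E)%E); last first.
  move=> z _; rewrite -sumEFin; apply: eq_bigr => k _; rewrite -EFinM; congr (_ * _)%:E.
  rewrite indicE; congr (_%:R); congr nat_of_bool.
  by apply/idP/idP => [h|/set_mem//]; exact/mem_set.
rewrite ge0_integral_sum//; last first.
  move=> k; apply: measurable_funTS; apply/measurable_EFinP.
  by apply: measurable_funM => //; apply: measurable_indic; exact: mTl.
apply: eq_bigr => k _; rewrite ge0_integralZl//; last first.
  by apply: measurable_funTS; apply/measurable_EFinP; apply: measurable_indic; exact: mTl.
by rewrite integral_indic//; [rewrite setIC|exact: mTl].
Qed.

(** [H] is within [1/N] of an average of indicators of its superlevel sets,
    which are predictable. *)
Lemma integral_levels_le :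
  (\int[Pi]_(z in levels t a) (H (time_change s t a z))%:E <=
   \int[Pi]_(z in levels t b) (H (time_change s t b z))%:E)%E.
Proof.
have mL c (ic : increasing_process P s t c) := measurable_levels st ic.
have mH c (ic : increasing_process P s t c) :
    measurable_fun (levels t c) (fun z : Omega * R => (H (time_change s t c z))%:E).
  apply: measurable_funTS; apply/measurable_EFinP; apply: measurableT_comp.
    exact: measurable_of_layers.
  exact: (measurable_time_change st ic).
have mS c (ic : increasing_process P s t c) N : measurable_fun (levels t c) (fun z : Omega * R =>
    (\sum_(k < N.+1) N.+1%:R^-1 * (k.+1%:R / N.+1%:R <= H (time_change s t c z))%R%:R)%:E).
  apply: measurable_funTS; apply/measurable_EFinP; apply: measurable_sum => k.
  apply: measurable_funM; first exact: measurable_cst.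
  rewrite (_ : (fun _ => _) = \1_(time_change s t c @^-1` layer N k)).
    by apply: measurable_indic; apply: (measurable_layers ic); apply: mlayer; rewrite -ltnS.
  apply/funext => z; rewrite indicE; congr (_%:R); congr nat_of_bool.
  by apply/idP/idP => [h|/set_mem//]; exact/mem_set.
have S0 h N : 0 <= \sum_(k < N.+1) N.+1%:R^-1 * (k.+1%:R / N.+1%:R <= h)%R%:R :> R.
  by apply: sumr_ge0 => k _; rewrite mulr_ge0// invr_ge0.
have main N : (\int[Pi]_(z in levels t a) (H (time_change s t a z))%:E <=
    \int[Pi]_(z in levels t b) (H (time_change s t b z))%:E + (N.+1%:R^-1)%:E * Pi (levels t a))%E.
  apply: (@le_trans _ _ (\int[Pi]_(z in levels t a) ((\sum_(k < N.+1) N.+1%:R^-1 *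
      (k.+1%:R / N.+1%:R <= H (time_change s t a z))%R%:R)%:E + (N.+1%:R^-1)%:E))%E).
    apply: ge0_le_integral => //; first exact: mL.
    - by move=> z _; rewrite lee_fin; have /andP[] := H01 (time_change s t a z).
    - exact: mH.
    - by apply: emeasurable_funD; [exact: mS|exact: measurable_cst].
    - move=> z _; rewrite -EFinD lee_fin.
      by have /andP[h0 h1] := H01 (time_change s t a z); have /andP[] := layers_le N h0 h1.
  rewrite ge0_integralD//; last 3 first.
  - exact: mL.
  - by move=> z _; rewrite lee_fin.
  - exact: mS.
  rewrite integral_cst; last exact: mL.
  apply: leeD2r; rewrite (integral_layers incr_a).
  apply: (@le_trans _ _ (\sum_(k < N.+1) (N.+1%:R^-1)%:E * mass P s t b (layer N k))%E).
    apply: lee_sum => k _; apply: lee_wpmul2l; first by rewrite lee_fin invr_ge0.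
    by have [] := mass_le_predictable st filF incr_a incr_b ab (@layer_pred N k (ltn_ord k)).
  rewrite -(integral_layers incr_b); apply: ge0_le_integral => //; first exact: mL.
  - by move=> z _; rewrite lee_fin.
  - exact: mS.
  - exact: mH.
  - move=> z _; rewrite lee_fin.
    by have /andP[h0 h1] := H01 (time_change s t b z); have /andP[] := layers_le N h0 h1.
have finL : (Pi (levels t a) < +oo)%E := finite_levels st incr_a.
have L0 : (0 <= Pi (levels t a))%E by [].
apply/lee_addgt0Pr => e e0.
pose l := fine (Pi (levels t a)).
have lE : Pi (levels t a) = l%:E by rewrite fineK// ge0_fin_numE.
have l0 : 0 <= l by rewrite fine_ge0.
apply: le_trans (main (Num.trunc (l / e))) _; rewrite leeD2l// lE -EFinM lee_fin.
rewrite mulrC ler_pdivrMr// mulrC -ler_pdivrMr//; apply: ltW.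
exact: truncnS_gt.
Qed.

End transfer.

Section clip_potential.
Context {R : realType}.
Implicit Types x y : R.

(** A bounded weight that charges the times at which [x] is negative. *)
Definition clip_neg x : R := Num.min 1 (Num.max 0 (- x)).

(** The antiderivative of [- clip_neg] that vanishes at [0]; it is convex. *)
Definition clip_potential x : R :=
  if 0 <= x then 0 else if -1 <= x then x ^+ 2 / 2 else - x - 1 / 2.

Lemma clip_neg01 x : 0 <= clip_neg x <= 1.
Proof. by rewrite /clip_neg le_min ge_min lexx ler01 le_max lexx. Qed.

Lemma clip_neg_ge c x : 0 < c -> c <= 1 -> (c <= clip_neg x) = (x <= - c).
Proof.
by move=> c0 c1; rewrite /clip_neg le_min c1 le_max leNgt c0 /= lerNr.
Qed.

Lemma clip_potential_ge0 x : 0 <= clip_potential x.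
Proof. by rewrite /clip_potential; case: (leP 0 x) => // h; case: (leP (-1) x) => h1; nra. Qed.

Lemma clip_potential_eq0 x : clip_potential x = 0 -> 0 <= x.
Proof. by rewrite /clip_potential; case: (leP 0 x) => // h; case: (leP (-1) x) => h1 h2; nra. Qed.

Lemma clip_potential_le x : clip_potential x <= `|x|.
Proof.
rewrite /clip_potential; case: (leP 0 x) => // h; rewrite (ltr0_norm h).
by case: (leP (-1) x) => h1; nra.
Qed.

Lemma clip_potential_convex x y :
  clip_neg y * (y - x) <= clip_potential x - clip_potential y.
Proof.
have [y0|y0] := leP 0 y.
  rewrite /clip_neg (max_l (_ : - y <= 0)) ?oppr_le0// min_r ?ler01// mul0r.
  rewrite {2}/clip_potential y0 subr0; exact: clip_potential_ge0.
have ny : 0 <= - y by lra.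
rewrite /clip_neg (max_r ny).
have [y1|y1] := leP (-1) y.
  rewrite (min_r (_ : - y <= 1)); last by lra.
  rewrite /clip_potential (leNgt 0 y) y0 /= y1.
  case: (leP 0 x) => x0; first by have := mulr_ge0 ny x0; nra.
  case: (leP (-1) x) => x1; first by have := sqr_ge0 (x - y); lra.
  have : 0 <= (1 + y) * (- x - (1 - y) / 2) by apply: mulr_ge0; lra.
  by nra.
rewrite (min_l (_ : 1 <= - y)); last by lra.
rewrite /clip_potential (leNgt 0 y) y0 /= (leNgt (-1) y) y1 /=.
by case: (leP 0 x) => x0; [|case: (leP (-1) x) => x1]; nra.
Qed.

Lemma continuous_clip_neg : continuous clip_neg.
Proof.
move=> x; rewrite (_ : clip_neg = fun y => Num.min 1 (- Num.min 0 y)); last first.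
  by apply/funext => y; rewrite /clip_neg oppr_min oppr0.
apply: cvg_minr; first exact: cvg_cst.
by apply: cvgN; apply: cvg_minr; [exact: cvg_cst|exact: cvg_id].
Qed.

Lemma measurable_clip_potential : measurable_fun setT clip_potential.
Proof.
rewrite /clip_potential; apply: (@measurable_fun_ifT _ _ (measurableTypeR R) (measurableTypeR R) (cst 0) _ (fun x : R => 0 <= x)).
- by apply: measurable_fun_ler; [exact: measurable_cst|exact: measurable_id].
- exact: measurable_cst.
apply: (@measurable_fun_ifT _ _ _ _ (fun x => x ^+ 2 / 2) _ (fun x : R => -1 <= x)).
- by apply: measurable_fun_ler; [exact: measurable_cst|exact: measurable_id].
- by apply: measurable_funM; [apply: measurable_funX; exact: measurable_id|exact: measurable_cst].
by apply: measurable_funB; [exact: measurable_funN|exact: measurable_cst].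
Qed.

End clip_potential.

Section domination.
Context {R : realType} {d : measure_display} {Omega : measurableType d}.
Variable P : probability Omega R.
Implicit Types (Y Z : Omega -> R) (B : set Omega) (C : set (R * Omega)).

Local Notation intg X := (P.-integrable [set: Omega] (EFin \o X)).
Local Notation E := (Rintegral P).
Local Notation Pi := (P \x @lebesgue_measure R)%E.

Variables (s t : R) (F : R -> set (set Omega)).
Hypothesis st : s < t.
Let st' := ltW st.
Hypothesis filF : interval_filtration P s t F.
Variables (a m j : R -> Omega -> R).
Hypothesis incr_a : increasing_process P s t a.
Hypothesis incr_m : increasing_process P s t m.
Hypothesis incr_j : increasing_process P s t j.
Hypothesis amj : forall u v, s <= u -> u <= v -> v <= t -> forall B, F u B ->
  E B (fun w => a v w - a u w) <= E B (fun w => m v w - m u w + (j v w - j u w)).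
Variable tau : Omega -> R.
Hypothesis stop_a : forall w y, s <= y -> y <= t -> tau w <= y -> a y w = a t w.
Hypothesis stop_m : forall w y, s <= y -> y <= t -> tau w <= y -> m y w = m t w.
Hypothesis stop_j : forall w y, s <= y -> y <= t -> tau w <= y -> j y w = j t w.

Let k u w := m u w - a u w.
Let b u w := m u w + j u w.

Hypothesis pred_k : forall c,
  <<s predictable_algebra s t F >>
    [set z | [/\ s < z.1, z.1 <= t, z.1 <= tau z.2 & k z.1 z.2 <= c]].

Let H (z : R * Omega) : R :=
  if `[< [/\ s < z.1, z.1 <= t & z.1 <= tau z.2] >] then clip_neg (k z.1 z.2) else 0.

Let H01 z : 0 <= H z <= 1.
Proof. by rewrite /H; case: ifP => _; [exact: clip_neg01|rewrite lexx ler01]. Qed.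

Let predH c : 0 < c -> c <= 1 -> <<s predictable_algebra s t F >> [set z | c <= H z].
Proof.
move=> c0 c1; rewrite (_ : mkset _ = 
  [set z | [/\ s < z.1, z.1 <= t, z.1 <= tau z.2 & k z.1 z.2 <= - c]]) //.
apply/seteqP; split => z; rewrite /H /=; case: asboolP => [[h1 h2 h3]|h].
- by rewrite clip_neg_ge.
- by rewrite leNgt c0.
- by rewrite clip_neg_ge// => -[].
- by move=> [h1 h2 h3 _]; exfalso; apply: h.
Qed.

Let incr_b : increasing_process P s t b.
Proof.
have [m0 ndm rm mm im] := incr_m; have [j0 ndj rj mj ij] := incr_j; split.
- by move=> w; rewrite /b m0 j0 addr0.
- by move=> w u v su uv vt; rewrite lerD// ?ndm ?ndj.
- by move=> w u su ut; apply: cvgD; [exact: rm|exact: rj].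
- by move=> u su ut; apply: measurable_funD; [exact: mm|exact: mj].
- exact: intgD.
Qed.

Let stop_b w y : s <= y -> y <= t -> tau w <= y -> b y w = b t w.
Proof. by move=> sy yt ty; rewrite /b stop_m// stop_j. Qed.

Let ab u v : s <= u -> u <= v -> v <= t -> forall B, F u B ->
  E B (fun w => a v w - a u w) <= E B (fun w => b v w - b u w).
Proof.
move=> su uv vt B FB; apply: le_trans (amj su uv vt FB) _.
by rewrite le_eqVlt; apply/orP; left; apply/eqP; apply: eq_Rintegral => w _; rewrite /b; lra.
Qed.

Let pt n (i : nat) := grid_point s t n i%:Z.
Let pt_ge n i : s <= pt n i := grid_point_ge st n i.
Let pt_le n i : (i <= 2 ^ n)%N -> pt n i <= t := @grid_point_le_max _ _ _ st n i.

Let pt_lt n i l : (i <= l)%N -> pt n i <= pt n l.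
Proof. by move=> il; apply: le_grid_point. Qed.

Let f n i w := clip_neg (k (pt n i.+1) w).

Let mk u : s <= u -> u <= t -> measurable_fun setT (k u).
Proof.
move=> su ut; have [_ _ _ mm _] := incr_m; have [_ _ _ ma _] := incr_a.
by apply: measurable_funB; [exact: mm|exact: ma].
Qed.

Let mclip : measurable_fun setT (@clip_neg R).
Proof. by apply: continuous_measurable_fun; exact: continuous_clip_neg. Qed.

Let rk u w : s <= u -> u < t -> k x w @[x --> u^'+] --> k u w.
Proof.
move=> su ut; have [_ _ rm _ _] := incr_m; have [_ _ ra _ _] := incr_a.
by apply: cvgB; [exact: rm|exact: ra].
Qed.

Let S n c := \sum_(i < 2 ^ n) E setT (fun w => f n i w * (c (pt n i.+1) w - c (pt n i) w)).

Let mtc c (ic : increasing_process P s t c) : measurable_fun setT (reach_time s t c).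
Proof. exact: (measurable_reach_time st ic). Qed.

(* the value of k at the right end of the grid cell of the reaching time *)
Let g c n (z : Omega * R) : R := \sum_(i < 2 ^ n)
  (if (pt n i < reach_time s t c z) && (reach_time s t c z <= pt n i.+1) then f n i z.1 else 0).

Let gE c n z i : (i < 2 ^ n)%N -> grid_index s t n (reach_time s t c z) = i%:Z + 1 ->
  g c n z = f n i z.1.
Proof.
move=> i2 e; rewrite /g (bigD1 (Ordinal i2))//= big1 ?addr0.
  have := grid_left_lt st n (reach_time s t c z); rewrite /grid_left e addrK => ->.
  by have := grid_right_ge st n (reach_time s t c z); rewrite /grid_right e -PoszD addn1 => ->.
move=> l li; case: ifP => // /andP[h1 h2]; exfalso.
have e' : grid_index s t n (reach_time s t c z) = l%:Z + 1.
  by apply: grid_cell => //; rewrite -PoszD addn1.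
by move/eqP: li; apply; apply/val_inj => /=; lia.
Qed.

Let g_right c n z : levels t c z -> increasing_process P s t c ->
  g c n z = clip_neg (k (grid_right s t n (reach_time s t c z)) z.1).
Proof.
move=> lz ic; have gt := reach_time_gt st ic lz.
have [i i2 hi] := grid_index_cell st n gt (reach_time_le c st z).
by rewrite (gE i2 hi) /f /grid_right hi /pt -PoszD addn1.
Qed.

Let mg c n (ic : increasing_process P s t c) : measurable_fun setT (g c n).
Proof.
apply: measurable_sum => i.
apply: (@measurable_fun_ifT _ _ _ _ (fun z => f n i z.1) (cst 0)
  (fun z => (pt n i < reach_time s t c z) && (reach_time s t c z <= pt n i.+1))).
- apply: measurable_and.
    by apply: measurable_fun_ltr; [exact: measurable_cst|exact: mtc].
  by apply: measurable_fun_ler; [exact: mtc|exact: measurable_cst].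
- apply: measurableT_comp; last exact: measurable_fst.
  by apply: measurableT_comp; [exact: mclip|exact: mk (pt_ge _ _) (pt_le _)].
- exact: measurable_cst.
Qed.

Let stop_reach c z : increasing_process P s t c ->
  (forall w y, s <= y -> y <= t -> tau w <= y -> c y w = c t w) ->
  levels t c z -> reach_time s t c z <= tau z.1.
Proof.
move=> ic stop_c lz; rewrite leNgt; apply/negP => h.
have rt := reach_time_le c st z; have sr := reach_time_gt st ic lz.
pose y := Num.max s (tau z.1).
have sy : s <= y by rewrite le_max lexx.
have yr : y < reach_time s t c z by rewrite gt_max sr h.
have yt : y <= t by apply: le_trans (ltW yr) rt.
have : reach_time s t c z <= y.
  rewrite (reach_time_le_levels st ic lz sy yt) stop_c//; first by have [] := lz.
  by rewrite le_max lexx orbT.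
by rewrite leNgt yr.
Qed.

Let g_cvg c z : increasing_process P s t c ->
  (forall w y, s <= y -> y <= t -> tau w <= y -> c y w = c t w) ->
  levels t c z -> g c n z @[n --> \oo] --> H (time_change s t c z).
Proof.
move=> ic stop_c lz; have rt := reach_time_le c st z; have sr := reach_time_gt st ic lz.
rewrite /H /=; case: asboolP => [_|]; last first.
  by move=> []; split => //; exact: stop_reach.
rewrite (_ : (fun n => g c n z) = fun n => clip_neg (k (grid_right s t n (reach_time s t c z)) z.1)); last first.
  by apply/funext => n; exact: g_right.
set r := reach_time s t c z in rt sr *.
apply: (@cvg_comp _ _ _ (fun n => k (grid_right s t n r) z.1) _ _ (nbhs (k r z.1))); last first.
  exact: continuous_clip_neg.
have [rt'|tr] := ltP r t; last first.
  apply: cvg_near_cst; apply: nearW => n; congr k; apply/eqP; rewrite eq_le.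
  by rewrite (le_trans (grid_right_le st n rt) tr) grid_right_ge.
apply/cvgrPdist_le => e e0.
have := @rk r z.1 (ltW sr) rt' => /cvgrPdist_le /(_ _ e0) /near_rightP[v rv hv].
have := near_grid_right st rv; apply: filterS => n nv.
have := grid_right_ge st n r; rewrite le_eqVlt => /orP[/eqP <-|h].
  by rewrite subrr normr0 ltW.
by apply: hv; rewrite h.
Qed.

Let g01 c n z : levels t c z -> increasing_process P s t c -> 0 <= g c n z <= 1.
Proof. by move=> lz ic; rewrite g_right//; exact: clip_neg01. Qed.

Let S_cvg c : increasing_process P s t c ->
  (forall w y, s <= y -> y <= t -> tau w <= y -> c y w = c t w) ->
  (S n c)%:E @[n --> \oo] --> (\int[Pi]_(z in levels t c) (H (time_change s t c z))%:E)%E.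
Proof.
move=> ic stop_c.
have mL := measurable_levels st ic.
have mH := measurable_of_layers st filF incr_a incr_b ab H01 predH.
have -> : (fun n => (S n c)%:E) = fun n => (\int[Pi]_(z in levels t c) (g c n z)%:E)%E.
  apply/funext => n; symmetry; apply: (integral_levels_step st ic (f := f n)).
  - by move=> i i2; apply: measurableT_comp; [exact: mclip|exact: mk (pt_ge _ _) (pt_le _)].
  - by move=> i w i2; exact: clip_neg01.
  - by move=> z lz i i2 e; exact: gE.
have [] // := @dominated_convergence _ _ R Pi (levels t c) mL
  (fun n (z : Omega * measurableTypeR R) => (g c n z)%:E)
  (fun z : Omega * measurableTypeR R => (H (time_change s t c z))%:E) (cst 1%E).
- by move=> n; apply: measurable_funTS; apply/measurable_EFinP; exact: mg.
- apply: measurable_funTS; apply/measurable_EFinP; apply: measurableT_comp => //.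
  exact: (measurable_time_change st ic).
- by apply: aeW => z lz; apply: cvg_EFin; [exact: nearW|exact: g_cvg].
- apply/integrableP; split; first exact: measurable_cst.
  rewrite (eq_integral (cst 1%E)); last by move=> z _ /=; rewrite normr1.
  by rewrite integral_cst// mul1e; exact: (finite_levels st ic).
- apply: aeW => z n lz /=; rewrite lee_fin ger0_norm; first by have /andP[] := g01 n lz ic.
  by have /andP[] := g01 n lz ic.
Qed.

Let ik u : s <= u -> u <= t -> intg (k u).
Proof.
by move=> su ut; apply: intgB; [exact: (increasing_process_intg st incr_m su ut)|
  exact: (increasing_process_intg st incr_a su ut)].
Qed.

Let ipot u : s <= u -> u <= t -> intg (fun w => clip_potential (k u w)).
Proof.
move=> su ut; apply: (intg_le _ (ik su ut)).
  by apply: measurableT_comp; [exact: measurable_clip_potential|exact: mk].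
by apply: aeW => w; rewrite ger0_norm ?clip_potential_ge0 ?clip_potential_le.
Qed.

Let ij u : s <= u -> u <= t -> intg (j u).
Proof. by move=> su ut; exact: (increasing_process_intg st incr_j su ut). Qed.

Let S_le n : S n b <= S n a + E setT (fun w => j t w - clip_potential (k t w)).
Proof.
pose e i := E setT (fun w => j (pt n i) w - clip_potential (k (pt n i) w)).
have e0 : e 0%N = 0.
  rewrite /e [X in _ = X](_ : 0 = E setT (fun=> 0)); last by rewrite E_cst// mul0r.
  apply: eq_Rintegral => w _; rewrite /pt grid_point0.
  have [a0 _ _ _ _] := incr_a; have [m0 _ _ _ _] := incr_m; have [j0 _ _ _ _] := incr_j.
  by rewrite /k m0 a0 j0 subrr /clip_potential lexx subrr.
have eT : e (2 ^ n)%N = E setT (fun w => j t w - clip_potential (k t w)).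
  by rewrite /e /pt grid_point_max.
rewrite -eT -[e (2 ^ n)%N]subr0 -e0 -lerBlDl -(telescope_sumr e (leq0n _)) big_mkord.
rewrite /S -sumrB; apply: ler_sum => i _.
have p1 := pt_ge n i; have p2 := pt_le (ltnW (ltn_ord i)).
have p3 := pt_ge n i.+1; have p4 := pt_le (ltn_ord i).
have mf : measurable_fun setT (f n i) by apply: measurableT_comp; [exact: mclip|exact: mk].
have ifc c : increasing_process P s t c -> intg (fun w => f n i w * (c (pt n i.+1) w - c (pt n i) w)).
  move=> ic; have i1 := increasing_process_intg st ic p1 p2; have i2 := increasing_process_intg st ic p3 p4.
  apply: (intg_le _ (intgB i2 i1)).
    by apply: measurable_funM => //; apply: measurable_funB; [exact: intg_measurable i2|exact: intg_measurable i1].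
  apply: aeW => w; have /andP[f0 f1] := clip_neg01 (k (pt n i.+1) w).
  by rewrite normrM ler_piMl// ger0_norm.
rewrite -!E_B//; try by [exact: ifc|apply: intgB; [exact: ij|exact: ipot]].
apply: E_le => //.
- by apply: intgB; exact: ifc.
- by apply: intgB; (apply: intgB; [exact: ij|exact: ipot]).
move=> w _; have /andP[f0 f1] := clip_neg01 (k (pt n i.+1) w).
have [_ ndj _ _ _] := incr_j.
have dj := ndj w _ _ p1 (pt_lt n (leqnSn i)) p4.
have := clip_potential_convex (k (pt n i) w) (k (pt n i.+1) w).
rewrite /b /f; set x := clip_neg _ in f0 f1 *; rewrite {1 2}/k => h.
have : x * (j (pt n i.+1) w - j (pt n i) w) <= j (pt n i.+1) w - j (pt n i) w.
  by rewrite ler_piMl// subr_ge0.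
lra.
Qed.

(** Integrate the predictable integrand [clip_neg k] against [dm + dj - da]:
    the result is nonnegative, and by convexity at most
    [E (j t - clip_potential (k t))]. *)
Lemma stopped_domination :
  E setT (fun w => clip_potential (m t w - a t w)) <= E setT (j t).
Proof.
rewrite -subr_ge0 -E_B//; [|exact: ij|exact: (ipot st' (lexx t))].
have le1 := integral_levels_le st filF incr_a incr_b ab H01 predH.
have ca := S_cvg incr_a stop_a; have cb := S_cvg incr_b stop_b.
set Ia := (X in (X <= _)%E) in le1 ca; set Ib := (X in (_ <= X)%E) in le1 cb.
have finIa : Ia \is a fin_num.
  rewrite ge0_fin_numE; last first.
    by apply: integral_ge0 => z _; rewrite lee_fin; have /andP[] := H01 (time_change s t a z).
  apply: le_lt_trans (finite_levels st incr_a); rewrite -[leRHS]mul1e -integral_cst; last first.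
    exact: (measurable_levels st incr_a).
  apply: ge0_le_integral => //.
  - exact: (measurable_levels st incr_a).
  - by move=> z _; rewrite lee_fin; have /andP[] := H01 (time_change s t a z).
  - apply: measurable_funTS; apply/measurable_EFinP; apply: measurableT_comp.
      exact: (measurable_of_layers st filF incr_a incr_b ab H01 predH).
    exact: (measurable_time_change st incr_a).
  - by move=> z _; rewrite lee_fin; have /andP[] := H01 (time_change s t a z).
set c := E setT _.
have : (Ib <= Ia + c%:E)%E.
  have ca' : ((S n a)%:E + c%:E)%E @[n --> \oo] --> (Ia + c%:E)%E.
    by apply: cvgeD => //; [exact: fin_num_adde_defr|exact: cvg_cst].
  apply: (lee_cvg_to _ ca'); first exact: cb.
  apply: nearW => n.
  by rewrite -EFinD lee_fin; exact: S_le.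
move=> /(le_trans le1); rewrite -[leLHS]adde0 leeD2lE// lee_fin.
Qed.

End domination.

(** * Variation and predictability *)

Section variation_jump.
Context {R : realType}.
Implicit Types (f : R -> R) (a c e u : R) (l : seq R).

(* a partition of [[c, u]] without points in between is reduced to its end *)
Let itv_partition_end c u l : c < u -> itv_partition c u l ->
  (forall x, x \in l -> u <= x) -> l = [:: u].
Proof.
case: l => [|x l] cu; first by move=> /itv_partition_nil e; rewrite e ltxx in cu.
move=> [/= /andP[cx pl] /eqP lu] h.
case: l lu pl h => [/= -> //|y l] lu /= /andP[xy pl] h; exfalso.
have ux : u <= x by apply: h; rewrite mem_head.
have yl : y <= last y l by apply: (@itv_partition_le _ _ _ _ l); rewrite /itv_partition pl.
by have := lt_le_trans (le_lt_trans ux xy) yl; rewrite -[last y l]/(last x (y :: l)) lu ltxx.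
Qed.

(** Take a partition that almost attains the variation.  After its last point
    before [u] it only sees the two ends, so little variation is left to explain
    beyond their difference. *)
Lemma total_variation_jump a u f e : a < u -> (total_variation a u f < +oo)%E -> 0 < e ->
  exists r, [/\ a < r, r < u & forall c, r <= c -> c < u ->
    (total_variation c u f <= (`|f u - f c| + e)%:E)%E].
Proof.
move=> au fin e0.
have TVfin : total_variation a u f \is a fin_num.
  by rewrite ge0_fin_numE// total_variation_ge0// ltW.
have [_ [_ [l pl <-] <-] hl] := ub_ereal_sup_adherent e0 TVfin.
have [r [ar ru hr]] : exists r, [/\ a < r, r < u & forall x, x \in l -> x < u -> x <= r].
  elim: (l) => [|x l' [r [ar ru hr]]].
    by exists ((a + u) / 2); split => //; [rewrite midf_lt|rewrite midf_lt].
  have [xu|ux] := ltP x u; last first.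
    by exists r; split => // y; rewrite inE => /orP[/eqP ->|]; [rewrite ltNge ux|exact: hr].
  exists (Num.max x r); split; first by rewrite lt_max ar orbT.
    by rewrite gt_max xu.
  move=> y; rewrite inE => /orP[/eqP -> _|/hr h /h yr]; first by rewrite le_max lexx.
  by rewrite le_max yr orbT.
exists r; split => // c rc cu; have ac := lt_le_trans ar rc.
have pL := itv_partitionLP ac cu pl; have pR := itv_partitionRP ac cu pl.
have eR : itv_partitionR l c = [:: u].
  apply: (itv_partition_end cu pR) => x; rewrite mem_filter => /andP[cx xl].
  rewrite leNgt; apply/negP => xu; have := hr x xl xu.
  by rewrite leNgt (le_lt_trans rc cx).
have TVac : (total_variation a c f \is a fin_num).
  rewrite ge0_fin_numE ?total_variation_ge0 ?ltW//; apply: le_lt_trans fin.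
  by rewrite (total_variationD f (ltW ac) (ltW cu)) leeDl// total_variation_ge0// ltW.
have TVcu : (total_variation c u f \is a fin_num).
  rewrite ge0_fin_numE ?total_variation_ge0 ?ltW//; apply: le_lt_trans fin.
  by rewrite (total_variationD f (ltW ac) (ltW cu)) leeDr// total_variation_ge0// ltW.
move: hl; rewrite -/(total_variation a u f) (total_variationD f (ltW ac) (ltW cu)) => hl'.
have : ((variation a u f l)%:E <= total_variation a c f + (`|f u - f c|)%:E)%E.
  apply: (@le_trans _ _ (variation a u f (itv_partitionL l c ++ itv_partitionR l c))%:E).
    by rewrite lee_fin variation_itv_partitionLR.
  rewrite (variation_cat (c := c) f (ltW ac) (ltW cu) pL pR) EFinD leeD//.
    apply: ereal_sup_ubound; exists (variation a c f (itv_partitionL l c)) => //.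
    exact: variations_variation.
  by rewrite eR /variation /= big_nat_recr//= big_nil add0r.
move: hl'; rewrite -(fineK TVac) -(fineK TVcu) -!EFinD lte_fin !lee_fin; lra.
Qed.

Variables (s t : R).
Hypothesis st : s < t.

(** The variation at [u] is obtained from values at the left end of the grid cell
    and from [f u]: this makes the variation of a predictable process
    predictable. *)
Lemma variation_grid_left a f (V : R -> R) u : a <= s -> s < u -> u <= t ->
  (forall v, s <= v -> v <= t -> total_variation a v f = (V v)%:E) ->
  V (grid_left s t n u) + `|f u - f (grid_left s t n u)| @[n --> \oo] --> V u.
Proof.
move=> as_ su ut fV; apply/cvgrPdist_le => e e0.
have au := le_lt_trans as_ su.
have fin : (total_variation a u f < +oo)%E by rewrite fV ?ltry// ltW.
have [r [ar ru hr]] := total_variation_jump au fin e0.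
have := near_grid_left st ru; apply: filterS => n rn.
have sl := grid_left_ge st n su; have lu := grid_left_lt st n u.
set v := grid_left s t n u in rn sl lu *.
have := hr v (ltW rn) lu.
have D := total_variationD f (le_trans as_ sl) (ltW lu).
move: D; rewrite !fV ?(ltW su)// ?(le_trans (ltW lu))// => D.
have TVvu : total_variation v u f = (V u - V v)%:E.
  by rewrite EFinB D addeAC subee// add0e.
have := total_variation_ge f (ltW lu); rewrite TVvu !lee_fin => h1 h2.
rewrite ler_norml; apply/andP; split; lra.
Qed.

End variation_jump.

Section predictable_slab.
Context {R : realType} {d : measure_display} {Omega : measurableType d}.
Variable P : probability Omega R.
Variables (s t : R) (F : R -> set (set Omega)).
Hypothesis st : s < t.
Hypothesis filF : interval_filtration P s t F.

Local Notation gT := (g_sigma_algebraType (predictable_algebra s t F)).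

Definition slab : set (R * Omega) := [set z | s < z.1 /\ z.1 <= t].

Let cs u := clamp_time_ge s t u.
Let ct u := clamp_time_le st u.

Let salF := filtration_salgebra filF.

Let mcst (Q : Prop) u : s <= u -> u <= t -> F u [set w | Q].
Proof.
move=> su ut; have [q|q] := pselect Q.
  by rewrite (_ : mkset _ = setT); [exact: salgebraT (salF su ut)|apply/seteqP; split].
by rewrite (_ : mkset _ = set0); [exact: salgebra0 (salF su ut)|apply/seteqP; split].
Qed.

Lemma predictable_slab : measurable (slab : set gT).
Proof.
apply: sub_gen_smallest; exists 0%N => y; split; last exact: (mcst (s < y /\ y <= t) (cs _) (ct _)).
move=> y' w e [/= sy yt].
have [i i2 hi] := grid_index_cell st 0 sy yt.
have i0 : i = 0%N by case: i i2 {hi}.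
rewrite -e i0 in hi; split => /=.
  by have := grid_left_lt st 0 y'; rewrite /grid_left hi addrK grid_point0.
by have := grid_right_ge st 0 y'; rewrite /grid_right hi (_ : 0%N%:Z + 1 = (2 ^ 0)%N%:Z)// grid_point_max.
Qed.

Let leftE n y : s < y -> y <= t -> clamp_time s t (grid_left s t n y) = grid_left s t n y.
Proof.
move=> sy yt; rewrite clamp_time_id//; first exact: grid_left_ge.
by rewrite (le_trans _ yt)// ltW// grid_left_lt.
Qed.

Let predictable_grid_left n (Q : R -> set Omega) :
  (forall u, s <= u -> u <= t -> F u (Q u)) ->
  measurable ([set z | Q (clamp_time s t (grid_left s t n z.1)) z.2] : set gT).
Proof.
move=> hQ; apply: sub_gen_smallest; exists n => y; split; last by apply: hQ; [exact: cs|exact: ct].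
by move=> y' w e; rewrite /= /grid_left e.
Qed.

(** [tau < y] if and only if [tau] is before the left end of the cell of [y] in a
    fine enough grid. *)
Lemma predictable_after (tau : Omega -> R) :
  (forall u, s <= u -> u <= t -> F u [set w | tau w <= u]) ->
  measurable (slab `&` [set z | tau z.2 < z.1] : set gT).
Proof.
move=> ht; rewrite (_ : _ `&` _ =
    \bigcup_n (slab `&` [set z | tau z.2 <= clamp_time s t (grid_left s t n z.1)])); last first.
  apply/seteqP; split => [[y w] [[/= sy yt] h]|[y w] [n _ [[/= sy yt] /=]]].
    have [n _ hn] := near_grid_left st h; exists n => //; split => //=.
    rewrite leftE//; apply: ltW; exact: hn n (leqnn n).
  by rewrite leftE// => h; split => //=; apply: le_lt_trans h (grid_left_lt st n y).
apply: bigcupT_measurable => n; apply: measurableI; first exact: predictable_slab.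
exact: predictable_grid_left ht.
Qed.

Lemma predictable_until (tau : Omega -> R) :
  (forall u, s <= u -> u <= t -> F u [set w | tau w <= u]) ->
  measurable (slab `&` [set z | z.1 <= tau z.2] : set gT).
Proof.
move=> ht; rewrite (_ : _ `&` _ = slab `\` (slab `&` [set z | tau z.2 < z.1])).
  by apply: measurableD; [exact: predictable_slab|exact: predictable_after].
apply/seteqP; split => -[y w] [h1 /= h2]; split => //=.
  by move=> [_]; rewrite /= ltNge h2.
by rewrite leNgt; apply/negP => h; apply: h2.
Qed.

Lemma predictable_section B : F s B -> measurable (slab `&` [set z | B z.2] : set gT).
Proof.
move=> FB; apply: measurableI; first exact: predictable_slab.
apply: (@predictable_grid_left 0 (fun=> B)) => u su ut.
by have [_ mo _ _] := filF; exact: (mo s u).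
Qed.

Lemma predictable_of_left (X V : R -> Omega -> R) B :
  F s B -> (forall u, s <= u -> u <= t -> measurable_wrt (F u) (X u)) ->
  (forall u, s <= u -> u <= t -> measurable_wrt (F u) (V u)) ->
  measurable_fun (slab : set gT) (fun z : gT => X z.1 z.2) ->
  (forall w, B w -> forall u, s < u -> u <= t ->
     V (grid_left s t n u) w + `|X u w - X (grid_left s t n u) w| @[n --> \oo] --> V u w) ->
  measurable_fun (slab `&` [set z | B z.2] : set gT) (fun z : gT => V z.1 z.2).
Proof.
move=> FB hX hV pX cV.
have mSB := predictable_section FB.
have mleft n (Y : R -> Omega -> R) : (forall u, s <= u -> u <= t -> measurable_wrt (F u) (Y u)) ->
    measurable_fun (slab `&` [set z | B z.2] : set gT)
      (fun z : gT => Y (clamp_time s t (grid_left s t n z.1)) z.2).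
  move=> hY; apply: measurable_funTS => _ C mC; rewrite setTI.
  by apply: (predictable_grid_left n (Q := fun u => Y u @^-1` C)) => u su ut; exact: hY.
apply: (@measurable_fun_cvg _ gT R _ (fun n (z : gT) => V (clamp_time s t (grid_left s t n z.1)) z.2 +
  `|X z.1 z.2 - X (clamp_time s t (grid_left s t n z.1)) z.2|)).
  move=> n; apply: measurable_funD; first exact: mleft.
  apply: measurableT_comp => //; apply: measurable_funB; last exact: mleft.
  apply: measurable_funS pX; [exact: predictable_slab|exact: subIsetl].
move=> [y w] [[/= sy yt] /= Bw].
have := cV w Bw y sy yt; apply: cvg_trans; apply: near_eq_cvg; apply: nearW => n /=.
by rewrite leftE.
Qed.

End predictable_slab.

Section predictable_trace.
Context {R : realType} {d : measure_display} {Omega : measurableType d}.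
Variable P : probability Omega R.
Variables (T : \bar R) (F : \bar R -> set (set Omega)).
Hypothesis usualF : usual_filtration T F P.
Variables (s t : R).
Hypotheses (s0 : 0 <= s) (st : s < t) (tT : (t%:E <= T)%E).

Local Notation gT := (g_sigma_algebraType (predictable_algebra s t (fun u => F u%:E))).

Let filF := usual_interval_filtration usualF s0 (ltW st) tT.

Let tm u : s <= u -> u <= t -> times T u%:E.
Proof.
move=> su ut; split; first by rewrite lee_fin (le_trans s0).
by apply: le_trans tT; rewrite lee_fin.
Qed.

(** For [B] in [F u], the rectangle [(u, +oo) * B] is the set of times after [tau],
    where [tau] is [u] on [B] and beyond [t] elsewhere. *)
Lemma predictable_trace C : predictable_sets T F C ->
  measurable (slab s t `&` [set z | C (z.1%:E, z.2)] : set gT).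
Proof.
have mS := predictable_slab st filF.
pose W := [set C : set (\bar R * Omega) |
  measurable (slab s t `&` [set z | C (z.1%:E, z.2)] : set gT)].
suff sub : predictable_sets T F `<=` W by exact: sub.
apply: smallest_sub.
  split.
  - by rewrite /W /= (_ : _ `&` _ = set0)//; apply/seteqP; split => z // -[].
  - move=> A WA; rewrite /W /= (_ : _ `&` _ = slab s t `\` (slab s t `&` [set z | A (z.1%:E, z.2)])).
      exact: measurableD.
    apply/seteqP; split => -[y w] [/= [sy yt] h]; split => //=.
      by move=> [_]; apply: h.2.
    split; first by split => //; exact: tm (ltW sy) yt.
    by move=> Aw; apply: h.
  - move=> A WA; rewrite /W /= (_ : _ `&` _ = \bigcup_i (slab s t `&` [set z | A i (z.1%:E, z.2)])).
      exact: bigcupT_measurable.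
    by apply/seteqP; split => -[y w] => [[h1 [i _ h2]]|[i _ [h1 h2]]]; [exists i|split => //; exists i].
move=> A [[B FB ->]|[u [v [B [u0 uv vT FB ->]]]]]; rewrite /W /=.
  rewrite (_ : _ `&` _ = set0)//; apply/seteqP; split => -[y w] //= [[/= sy _] [/= e _]].
  by move: e => [e]; move: (le_lt_trans s0 sy); rewrite e ltxx.
have mcst r : measurable (slab s t `&` [set z | (r < z.1)] : set gT).
  apply: (predictable_after st filF (tau := fun=> r)) => x sx xt.
  have sal : sigma_algebra setT (F x%:E) by have [+ _ _ _] := usualF => /(_ _ (tm sx xt))[].
  have [rx|xr] := leP r x.
    by rewrite (_ : mkset _ = setT); [exact: salgebraT|apply/seteqP; split].
  by rewrite (_ : mkset _ = set0); [exact: salgebra0|apply/seteqP; split].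
have mv : measurable (slab s t `&` [set z | (z.1%:E <= v)%E] : set gT).
  rewrite (_ : _ `&` _ = slab s t `\` (slab s t `&` [set z | (v < z.1%:E)%E])).
    apply: measurableD => //; case: v {uv vT} => [r| |].
    - exact: mcst.
    - by rewrite (_ : _ `&` _ = set0)//; apply/seteqP; split => z // -[].
    - rewrite (_ : _ `&` _ = slab s t)//; apply/seteqP; split => z; first by case.
      by move=> h; split => //=; exact: ltNyr.
  apply/seteqP; split => z [h1 h2]; split => //=.
    by move=> [_] /=; rewrite ltNge h2.
  by rewrite leNgt; apply/negP => h; apply: h2.
rewrite (_ : _ `&` _ = (slab s t `&` [set z | (z.1%:E <= v)%E]) `&`
  (slab s t `&` [set z | (u < z.1%:E)%E /\ B z.2])); last first.
  by apply/seteqP; split => z => [[h1 [[h2 h3] h4]]|[[h1 h2] [_ [h3 h4]]]].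
apply: measurableI => //.
case: u u0 uv FB => [r| |] // r0 uv FB; last first.
  by rewrite (_ : _ `&` _ = set0)//; apply/seteqP; split => z // -[_ []].
pose tau w := if `[< B w >] then r else t + 1.
rewrite (_ : _ `&` _ = slab s t `&` [set z | tau z.2 < z.1]); last first.
  apply/seteqP; split => -[y w] [[/= sy yt]] /=; rewrite /tau lte_fin.
    by move=> [h1 h2]; split => //=; case: asboolP.
  case: asboolP => h h1; split => //; exfalso.
  by move: (lt_le_trans h1 yt); rewrite ltNge lerDl ler01.
apply: (predictable_after st filF) => x sx xt.
have [sal _] : sigma_algebra setT (F x%:E) /\ F x%:E `<=` measurable.
  by have [+ _ _ _] := usualF => /(_ _ (tm sx xt)).
have [rx|xr] := leP r x; last first.
  rewrite (_ : mkset _ = set0); first exact: salgebra0.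
  apply/seteqP; split => w //=; rewrite /tau; case: asboolP => _; first by rewrite leNgt xr.
  by move=> /le_trans /(_ xt); rewrite leNgt ltrDl ltr01.
rewrite (_ : mkset _ = B).
  have [_ mo _ _] := usualF; apply: (mo r%:E x%:E) => //; last exact: tm.
  by split => //; apply: le_trans (tm sx xt).2; rewrite lee_fin.
apply/seteqP; split => w //=; rewrite /tau; case: asboolP => // _.
by move=> /le_trans /(_ xt); rewrite leNgt ltrDl ltr01.
Qed.

Lemma measurable_predictable X : predictable T F X ->
  measurable_fun (slab s t : set gT) (fun z : gT => X z.1%:E z.2).
Proof.
move=> pX _ B mB; have := predictable_trace (pX B mB).
rewrite (_ : _ `&` [set z | _] = slab s t `&` (fun z : gT => X z.1%:E z.2) @^-1` B) //.
apply/seteqP; split => -[y w] [h1 h2]; split => //=; first by case: h2.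
by split => //; have [/= sy yt] := h1; exact: tm (ltW sy) yt.
Qed.

End predictable_trace.

(** * An integrable bound for the process *)

Section integrable_bound.
Context {R : realType} {d : measure_display} {Omega : measurableType d}.
Variable P : probability Omega R.

Local Notation intg X := (P.-integrable [set: Omega] (EFin \o X)).

(** The integral of a nonnegative function is a supremum over simple functions,
    whether the function is measurable or not. *)
Lemma ge0_le_integralT (f g : Omega -> \bar R) : (forall w, (0 <= f w)%E) ->
  (forall w, (f w <= g w)%E) -> (\int[P]_w f w <= \int[P]_w g w)%E.
Proof.
move=> f0 fg; have g0 w : (0 <= g w)%E by apply: le_trans (fg w).
rewrite !ge0_integralTE//; apply: le_ereal_sup => _ [h hf <-]; exists h => //= w.
exact: le_trans (hf w) (fg w).
Qed.

Variables (T : \bar R) (F : \bar R -> set (set Omega)).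
Hypothesis usualF : usual_filtration T F P.

(** The supremum of [|G|] over countably many times is measurable, and by
    right-continuity it bounds [|G|] at all times. *)
Lemma in_S1_bound (G : \bar R -> Omega -> R) (t : R) :
  cadlag_process T F P G -> in_S1 T P G -> 0 <= t -> (t%:E <= T)%E ->
  exists Gam : Omega -> R, [/\ intg Gam, (forall w, 0 <= Gam w) &
    \forall w \ae P, forall u, 0 <= u -> u <= t -> `|G u%:E w| <= Gam w].
Proof.
move=> [aG cG] S1G t0 tT.
have tm u : 0 <= u -> u <= t -> times T u%:E.
  by move=> u0 ut; split; [rewrite lee_fin|apply: le_trans tT; rewrite lee_fin].
pose q (k : nat) : R := if unpickle k is Some r then Num.min t (Num.max 0 (ratr (r : rat))) else t.
have q0 k : 0 <= q k by rewrite /q; case: unpickle => // r; rewrite le_min t0 le_max lexx.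
have qt k : q k <= t by rewrite /q; case: unpickle => // r; rewrite ge_min lexx.
pose Ge w := esups (fun k => (`|G (q k)%:E w|)%:E) 0.
have GeP w k : ((`|G (q k)%:E w|)%:E <= Ge w)%E by apply: ereal_sup_ubound; exists k.
have Ge0 w : (0 <= Ge w)%E by apply: le_trans (GeP w 0%N); rewrite lee_fin.
have mGe : measurable_fun setT Ge.
  apply: measurable_fun_esups => k; apply/measurable_EFinP; apply: measurableT_comp => //.
  have [_ sub] : sigma_algebra setT (F (q k)%:E) /\ F (q k)%:E `<=` measurable.
    by have [+ _ _ _] := usualF; apply; exact: tm.
  by move=> _ B mB; rewrite setTI; apply: sub; apply: aG => //; exact: tm.
have iGe : P.-integrable setT Ge.
  apply/integrableP; split => //; apply: le_lt_trans S1G.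
  apply: ge0_le_integralT => w; first exact: abse_ge0.
  rewrite gee0_abs//; apply: ge_ereal_sup => _ [k _ <-].
  by apply: ereal_sup_ubound; exists (q k)%:E => //; exact: tm.
exists (fun w => fine (Ge w)).
have finGe : \forall w \ae P, Ge w \is a fin_num.
  have := integrable_ae measurableT iGe; apply: filterS => w; exact.
split.
- apply: (le_integrable measurableT _ _ iGe).
    by apply/measurable_EFinP; apply: measurableT_comp.
  move=> w _ /=; rewrite (gee0_abs (Ge0 w)) ger0_norm ?fine_ge0//.
  by case: (Ge w) (Ge0 w) => [r| |].
- by move=> w; rewrite fine_ge0.
apply: filterS2 finGe cG => w fw cw u u0 ut.
have Gq k : `|G (q k)%:E w| <= fine (Ge w) by rewrite -lee_fin fineK.
have Gr (r : rat) : 0 <= ratr r :> R -> ratr r <= t -> `|G (ratr r)%:E w| <= fine (Ge w).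
  move=> r0 rt; have := Gq (pickle r); rewrite /q pickleK max_r// min_r//.
move: ut; rewrite le_eqVlt => /orP[/eqP ->|ut].
  have [r hr] : exists r : rat, ratr r \in `]t, (t + 1)[ by apply: rat_in_itvoo; rewrite ltrDl.
  move: hr; rewrite in_itv /= => /andP[tr _].
  by have := Gq (pickle r); rewrite /q pickleK min_l// le_max (ltW tr) orbT.
have uT : finite_times T u by split => //; apply: le_trans tT; rewrite lee_fin ltW.
have [rc _] := cw u uT; have {}rc := rc _; rewrite -subr_ge0.
apply: (@right_limit_ge0 R (fun x => fine (Ge w) - `|G x%:E w|) u t _ ut).
  apply: cvgB; first exact: cvg_cst.
  by apply: cvg_norm; apply: rc; apply: lt_le_trans tT; rewrite lte_fin.
move=> r /andP[ur rt]; rewrite subr_ge0; apply: Gr; last exact: ltW.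
exact: le_trans u0 (ltW ur).
Qed.

End integrable_bound.

(** * Stopping at a bounded variation *)

Section stopped_paths.
Context {R : realType} {d : measure_display} {Omega : measurableType d}.
Variable P : probability Omega R.

Local Notation intg X := (P.-integrable [set: Omega] (EFin \o X)).

Definition increasing_paths (s t : R) (x : R -> Omega -> R) : Prop :=
  [/\ (forall w, x s w = 0),
      (forall w u v, s <= u -> u <= v -> v <= t -> x u w <= x v w) &
      (forall w u, s <= u -> u < t -> x y w @[y --> u^'+] --> x u w)].

Variables (s t : R) (F : R -> set (set Omega)).
Hypothesis st : s < t.
Hypothesis filF : interval_filtration P s t F.

Let mF := filtration_measurable filF.
Let salF := filtration_salgebra filF.

Variables (x : R -> Omega -> R) (tau : Omega -> R).
Hypothesis htau : forall u, s <= u -> u <= t -> F u [set w | tau w <= u].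

Let z u := stopped_after s u x tau.

Lemma stopped_after_before u w : s < tau w -> u <= tau w -> z u w = x u w.
Proof. by move=> h1 h2; rewrite /z /stopped_after patchE mem_set// min_l. Qed.

Lemma stopped_after_late u w : s < tau w -> tau w <= u -> z u w = x (tau w) w.
Proof. by move=> h1 h2; rewrite /z /stopped_after patchE mem_set// min_r. Qed.

Lemma stopped_after_never u w : tau w <= s -> z u w = 0.
Proof. by move=> h; rewrite /z /stopped_after patchE memNset//= => /lt_le_trans /(_ h); rewrite ltxx. Qed.

Lemma stopped_after_const y w : s <= y -> y <= t -> tau w <= y -> z y w = z t w.
Proof.
move=> sy yt h; have [h1|h1] := ltP s (tau w); last by rewrite !stopped_after_never.
by rewrite !stopped_after_late// (le_trans h).
Qed.

Hypothesis incr_x : increasing_paths s t x.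

Lemma increasing_stopped : increasing_paths s t z.
Proof.
have [x0 nd rc] := incr_x; split.
- move=> w; have [h|h] := ltP s (tau w); last exact: stopped_after_never.
  by rewrite stopped_after_before// ltW.
- move=> w u v su uv vt; have [h|h] := ltP s (tau w); last by rewrite !stopped_after_never.
  rewrite /z /stopped_after !patchE !mem_set//; apply: nd.
  + by rewrite le_min su ltW.
  + by rewrite le_min ge_min uv /= ge_min lexx orbT.
  + by rewrite ge_min vt.
- move=> w u su ut; have [h|h] := ltP s (tau w); last first.
    rewrite stopped_after_never//; apply: cvg_near_cst; apply: nearW => y.
    by rewrite stopped_after_never.
  have [ut'|tu] := ltP u (tau w); last first.
    rewrite stopped_after_late//; apply: cvg_near_cst; apply/near_rightP.
    exists t => // y /andP[uy _]; rewrite stopped_after_late//; exact: le_trans tu (ltW uy).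
  rewrite stopped_after_before//; last exact: ltW.
  apply: cvg_trans (rc w u su ut); apply: near_eq_cvg; apply/near_rightP.
  by exists (tau w) => // y /andP[uy yt]; rewrite stopped_after_before// ltW.
Qed.

Lemma stopped_after_left_limit w u : s < u -> u <= t ->
  cvg (x y w @[y --> u^'-]) -> cvg (z y w @[y --> u^'-]).
Proof.
move=> su ut /cvg_ex[l hl]; have [h|h] := ltP s (tau w); last first.
  apply: (cvgP 0); apply: cvg_near_cst; apply: nearW => y.
  by rewrite stopped_after_never.
have [ut'|tu] := leP u (tau w); last first.
  apply: (cvgP (x (tau w) w)); apply: cvg_near_cst; apply/near_leftP.
  by exists (tau w) => // y /andP[uy _]; rewrite stopped_after_late// ltW.
apply: (cvgP l); apply: cvg_trans hl; apply: near_eq_cvg; apply/near_leftP.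
by exists s => // y /andP[sy yu]; rewrite stopped_after_before// ltW// (lt_le_trans yu).
Qed.

Hypothesis hx : forall u, s <= u -> u <= t -> measurable_wrt (F u) (x u).

Lemma adapted_stopped u : s <= u -> u <= t -> measurable_wrt (F u) (z u).
Proof.
move=> su ut; have [x0 _ rc] := incr_x.
move: su; rewrite le_eqVlt => /orP[/eqP <-|su].
  rewrite (_ : z s = fun=> 0); last first.
    apply/funext => w; have [h|h] := ltP s (tau w); last exact: stopped_after_never.
    by rewrite stopped_after_before// ltW.
  exact: measurable_wrt_cst (salF (lexx s) (ltW st)) _.
apply: (measurable_stopped_after su (filtration_sub filF (lexx s) (ltW su) ut)).
- by move=> v sv vu; apply: hx => //; exact: le_trans ut.
- by apply: aeW => w v sv vu; apply: rc => //; exact: lt_le_trans ut.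
- by move=> v sv vu; apply: htau => //; exact: le_trans ut.
Qed.

Lemma increasing_process_stopped : intg (z t) -> increasing_process P s t z.
Proof.
move=> iz; have [z0 nd rc] := increasing_stopped; split => // u su ut.
apply: measurable_wrt_measurable (adapted_stopped su ut) => B; exact: mF.
Qed.

Variable c : R.
Hypothesis c0 : 0 < c.

Definition first_passage (w : Omega) : R :=
  if c <= x t w then reach_time s t (fun u w => Num.min (x u w) c) (w, c) else t + 1.

(** Truncation at level [c] turns the path into one with an integrable end
    without changing the passage above [c]. *)
Lemma first_passage_le w u : s <= u -> u <= t -> (first_passage w <= u) = (c <= x u w).
Proof.
have [x0 nd rc] := incr_x => su; rewrite /first_passage.
have mx v : s <= v -> v <= t -> measurable_fun setT (x v).
  by move=> sv vt; apply: measurable_wrt_measurable (hx sv vt) => B; exact: mF.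
have ip : increasing_process P s t (fun u w => Num.min (x u w) c).
  split.
  - by move=> w'; rewrite x0 min_l// ltW.
  - by move=> w' v v' sv vv' vt; rewrite le_min !ge_min lexx (nd w' _ _ sv vv' vt) orbT.
  - move=> w' v sv vt; apply: cvg_minr; last exact: cvg_cst.
    exact: rc.
  - by move=> v sv vt; apply: measurable_minr; [exact: mx|exact: measurable_cst].
  - apply: (@intg_bounded _ _ _ _ _ c).
      by apply: measurable_minr; [exact: mx (ltW st) (lexx t)|exact: measurable_cst].
    apply: aeW => w'; rewrite ger0_norm ?ge_min ?lexx ?orbT// le_min (ltW c0) andbT.
    by rewrite -(x0 w'); apply: nd => //; exact: ltW.
rewrite le_eqVlt => /orP[/eqP ->|ut].
  case: ifP => h; first by rewrite reach_time_le.
  by apply/negbTE; rewrite -ltNge ltrDl.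
case: ifP => h.
  by rewrite (reach_time_leP st ip)//= le_min lexx andbT.
rewrite leNgt (lt_trans ut) ?ltrDl//=; apply/esym/negbTE; move/negbT: h; rewrite -!ltNge.
by apply: le_lt_trans; exact: nd w u t su (ltW ut) (lexx t).
Qed.

Lemma first_passage_stopping u : s <= u -> u <= t -> F u [set w | first_passage w <= u].
Proof.
move=> su ut; rewrite (_ : mkset _ = [set w | (fun=> c) w <= x u w]).
  apply: measurable_wrt_le; [exact: salF| |exact: hx].
  exact: measurable_wrt_cst (salF su ut) _.
by apply/seteqP; split => w /=; rewrite first_passage_le.
Qed.

End stopped_paths.

(** * The estimate on one time interval *)

Section estimate.
Context {R : realType} {d : measure_display} {Omega : measurableType d}.
Variable P : probability Omega R.
Implicit Types (B C : set Omega).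

Local Notation intg X := (P.-integrable [set: Omega] (EFin \o X)).
Local Notation E := (Rintegral P).

Variables (T : \bar R) (F : \bar R -> set (set Omega)).
Variables (s t : R) (G N D Dp Dm S M A : \bar R -> Omega -> R) (Gam : Omega -> R).

(** The properties of a single path that are used; they hold outside of a
    negligible event. *)
Record regular_outcome (w : Omega) : Prop := {
  A_nd : forall u v, s <= u -> u <= v -> v <= t -> A u%:E w <= A v%:E w;
  A_rc : forall u, s <= u -> u < t -> A x%:E w @[x --> u^'+] --> A u%:E w;
  Dp_nd : forall u v, s <= u -> u <= v -> v <= t -> Dp u%:E w <= Dp v%:E w;
  Dp_rc : forall u, s <= u -> u < t -> Dp x%:E w @[x --> u^'+] --> Dp u%:E w;
  Dm_nd : forall u v, s <= u -> u <= v -> v <= t -> Dm u%:E w <= Dm v%:E w;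
  Dm_rc : forall u, s <= u -> u < t -> Dm x%:E w @[x --> u^'+] --> Dm u%:E w;
  Dm_ll : forall u, s < u -> u <= t -> cvg (Dm x%:E w @[x --> u^'-]);
  N_rc : forall u, s <= u -> u < t -> N x%:E w @[x --> u^'+] --> N u%:E w;
  G_eq : forall u, s <= u -> u <= t -> G u%:E w = N u%:E w + D u%:E w;
  D_eq : forall u, s <= u -> u <= t -> D u%:E w - D 0%E w = Dp u%:E w - Dm u%:E w;
  D_var : forall u, s <= u -> u <= t ->
    total_variation 0 u (fun x => D x%:E w) = (Dp u%:E w + Dm u%:E w)%:E;
  S_eq : forall u, s <= u -> u <= t -> S u%:E w = M u%:E w - A u%:E w;
  S_ge : forall u, s <= u -> u <= t -> G u%:E w <= S u%:E w;
  G_bd : forall u, s <= u -> u <= t -> `|G u%:E w| <= Gam w }.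

Hypothesis usualF : usual_filtration T F P.
Hypotheses (s0 : 0 <= s) (st : s < t) (tT : (t%:E <= T)%E).

Let filF := usual_interval_filtration usualF s0 (ltW st) tT.

Let tm u : s <= u -> u <= t -> times T u%:E.
Proof.
move=> su ut; split; first by rewrite lee_fin (le_trans s0).
by apply: le_trans tT; rewrite lee_fin.
Qed.

Let mF u B : s <= u -> u <= t -> F u%:E B -> measurable B.
Proof. by move=> su ut; have [+ _ _ _] := filF => /(_ _ su ut)[_]; exact. Qed.

Let salF u : s <= u -> u <= t -> sigma_algebra setT (F u%:E).
Proof. by move=> su ut; have [+ _ _ _] := filF => /(_ _ su ut)[]. Qed.

Let monoF u v : s <= u -> u <= v -> v <= t -> F u%:E `<=` F v%:E.
Proof. by have [_ + _ _] := filF; exact. Qed.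

Variable Om : set Omega.
Hypothesis FOm : F 0%E Om.
Hypothesis aeOm : \forall w \ae P, Om w.
Hypothesis reg : forall w, Om w -> regular_outcome w.

Let F0 u B : s <= u -> u <= t -> F 0%E B -> F u%:E B.
Proof.
move=> su ut; have [_ mo _ _] := usualF; apply: mo; [|exact: tm|by rewrite lee_fin (le_trans s0)].
by split => //; have [_] := tm su ut; apply: le_trans; rewrite lee_fin (le_trans s0).
Qed.

(** Zero on the exceptional outcomes, so that the paths are regular everywhere. *)
Definition increment (X : \bar R -> Omega -> R) (u : R) : Omega -> R :=
  (fun w => X u%:E w - X s%:E w) \_ Om.

Lemma incrementE X u w : Om w -> increment X u w = X u%:E w - X s%:E w.
Proof. by move=> h; rewrite /increment patchE mem_set. Qed.

Lemma increment0 X u w : ~ Om w -> increment X u w = 0.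
Proof. by move=> h; rewrite /increment patchE memNset. Qed.

Lemma adapted_increment X : adapted T F X ->
  forall u, s <= u -> u <= t -> measurable_wrt (F u%:E) (increment X u).
Proof.
move=> aX u su ut; apply: measurable_wrt_restrict; [exact: salF|exact: F0|].
apply: measurable_wrtB; [exact: salF|exact: aX (tm su ut)|move=> B mB].
apply: (monoF (lexx s) su ut); exact: aX (tm (lexx s) (ltW st)) B mB.
Qed.

Let increasing_increment X :
  (forall w, Om w -> forall u v, s <= u -> u <= v -> v <= t -> X u%:E w <= X v%:E w) ->
  (forall w, Om w -> forall u, s <= u -> u < t -> X x%:E w @[x --> u^'+] --> X u%:E w) ->
  increasing_paths s t (increment X).
Proof.
move=> nd rc; split.
- by move=> w; have [h|h] := pselect (Om w); [rewrite incrementE// subrr|exact: increment0].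
- move=> w u v su uv vt; have [h|h] := pselect (Om w); last by rewrite !increment0.
  by rewrite !incrementE// lerD2r nd.
- move=> w u su ut; have [h|h] := pselect (Om w).
    rewrite incrementE// (_ : (fun y => increment X y w) = fun y => X y%:E w - X s%:E w); last first.
      by apply/funext => y; rewrite incrementE.
    by apply: cvgB; [exact: rc|exact: cvg_cst].
  rewrite increment0//; apply: cvg_near_cst; apply: nearW => y; exact: increment0.
Qed.

Hypotheses (aA : adapted T F A) (aDp : adapted T F Dp) (aDm : adapted T F Dm).
Hypotheses (aD : adapted T F D) (cG : cadlag_process T F P G).
Hypothesis snellS : snell_envelope T F P G S.
Hypothesis mM : martingale T F P M.
Hypotheses (pA : predictable T F A) (pD : predictable T F D).
Hypotheses (iGam : intg Gam) (Gam0 : forall w, 0 <= Gam w).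
Variable sigma : Omega -> \bar R.
Hypothesis stop_sigma : stopping_time T F sigma.
Hypothesis mN : martingale T F P (stopped N sigma).
Variable lvl : R.
Hypothesis lvl0 : 0 < lvl.

Let a := increment A.
Let p := increment Dp.
Let m := increment Dm.
Let v0 u w := p u w + m u w.

Let ia : increasing_paths s t a.
Proof. by apply: increasing_increment => w /reg; [exact: A_nd|exact: A_rc]. Qed.
Let ip : increasing_paths s t p.
Proof. by apply: increasing_increment => w /reg; [exact: Dp_nd|exact: Dp_rc]. Qed.
Let im : increasing_paths s t m.
Proof. by apply: increasing_increment => w /reg; [exact: Dm_nd|exact: Dm_rc]. Qed.

Let path_ge0 (x : R -> Omega -> R) u w : increasing_paths s t x -> s <= u -> u <= t -> 0 <= x u w.
Proof. by move=> [x0 nd _] su ut; rewrite -(x0 w); exact: nd. Qed.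

Let iv : increasing_paths s t v0.
Proof.
have [p0 ndp rp] := ip; have [m0 ndm rm] := im; split.
- by move=> w; rewrite /v0 p0 m0 addr0.
- by move=> w u v su uv vt; rewrite lerD// ?ndp ?ndm.
- by move=> w u su ut; apply: cvgD; [exact: rp|exact: rm].
Qed.

Let av u : s <= u -> u <= t -> measurable_wrt (F u%:E) (v0 u).
Proof.
by move=> su ut; apply: measurable_wrtD; [exact: salF|exact: adapted_increment|exact: adapted_increment].
Qed.

(** Before [stop] the variation of the drift since [s] is below [lvl] and the
    local martingale is a martingale. *)
Definition stop (w : Omega) : R :=
  Num.min (if (sigma w <= t%:E)%E then fine (sigma w) else t + 1)
          (first_passage s t v0 lvl w).

Let tau := stop.

Let capped_le u w : s <= u -> u <= t ->
  ((if (sigma w <= t%:E)%E then fine (sigma w) else t + 1) <= u) = (sigma w <= u%:E)%E.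
Proof.
move=> su ut; have [sg _] := stop_sigma; have := sg w; case: (sigma w) => [r| |] //= _.
  rewrite !lee_fin; case: ifP => // /negbT; rewrite -ltNge => tr.
  by rewrite !leNgt (le_lt_trans ut tr) (le_lt_trans ut) ?ltrDl.
by rewrite leNgt (le_lt_trans ut) ?ltrDl.
Qed.

Lemma stop_stopping u : s <= u -> u <= t -> F u%:E [set w | tau w <= u].
Proof.
move=> su ut; rewrite (_ : mkset _ = [set w | (sigma w <= u%:E)%E] `|`
    [set w | first_passage s t v0 lvl w <= u]); last first.
  apply/seteqP; split => w /=; rewrite /tau /stop ge_min capped_le//.
    by move=> /orP.
  by move=> h; apply/orP.
apply: salgebraU; first exact: salF.
  by have [_ h] := stop_sigma; apply: h; exact: tm.
exact: (first_passage_stopping st filF iv av lvl0).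
Qed.

Let htau := stop_stopping.

Lemma lt_stop w : (t%:E < sigma w)%E -> v0 t w < lvl -> t < tau w.
Proof.
move=> h1 h2; rewrite ltNge /tau /stop ge_min capped_le ?(ltW st)//.
rewrite (first_passage_le st filF iv av lvl0)// ?(ltW st)//.
by rewrite leNgt h1 /= -ltNge.
Qed.

Let tau_v0 u w : s <= u -> u <= t -> u < tau w -> v0 u w < lvl.
Proof.
move=> su ut; rewrite lt_min => /andP[_]; rewrite ltNge.
by rewrite (first_passage_le st filF iv av lvl0)// -ltNge.
Qed.

Let Ns u := stopped N sigma u%:E.

Let NsE u w : u <= t -> u <= tau w -> Ns u w = N u%:E w.
Proof.
move=> ut; rewrite le_min => /andP[h _]; rewrite /Ns /stopped min_l//.
have [sg _] := stop_sigma; have := sg w; case: (sigma w) h => [r| |] //=.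
  case: ifP => [_ h _|/negbT]; first by rewrite lee_fin.
  by rewrite -ltNge !lte_fin => tr _ _; rewrite lee_fin; exact: le_trans ut (ltW tr).
by move=> _ _; rewrite leey.
Qed.

Let rNs w : Om w -> forall u, s <= u -> u < t -> Ns x w @[x --> u^'+] --> Ns u w.
Proof.
move=> Ow u su ut; rewrite /Ns /stopped.
have [us|su'] := ltP u%:E (sigma w); last first.
  apply: cvg_near_cst; apply/near_rightP.
  by exists t => // y /andP[uy _]; rewrite min_r// (le_trans su')// lee_fin ltW.
apply: cvg_trans (N_rc (reg Ow) su ut); apply: near_eq_cvg; apply/near_rightP.
case: (sigma w) us => [r| |] // us.
  by exists r => // y /andP[uy yr]; rewrite min_l// lee_fin ltW.
by exists t => // y _; rewrite min_l// leey.
Qed.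

Let iNs u : s <= u -> u <= t -> intg (Ns u).
Proof. by move=> su ut; have [_ i _] := mN; apply: i; exact: tm. Qed.

Let mart X : martingale T F P X -> forall u v, s <= u -> u <= v -> v <= t ->
  forall B, F u%:E B -> E B (X u%:E) = E B (X v%:E).
Proof.
move=> [_ iX EX] u v su uv vt B FB.
have ut := le_trans uv vt; have sv := le_trans su uv.
have uv' : (u%:E <= v%:E)%E by rewrite lee_fin.
have sub : F u%:E `<=` measurable by move=> C; exact: mF.
have /(cond_exp_E _ sub (iX _ (tm sv vt)))[_ _] := EX _ _ (tm su ut) (tm sv vt) uv'.
exact.
Qed.

Let optional_N u v : s <= u -> u < v -> v <= t ->
  intg (stopped_after u v Ns tau) /\
  forall B, F u%:E B -> E B (stopped_after u v Ns tau) = E (B `&` [set w | u < tau w]) (Ns u).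
Proof.
move=> su uv vt; have filuv := filtration_sub filF su (ltW uv) vt.
have [aN _ _] := mN.
have [i1 e1] : intg (stopped_after u v Ns tau) /\ forall B, F u%:E B ->
    E B (stopped_after u v Ns tau) = E (B `&` [set w | u < tau w]) (Ns v).
  apply: (optional_stopping uv filuv).
  - by move=> x ux xv; apply: aN; apply: tm; [exact: le_trans ux|exact: le_trans vt].
  - apply: filterS aeOm => w Ow x ux xv.
    by apply: (rNs Ow); [exact: le_trans ux|exact: lt_le_trans vt].
  - by move=> x ux xv; apply: htau; [exact: le_trans ux|exact: le_trans vt].
  - by move=> x ux xv; apply: iNs; [exact: le_trans ux|exact: le_trans vt].
  - by move=> x ux xv B FB; apply: (mart mN) => //; exact: le_trans ux.
split => // B FB; rewrite e1//; symmetry; apply: (mart mN) => //; first exact: ltW.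
have ut := le_trans (ltW uv) vt.
by apply: salgebraI => //; [exact: salF|exact: (stopping_gt filF)].
Qed.

Let a' u := stopped_after s u a tau.
Let m' u := stopped_after s u m tau.
Let j u := (fun w => 2 * Gam w) \_ [set w | s < tau w /\ tau w <= u].

Let jE u w : s < tau w -> tau w <= u -> j u w = 2 * Gam w.
Proof. by move=> h1 h2; rewrite /j patchE mem_set. Qed.

Let jN u w : ~ (s < tau w /\ tau w <= u) -> j u w = 0.
Proof. by move=> h; rewrite /j patchE memNset. Qed.

Let Gam20 w : 0 <= 2 * Gam w. Proof. by rewrite mulr_ge0. Qed.

(* the jump of the variation at the stopping time is a jump of D, and D is there
   the difference of G and of a stopped martingale *)
Let intg_m' : intg (m' t).
Proof.
have [i1 _] := optional_N (lexx s) st (lexx t).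
have i2 : intg (fun w => 2 * lvl + 1 + 2 * Gam w +
    `|stopped_after s t Ns tau w| + `|Ns s w|).
  apply: intgD; last by apply: intg_norm; apply: iNs => //; exact: ltW.
  apply: intgD; last exact: intg_norm.
  by apply: intgD; [exact: intg_cst|exact: intgZ].
apply: (intg_le _ i2).
  apply: (measurable_wrt_measurable _ (adapted_stopped st filF htau im (adapted_increment aDm) (ltW st) (lexx t))).
  by move=> B; exact: (mF (ltW st) (lexx t)).
apply: aeW => w; apply: le_trans (ler_norm _).
have pos : 0 <= 2 * lvl + 1 + 2 * Gam w + `|stopped_after s t Ns tau w| + `|Ns s w|.
  have := Gam0 w; have := normr_ge0 (stopped_after s t Ns tau w); have := normr_ge0 (Ns s w).
  by have := lvl0; lra.
have [h|h] := ltP s (tau w); last by rewrite /m' stopped_after_never// normr0.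
have [Ow|nOw] := pselect (Om w); last first.
  by rewrite /m' /stopped_after patchE mem_set//= /m increment0// normr0.
rewrite /m' /stopped_after !patchE !mem_set//=.
set u := Num.min t (tau w).
have su : s < u by rewrite lt_min st.
have ut : u <= t by rewrite ge_min lexx.
have utau : u <= tau w by rewrite ge_min lexx orbT.
have rw := reg Ow.
have [r [r0 ru hr]] : exists r, [/\ 0 < r, r < u & forall c, r <= c -> c < u ->
    (total_variation c u (fun x => D x%:E w) <= (`|D u%:E w - D c%:E w| + 1)%:E)%E].
  apply: total_variation_jump => //; first exact: le_lt_trans su.
  by rewrite (D_var rw) ?ltry// ltW.
pose c := Num.max r s.
have rc : r <= c by rewrite le_max lexx.
have sc : s <= c by rewrite le_max lexx orbT.
have cu : c < u by rewrite gt_max ru su.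
have ct : c <= t := le_trans (ltW cu) ut.
have := hr c rc cu.
have := total_variationD (fun x => D x%:E w) (le_trans s0 sc) (ltW cu).
rewrite !(D_var rw)// ?(ltW su)// => hV hTV.
have {hV hTV} hV : Dp u%:E w + Dm u%:E w <= Dp c%:E w + Dm c%:E w + (`|D u%:E w - D c%:E w| + 1).
  by rewrite -lee_fin hV [leRHS]EFinD; exact: leeD2l.
have hlvl := tau_v0 sc ct (lt_le_trans cu utau).
rewrite /v0 /p /m !incrementE// in hlvl *.
have Dc := D_eq rw sc ct; have Ds := D_eq rw (lexx s) (ltW st).
have pc := Dp_nd rw (lexx s) sc ct; have mc := Dm_nd rw (lexx s) sc ct.
have pu := Dp_nd rw (lexx s) (ltW su) ut; have mu := Dm_nd rw (lexx s) (ltW su) ut.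
have Gu := G_eq rw (ltW su) ut; have Gs := G_eq rw (lexx s) (ltW st).
have bu := G_bd rw (ltW su) ut; have bs := G_bd rw (lexx s) (ltW st).
rewrite (NsE ut utau) (NsE (ltW st) (ltW h)) ger0_norm ?subr_ge0//.
have {bu} : `|D u%:E w| <= Gam w + `|N u%:E w|.
  rewrite (_ : D u%:E w = G u%:E w - N u%:E w); last by rewrite Gu; lra.
  by apply: le_trans (ler_normB _ _) _; rewrite lerD2r.
have {bs} : `|D s%:E w| <= Gam w + `|N s%:E w|.
  rewrite (_ : D s%:E w = G s%:E w - N s%:E w); last by rewrite Gs; lra.
  by apply: le_trans (ler_normB _ _) _; rewrite lerD2r.
have dc : `|D c%:E w - D s%:E w| <= lvl by rewrite ler_norml; apply/andP; split; lra.
have := ler_normD (D c%:E w - D s%:E w) (D s%:E w); rewrite subrK.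
have := ler_normB (D u%:E w) (D c%:E w).
lra.
Qed.

Let superS : [/\ adapted T F S, integrable_process T P S &
      forall r v, times T r -> times T v -> (r <= v)%E ->
        forall B, F r B -> E B (S v) <= E B (S r)].
Proof. by apply/(supermartingaleP usualF); have [_] := snellS. Qed.

Let iS u : s <= u -> u <= t -> intg (S u%:E).
Proof. by move=> su ut; have [_ i _] := superS; apply: i; exact: tm. Qed.

Let iM u : s <= u -> u <= t -> intg (M u%:E).
Proof. by move=> su ut; have [_ i _] := mM; apply: i; exact: tm. Qed.

Let intg_a' : intg (a' t).
Proof.
have st' := ltW st.
have i2 := intgB (intgB (iM st' (lexx t)) (iS st' (lexx t))) (intgB (iM (lexx s) st') (iS (lexx s) st')).
apply: (intg_le _ i2).
  apply: (measurable_wrt_measurable _ (adapted_stopped st filF htau ia (adapted_increment aA) st' (lexx t))).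
  by move=> B; exact: (mF (ltW st) (lexx t)).
apply: filterS aeOm => w Ow; have rw := reg Ow.
have := S_eq rw st' (lexx t); have := S_eq rw (lexx s) st' => -> ->.
have [_ nd _] := ia.
apply: le_trans (ler_norm _); rewrite ger0_norm; last first.
  by rewrite /a' (path_ge0 _ (increasing_stopped tau ia)).
apply: (@le_trans _ _ (a t w)); last by rewrite /a incrementE//; lra.
have [h|h] := ltP s (tau w); last by rewrite /a' stopped_after_never// (path_ge0 _ ia).
rewrite /a' /stopped_after patchE mem_set//; apply: nd => //.
  by rewrite le_min st' ltW.
by rewrite ge_min lexx.
Qed.

Let inc_a' : increasing_process P s t a'.
Proof. exact: (increasing_process_stopped st filF htau ia (adapted_increment aA)). Qed.

Let inc_m' : increasing_process P s t m'.
Proof. exact: (increasing_process_stopped st filF htau im (adapted_increment aDm)). Qed.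

Let F_tau_gt u : s <= u -> u <= t -> F u%:E [set w | u < tau w].
Proof. by move=> su ut; exact: (stopping_gt filF). Qed.

Let F_tau_in u : s <= u -> u <= t -> F u%:E [set w | s < tau w /\ tau w <= u].
Proof.
move=> su ut; rewrite (_ : mkset _ = [set w | s < tau w] `&` [set w | tau w <= u])//.
apply: salgebraI; [exact: salF| |exact: htau].
by apply: (monoF (lexx s) su ut); exact: (F_tau_gt (lexx s) (ltW st)).
Qed.

Let intg_j u : s <= u -> u <= t -> intg (j u).
Proof.
move=> su ut; apply: intg_restrict; last exact: intgZ.
by apply: (mF su ut); exact: F_tau_in.
Qed.

Let inc_j : increasing_process P s t j.
Proof.
split.
- by move=> w; rewrite jN// => -[h1 h2]; have := lt_le_trans h1 h2; rewrite ltxx.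
- move=> w u v su uv vt; have [[h1 h2]|h] := pselect (s < tau w /\ tau w <= u).
    by rewrite !jE// (le_trans h2).
  rewrite (jN h); have [[h1 h2]|h'] := pselect (s < tau w /\ tau w <= v); first by rewrite jE.
  by rewrite jN.
- move=> w u su ut; have [[h1 h2]|h] := pselect (s < tau w /\ tau w <= u).
    rewrite jE//; apply: cvg_near_cst; apply/near_rightP; exists t => // y /andP[uy _].
    by rewrite jE// (le_trans h2)// ltW.
  rewrite (jN h); have [h1|h1] := ltP s (tau w); last first.
    apply: cvg_near_cst; apply: nearW => y; rewrite jN// => -[h2 _].
    by have := lt_le_trans h2 h1; rewrite ltxx.
  have [h2|h2] := leP (tau w) u; first by exfalso; apply: h.
  apply: cvg_near_cst; apply/near_rightP; exists (tau w) => // y /andP[_ yt].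
  by rewrite jN// => -[_]; rewrite leNgt yt.
- by move=> u su ut; apply: intg_measurable; exact: intg_j.
- exact: intg_j (ltW st) (lexx t).
Qed.

Section one_step.
Variables u v : R.
Hypotheses (su : s <= u) (uv : u < v) (vt : v <= t).

Let jv := (fun w => 2 * Gam w) \_ [set w | tau w <= v].

Let sv : s <= v. Proof. exact: le_trans (ltW uv). Qed.
Let ut : u <= t. Proof. exact: le_trans (ltW uv) vt. Qed.

Let jv_ge0 w : 0 <= jv w.
Proof. by rewrite /jv patchE; case: ifP. Qed.

Let ijv : intg jv.
Proof. by apply: intg_restrict; [exact: (mF sv vt (htau sv vt))|exact: intgZ]. Qed.

Let im'_ x : s <= x -> x <= t -> intg (m' x).
Proof. by move=> sx xt; exact: (increasing_process_intg st inc_m'). Qed.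

Let Y w := S v%:E w + jv w + m' v w.

Let iY : intg Y.
Proof. by apply: intgD; [apply: intgD; [exact: iS|exact: ijv]|exact: im'_]. Qed.

Let iG x : s <= x -> x <= t -> intg (G x%:E).
Proof.
move=> sx xt; have [aG _] := cG; apply: (intg_le _ iGam).
  by apply: (measurable_wrt_measurable _ (aG _ (tm sx xt))) => B; exact: mF.
apply: filterS aeOm => w Ow; rewrite (ger0_norm (Gam0 w)); exact: (G_bd (reg Ow)).
Qed.

(* the obstacle is below the competitor in mean: after [stop] because of the
   term [2 Gam], before it by optional stopping of N *)
Let G_le_competitor x : u <= x -> x < v -> forall B, F x%:E B ->
  E B (G x%:E) <= E B (fun w => Y w - m' x w).
Proof.
move=> ux xv B FB; have sx := le_trans su ux; have xt := le_trans (ltW xv) vt.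
have FC := F_tau_gt sx xt; set C := mkset _ in FC.
have mB := mF sx xt FB; have mC := mF sx xt FC.
have FBC := salgebraI (salF sx xt) FB FC.
have mBC := mF sx xt FBC; have mBD := mF sx xt (salgebraD (salF sx xt) FB FC).
have iGx := iG sx xt; have iYx := intgB iY (im'_ sx xt).
rewrite (E_split iGx mB mC) (E_split iYx mB mC) lerD//; last first.
  apply: E_le_ae => //; apply: filterS aeOm => w Ow [_ /negP nC].
  have tx : tau w <= x by rewrite leNgt.
  have rw := reg Ow.
  have jvE : jv w = 2 * Gam w by rewrite /jv patchE mem_set//= (le_trans tx)// ltW.
  have [_ nd _] := increasing_stopped tau im; have := nd w _ _ sx (ltW xv) vt.
  have := S_ge rw sv vt; have := G_bd rw sv vt; have := G_bd rw sx xt.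
  rewrite !ler_norml /Y jvE /m' => /andP[_ h1] /andP[h2 _]; lra.
have [i1 e1] := optional_N sx xv vt.
have e2 : E (B `&` C) (stopped_after x v Ns tau) = E (B `&` C) (Ns x).
  by rewrite e1// -setIA setIid.
have iN := iNs sx xt.
rewrite -subr_ge0 -E_B//; apply: (@le_trans _ _ (E (B `&` C) (fun w => stopped_after x v Ns tau w - Ns x w))).
  by rewrite E_B// e2 subrr.
apply: E_le_ae => //; [exact: intgB|exact: intgB|].
apply: filterS aeOm => w Ow [_ xtau]; have rw := reg Ow; rewrite /C /= in xtau.
have stau := le_lt_trans sx xtau.
set y := Num.min v (tau w).
have xy : x <= y by rewrite le_min !ltW.
have sy := le_trans sx xy.
have yt : y <= t by rewrite ge_min vt.
have ytau : y <= tau w by rewrite ge_min lexx orbT.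
have -> : stopped_after x v Ns tau w = N y%:E w.
  by rewrite /stopped_after patchE mem_set//= -/y NsE.
have -> : Ns x w = N x%:E w by rewrite NsE// ltW.
have -> : m' x w = Dm x%:E w - Dm s%:E w.
  by rewrite /m' stopped_after_before// ?ltW// /m incrementE.
have m'v : m' v w = Dm y%:E w - Dm s%:E w.
  by rewrite /m' /stopped_after patchE mem_set//= -/y /m incrementE.
have SY : G y%:E w <= S v%:E w + jv w.
  have [vtau|tauv] := ltP v (tau w).
    have yv : y = v by rewrite /y min_l// ltW.
    by rewrite yv -[leLHS]addr0; apply: lerD; [exact: (S_ge rw)|exact: jv_ge0].
  have jvE : jv w = 2 * Gam w by rewrite /jv patchE mem_set.
  have := S_ge rw sv vt; have := G_bd rw sv vt; have := G_bd rw sy yt.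
  rewrite !ler_norml jvE => /andP[_ h1] /andP[h2 _]; lra.
have := G_eq rw sx xt; have := G_eq rw sy yt.
have := D_eq rw sx xt; have := D_eq rw sy yt; have := Dp_nd rw sx xy yt.
rewrite /Y m'v; lra.
Qed.

Let snell_step B : F u%:E B -> E B (S u%:E) <= E B (fun w => Y w - m' u w).
Proof.
have u0 : 0 <= u := le_trans s0 su.
have vT : (v%:E <= T)%E by apply: le_trans tT; rewrite lee_fin.
have [z0 nd rc] := increasing_stopped tau im.
apply: (snell_le usualF cG snellS u0 uv vT iY).
- move=> x ux xv; apply: (adapted_stopped st filF htau im (adapted_increment aDm)).
    exact: le_trans ux.
  exact: le_trans vt.
- by move=> x ux xv; apply: im'_; [exact: le_trans ux|exact: le_trans vt].
- apply: aeW => w x y ux xy yv; apply: nd => //; first exact: le_trans ux.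
  exact: le_trans vt.
- apply: filterS aeOm => w Ow; split=> x ux xv.
    by apply: rc; [exact: le_trans ux|exact: lt_le_trans vt].
  have sx := le_lt_trans su ux; have xt := le_trans xv vt.
  apply: stopped_after_left_limit => //.
  have /cvg_ex[l hl] := Dm_ll (reg Ow) sx xt.
  apply: (cvgP (l - Dm s%:E w)); rewrite (_ : (fun y => m y w) = fun y => Dm y%:E w - Dm s%:E w).
    by apply: cvgB; [exact: hl|exact: cvg_cst].
  by apply/funext => y; rewrite /m incrementE.
- by move=> x ux xv; apply: iG; [exact: le_trans ux|exact: ltW (lt_le_trans xv vt)].
- by apply: aeW => w; rewrite /Y addrAC lerDl.
- exact: G_le_competitor.
Qed.

(** Before [stop] the martingale [M] turns the increase of [A] into the decrease
    of [S], which is bounded by comparison with the competitor. *)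
Lemma increment_le B : F u%:E B -> E B (fun w => a' v w - a' u w) <=
  E B (fun w => m' v w - m' u w + (j v w - j u w)).
Proof.
move=> FB; have FC := F_tau_gt su ut; set C := mkset _ in FC.
have mB := mF su ut FB; have mC := mF su ut FC.
have FBC := salgebraI (salF su ut) FB FC.
have mBC := mF su ut FBC; have mBD := mF su ut (salgebraD (salF su ut) FB FC).
have ia'_ x : s <= x -> x <= t -> intg (a' x).
  by move=> sx xt; exact: (increasing_process_intg st inc_a').
have i1 := intgB (ia'_ v sv vt) (ia'_ u su ut).
have i2 := intgD (intgB (im'_ sv vt) (im'_ su ut)) (intgB (intg_j sv vt) (intg_j su ut)).
have [_ ndj _ _ _] := inc_j; have [_ ndm _ _ _] := inc_m'; have [_ nda _] := ia.
rewrite (E_split i1 mB mC) (E_split i2 mB mC) lerD//; last first.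
  apply: E_le => // w [_ /negP nC]; have tu : tau w <= u by rewrite leNgt.
  have tv : tau w <= v := le_trans tu (ltW uv).
  have -> : a' v w = a' t w by exact: stopped_after_const.
  have -> : a' u w = a' t w by exact: stopped_after_const.
  rewrite subrr.
  by rewrite addr_ge0// subr_ge0; [exact: ndm (ltW uv) vt|exact: ndj (ltW uv) vt].
have iMS x : s <= x -> x <= t -> intg (fun w => M x%:E w - S x%:E w).
  by move=> sx xt; apply: intgB; [exact: iM|exact: iS].
apply: (@le_trans _ _ (E (B `&` C) (fun w => (M v%:E w - S v%:E w) - (M u%:E w - S u%:E w)))).
  apply: E_le_ae => //; first by apply: intgB; exact: iMS.
  apply: filterS aeOm => w Ow [_ utau]; rewrite /C /= in utau; have rw := reg Ow.
  have stau := le_lt_trans su utau.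
  rewrite (S_eq rw sv vt) (S_eq rw su ut).
  have : a' v w <= a v w.
    rewrite /a' /stopped_after patchE mem_set//; apply: nda => //.
      by rewrite le_min sv ltW.
    by rewrite ge_min lexx.
  have -> : a' u w = A u%:E w - A s%:E w.
    by rewrite /a' stopped_after_before// ?ltW// /a incrementE.
  rewrite /a incrementE//; lra.
have iMu := iM su ut; have iMv := iM sv vt; have iSu := iS su ut; have iSv := iS sv vt.
have eM := mart mM su (ltW uv) vt FBC.
rewrite E_B//; [|exact: iMS|exact: iMS]; rewrite !E_B// -eM.
have := snell_step FBC.
have -> : E (B `&` C) (fun w => Y w - m' u w) =
    E (B `&` C) (S v%:E) + E (B `&` C) (fun w => m' v w - m' u w + (j v w - j u w)).
  rewrite -E_D//; apply: eq_Rintegral => w /set_mem[_ utau]; rewrite /C /= in utau.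
  have -> : j v w - j u w = jv w.
    rewrite (jN (u := u)) ?subr0; last by move=> [_]; rewrite leNgt utau.
    have stau := le_lt_trans su utau.
    have [tv|vt'] := leP (tau w) v; first by rewrite jE// /jv patchE mem_set.
    rewrite jN; last by move=> [_]; rewrite leNgt vt'.
    by rewrite /jv patchE memNset//= => h; move: vt'; rewrite ltNge h.
  by rewrite /Y; lra.
lra.
Qed.

End one_step.

Let FtoFs B : F 0%E B -> F s%:E B. Proof. exact: F0 (lexx s) (ltW st). Qed.

(* twice Dm is the variation of D minus the increase of D *)
Let predictable_gap c :
  <<s predictable_algebra s t (fun u => F u%:E) >>
    [set z | [/\ s < z.1, z.1 <= t, z.1 <= tau z.2 & m' z.1 z.2 - a' z.1 z.2 <= c]].
Proof.
pose gT := g_sigma_algebraType (predictable_algebra s t (fun u => F u%:E)).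
pose V u w := Dp u%:E w + Dm u%:E w.
pose K (z : gT) := (V z.1 z.2 - (D z.1%:E z.2 - D 0%E z.2)) / 2 - Dm s%:E z.2 -
  (A z.1%:E z.2 - A s%:E z.2).
have sal := salF (lexx s) (ltW st).
have mS := predictable_slab st filF.
have mOm := predictable_section st filF (FtoFs FOm).
have mnOm := predictable_section st filF (salgebraC sal (FtoFs FOm)).
have mtau := predictable_until st filF htau.
set SO := slab s t `&` _ in mOm.
have mX X : measurable_wrt (F s%:E) X -> measurable_fun (SO : set gT) (fun z : gT => X z.2).
  move=> hX; apply: (measurable_funS mS (@subIsetl _ _ _)).
  by move=> _ C mC; exact: (predictable_section st filF (hX C mC)).
have mP X : predictable T F X -> measurable_fun (SO : set gT) (fun z : gT => X z.1%:E z.2).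
  move=> pX; apply: (measurable_funS mS (@subIsetl _ _ _)).
  exact: (measurable_predictable usualF s0 st tT pX).
have mV : measurable_fun (SO : set gT) (fun z : gT => V z.1 z.2).
  apply: (predictable_of_left st filF (X := fun u => D u%:E) (FtoFs FOm)).
  - by move=> u su ut; exact: aD (tm su ut).
  - move=> u su ut; apply: measurable_wrtD; [exact: salF|exact: aDp (tm su ut)|exact: aDm (tm su ut)].
  - exact: (measurable_predictable usualF s0 st tT pD).
  - move=> w Ow u su ut; apply: (variation_grid_left (a := 0) (f := fun x => D x%:E w) (V := fun x => V x w) st s0 su ut).
    by move=> v sv vt; exact: (D_var (reg Ow)).
have mK : measurable_fun (SO : set gT) K.
  apply: measurable_funB; last first.
    apply: measurable_funB; first exact: mP.
    by apply: mX; exact: aA (tm (lexx s) (ltW st)).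
  apply: measurable_funB; last by apply: mX; exact: aDm (tm (lexx s) (ltW st)).
  apply: measurable_funM; last exact: measurable_cst.
  apply: measurable_funB => //; apply: measurable_funB; first exact: mP.
  apply: mX => B mB; apply: FtoFs; apply: aD => //; split => //.
  by apply: le_trans tT; rewrite lee_fin (le_trans s0)// ltW.
rewrite (_ : mkset _ = (slab s t `&` [set z | z.1 <= tau z.2]) `&`
    ((SO `&` K @^-1` `]-oo, c]) `|`
     (slab s t `&` [set z | (~` Om) z.2] `&` [set z | 0 <= c]))); last first.
  have gapO z : Om z.2 -> s < z.1 -> z.1 <= t -> z.1 <= tau z.2 ->
      m' z.1 z.2 - a' z.1 z.2 = K z.
    move=> Ow sz zt ztau; have stau := lt_le_trans sz ztau.
    rewrite /m' /a' !stopped_after_before// /m /a !incrementE// /K /V.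
    have := D_eq (reg Ow) (ltW sz) zt; lra.
  have gapN z : ~ Om z.2 -> s < z.1 -> z.1 <= tau z.2 -> m' z.1 z.2 - a' z.1 z.2 = 0.
    move=> nO sz ztau; have stau := lt_le_trans sz ztau.
    by rewrite /m' /a' !stopped_after_before// /m /a !increment0// subrr.
  apply/seteqP; split => z /=.
    move=> [sz zt ztau]; have [Ow|nO] := pselect (Om z.2).
      rewrite gapO// => h; split; first by split.
      by left; split; [split|rewrite in_itv].
    rewrite gapN// => h; split; first by split.
    by right; split; [split|].
  move=> [[[sz zt] ztau]] [[[_ Ow]]|[[_ nO] h]]; last by split => //; rewrite gapN.
  by rewrite in_itv /= => h; split => //; rewrite gapO.
apply: (@measurableI _ gT); first exact: mtau.
apply: (@measurableU _ gT); first exact: mK.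
have [c0|c0] := leP 0 c.
  by rewrite (_ : [set z : gT | true] = setT) ?setIT//; apply/seteqP; split.
rewrite (_ : [set z : gT | false] = set0) ?setI0//; last by apply/seteqP; split.
Qed.

Lemma stop_estimate : E setT (fun w => clip_potential (m' t w - a' t w)) <= E setT (j t).
Proof.
apply: (stopped_domination st filF inc_a' inc_m' inc_j _ (tau := tau)).
- move=> u v su; rewrite le_eqVlt => /orP[/eqP <- ut B FB|uv vt B FB]; last exact: increment_le.
  rewrite (_ : (fun w => a' u w - a' u w) = fun=> 0); last by apply/funext => w; rewrite subrr.
  rewrite (_ : (fun w => _ + _) = fun=> 0)//; by apply/funext => w; rewrite !subrr addr0.
- by move=> w y sy yt h; exact: stopped_after_const.
- by move=> w y sy yt h; exact: stopped_after_const.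
- move=> w y sy yt h; have [h1|h1] := ltP s (tau w); first by rewrite !jE// (le_trans h).
  by rewrite !jN// => -[]; rewrite ltNge h1.
- exact: predictable_gap.
Qed.

Let g w := Num.min 1 (clip_potential (m t w - a t w)).

(** The same estimate for [m - a] at time [t] itself.  The minimum with [1] bounds
    the left-hand side whatever [lvl] is, while [m] at [t] need not be
    integrable. *)
Lemma gap_estimate :
  E setT (g \_ [set w | t < tau w]) <= E setT ((fun w => 2 * Gam w) \_ [set w | tau w <= t]).
Proof.
have st' := ltW st.
apply: (@le_trans _ _ (E setT (fun w => clip_potential (m' t w - a' t w)))).
  have i1 : intg (fun w => clip_potential (m' t w - a' t w)).
    have i2 := intgB intg_m' intg_a'.
    apply: (intg_le _ i2).
      by apply: measurableT_comp; [exact: measurable_clip_potential|exact: intg_measurable i2].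
    by apply: aeW => w; rewrite ger0_norm ?clip_potential_ge0 ?clip_potential_le.
  have mg : measurable_fun setT g.
    apply: measurable_minr => //; apply: measurableT_comp; first exact: measurable_clip_potential.
    apply: measurable_funB.
      apply: (measurable_wrt_measurable _ (adapted_increment aDm st' (lexx t))) => B.
      exact: (mF st' (lexx t)).
    apply: (measurable_wrt_measurable _ (adapted_increment aA st' (lexx t))) => B.
    exact: (mF st' (lexx t)).
  have mt' : measurable [set w | t < tau w] by apply: (mF st' (lexx t)); exact: F_tau_gt.
  have ig : intg (g \_ [set w | t < tau w]).
    apply: intg_restrict => //; apply: (@intg_bounded _ _ _ _ _ 1) => //.
    apply: aeW => w; rewrite ger0_norm; last by rewrite le_min ler01 clip_potential_ge0.
    by rewrite ge_min lexx.
  apply: E_le => // w _; rewrite patchE; case: ifPn => [/set_mem /= h|_]; last exact: clip_potential_ge0.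
  have stau := lt_trans st h.
  rewrite /m' /a' !stopped_after_before//; try exact: ltW.
  by rewrite /g ge_min lexx orbT.
apply: le_trans stop_estimate _; apply: E_le => //; first exact: intg_j st' (lexx t).
  by apply: intg_restrict; [exact: (mF st' (lexx t) (htau st' (lexx t)))|exact: intgZ].
move=> w _; have [[h1 h2]|h] := pselect (s < tau w /\ tau w <= t).
  by rewrite jE// patchE mem_set.
by rewrite jN// patchE; case: ifP.
Qed.

End estimate.

(** * Almost sure comparison of the increments *)
Section drift.
Context {R : realType} {d : measure_display} {Omega : measurableType d}.
Variable P : probability Omega R.

Local Notation intg X := (P.-integrable [set: Omega] (EFin \o X)).
Local Notation E := (Rintegral P).

Variables (T : \bar R) (F : \bar R -> set (set Omega)).
Variables (G N D Dp Dm S M A : \bar R -> Omega -> R).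
Hypothesis usualF : usual_filtration T F P.
Hypothesis cG : cadlag_process T F P G.
Hypothesis S1G : in_S1 T P G.
Hypothesis decG : canonical_decomposition T F P G N D.
Hypothesis varD : variation_components T F P D Dp Dm.
Hypothesis snellS : snell_envelope T F P G S.
Hypothesis decS : doob_meyer_decomposition T F P S M A.

Section interval.
Variables s t : R.
Hypotheses (s0 : 0 <= s) (st : s < t) (tT : (t%:E <= T)%E).

Let ft u : s <= u -> u <= t -> finite_times T u.
Proof.
move=> su ut; split; first exact: le_trans su.
by apply: le_trans tT; rewrite lee_fin.
Qed.

Let ltT u : u < t -> (u%:E < T)%E.
Proof. by move=> ut; apply: lt_le_trans tT; rewrite lte_fin. Qed.

Lemma ae_regular_outcome (Gam : Omega -> R) :
  (\forall w \ae P, forall u, 0 <= u -> u <= t -> `|G u%:E w| <= Gam w) ->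
  \forall w \ae P, regular_outcome s t G N D Dp Dm S M A Gam w.
Proof.
move=> GGam.
have [[cN _] _ [[cD _] _] fvD GND] := decG.
have [cDp cDm iDp iDm eD] := varD.
have [cS superS dS _] := snellS.
have [_ _ [cA _] iA [_ SMA]] := decS.
have [_ rN] := cN; have [_ rDp] := cDp; have [_ rDm] := cDm; have [_ rA] := cA.
near=> w.
have h1 : forall u, 0 <= u -> u <= t -> `|G u%:E w| <= Gam w by near: w.
have h2 : forall r, finite_times T r -> G r%:E w = N r%:E w + D r%:E w by near: w.
have h3 : forall r r', finite_times T r -> finite_times T r' -> r <= r' ->
  Dp r%:E w <= Dp r'%:E w by near: w.
have h4 : forall r r', finite_times T r -> finite_times T r' -> r <= r' ->
  Dm r%:E w <= Dm r'%:E w by near: w.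
have h5 : forall r r', finite_times T r -> finite_times T r' -> r <= r' ->
  A r%:E w <= A r'%:E w by near: w.
have h6 : forall r, finite_times T r -> D r%:E w - D 0%E w = Dp r%:E w - Dm r%:E w /\
  path_variation D w r = (Dp r%:E w + Dm r%:E w)%:E by near: w.
have h7 : forall u, times T u -> G u w <= S u w by near: w.
have h8 : forall r, finite_times T r -> S r%:E w = M r%:E w - A r%:E w by near: w.
have c1 : forall r : R, finite_times T r ->
    ((r%:E < T)%E -> N x%:E w @[x --> r^'+] --> N r%:E w) /\
    (0 < r -> cvg (N x%:E w @[x --> r^'-])) by near: w.
have c2 : forall r : R, finite_times T r ->
    ((r%:E < T)%E -> Dp x%:E w @[x --> r^'+] --> Dp r%:E w) /\
    (0 < r -> cvg (Dp x%:E w @[x --> r^'-])) by near: w.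
have c3 : forall r : R, finite_times T r ->
    ((r%:E < T)%E -> Dm x%:E w @[x --> r^'+] --> Dm r%:E w) /\
    (0 < r -> cvg (Dm x%:E w @[x --> r^'-])) by near: w.
have c4 : forall r : R, finite_times T r ->
    ((r%:E < T)%E -> A x%:E w @[x --> r^'+] --> A r%:E w) /\
    (0 < r -> cvg (A x%:E w @[x --> r^'-])) by near: w.
have ft2 u v : s <= u -> u <= v -> v <= t -> finite_times T u /\ finite_times T v.
  by move=> su uv vt; split; apply: ft => //; [exact: le_trans vt|exact: le_trans uv].
split.
- by move=> u v su uv vt; have [hu hv] := ft2 u v su uv vt; exact: h5.
- by move=> u su ut; have [h _] := c4 u (ft su (ltW ut)); apply: h; exact: ltT.
- by move=> u v su uv vt; have [hu hv] := ft2 u v su uv vt; exact: h3.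
- by move=> u su ut; have [h _] := c2 u (ft su (ltW ut)); apply: h; exact: ltT.
- by move=> u v su uv vt; have [hu hv] := ft2 u v su uv vt; exact: h4.
- by move=> u su ut; have [h _] := c3 u (ft su (ltW ut)); apply: h; exact: ltT.
- by move=> u su ut; have [_ h] := c3 u (ft (ltW su) ut); apply: h; exact: le_lt_trans su.
- by move=> u su ut; have [h _] := c1 u (ft su (ltW ut)); apply: h; exact: ltT.
- by move=> u su ut; apply: h2; exact: ft.
- by move=> u su ut; have [] := h6 u (ft su ut).
- by move=> u su ut; have [] := h6 u (ft su ut).
- by move=> u su ut; apply: h8; exact: ft.
- by move=> u su ut; apply: h7; have [u0 uT] := ft su ut; split.
- by move=> u su ut; apply: h1 => //; exact: le_trans su.
Unshelve. all: by end_near.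
Qed.

(** For almost every path the stopping time is beyond [t] once its level is large.
    So the left-hand sides of the estimates tend to the mean of a nonnegative
    variable, and the right-hand sides to 0, by dominated convergence. *)
Lemma drift_increment_le :
  \forall w \ae P, A t%:E w - A s%:E w <= Dm t%:E w - Dm s%:E w.
Proof.
have [Gam [iGam Gam0 GGam]] := in_S1_bound usualF cG S1G (le_trans s0 (ltW st)) tT.
have [[_ [sigma [stop_sigma up_sigma] mN]] _ [[aD _] pD] _ _] := decG.
have [[aDp _] [aDm _] _ _ _] := varD.
have [[_ [mM _]] _ [[aA _] pA] _ _] := decS.
have filF := usual_interval_filtration usualF s0 (ltW st) tT.
have [sal0 sub0] : sigma_algebra setT (F 0%E) /\ F 0%E `<=` measurable.
  have [+ _ _ _] := usualF; apply; split => //; apply: le_trans tT.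
  by rewrite lee_fin (le_trans s0)// ltW.
pose Om := [set w | regular_outcome s t G N D Dp Dm S M A Gam w /\ sigma n w @[n --> \oo] --> +oo%E].
have aeOm : \forall w \ae P, Om w.
  by apply: filterS2 (ae_regular_outcome GGam) up_sigma => w h1 [_ h2]; split.
have FOm : F 0%E Om.
  rewrite -[Om]setCK; apply: salgebraC => //.
  by have [_ _ _ nF] := usualF; apply: nF; exact: aeOm.
have reg w : Om w -> regular_outcome s t G N D Dp Dm S M A Gam w by case.
have lvl0 n : 0 < n.+1%:R :> R by [].
have est n := gap_estimate usualF s0 st tT FOm aeOm reg aA aDp aDm aD cG snellS mM pA pD
  iGam Gam0 (stop_sigma n) (mN n) (lvl0 n).
set m := increment s Om Dm in est; set a := increment s Om A in est.
set g := (fun w => Num.min 1 _) in est.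
pose tau n := stop s t Dp Dm Om (sigma n) n.+1%:R.
have late w : Om w -> \forall n \near \oo, t < tau n w.
  move=> Ow; have [_ /cvgeyPgt/(_ t) h1] := Ow.
  pose v := increment s Om Dp t w + increment s Om Dm t w.
  have h2 : \forall n \near \oo, v < n.+1%:R.
    by have := nbhs_infty_gtr v; apply: filterS => n /lt_le_trans; apply; rewrite ler_nat.
  near=> n; apply: (lt_stop usualF s0 st tT FOm reg aDp aDm (stop_sigma n) (lvl0 n)).
    by near: n.
  by near: n.
have st' := ltW st.
have mFt B : F t%:E B -> measurable B by have [+ _ _ _] := filF => /(_ _ st' (lexx t))[_]; exact.
have mg : measurable_fun setT g.
  apply: measurable_minr => //; apply: measurableT_comp; first exact: measurable_clip_potential.
  by apply: measurable_funB; apply: (measurable_wrt_measurable mFt);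
    apply: (adapted_increment usualF s0 st tT FOm).
have mtau n : measurable [set w | tau n w <= t].
  by apply: mFt; apply: (stop_stopping usualF s0 st tT FOm reg aDp aDm (stop_sigma n) (lvl0 n)).
have mtau' n : measurable [set w | t < tau n w].
  rewrite (_ : mkset _ = ~` [set w | tau n w <= t]); first exact: measurableC.
  by apply/seteqP; split => w /=; rewrite ltNge => /negP.
have g01 w : 0 <= g w <= 1.
  by rewrite /g le_min ler01 clip_potential_ge0 ge_min lexx.
have ig : intg g.
  apply: (@intg_bounded _ _ _ _ _ 1) => //; apply: aeW => w.
  by have /andP[g0 g1] := g01 w; rewrite ger0_norm.
have i2G : intg (fun w => 2 * Gam w) by exact: intgZ.
have c1 : E setT (g \_ [set w | t < tau n w]) @[n --> \oo] --> E setT g.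
  apply: (E_dominated_cvg (Y := fun=> 1)) => //.
  - move=> n; exact: (intg_measurable (intg_restrict (mtau' n) ig)).
  - exact: intg_cst.
  - apply: filterS aeOm => w Ow; apply: cvg_near_cst; apply: filterS (late w Ow) => n h.
    by rewrite patchE mem_set.
  - apply: aeW => w n; have /andP[g0 g1] := g01 w.
    by rewrite patchE; case: ifP => _; rewrite ?normr0// ger0_norm.
have c2 : E setT ((fun w => 2 * Gam w) \_ [set w | tau n w <= t]) @[n --> \oo] --> E setT (fun=> 0).
  apply: (E_dominated_cvg (Y := fun w => 2 * Gam w)) => //.
  - move=> n; exact: (intg_measurable (intg_restrict (mtau n) i2G)).
  - apply: filterS aeOm => w Ow; apply: cvg_near_cst; apply: filterS (late w Ow) => n h.
    by rewrite patchE memNset//= leNgt h.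
  - apply: aeW => w n; have G0 : 0 <= 2 * Gam w by rewrite mulr_ge0.
    by rewrite patchE; case: ifP => _; rewrite ?normr0// ger0_norm.
have Eg0 : E setT g <= 0.
  rewrite [leRHS](_ : 0 = E setT (fun=> 0)); last by rewrite E_cst// mul0r.
  by apply: ler_cvg_to c1 c2 _; exact: nearW est.
have g0 w : 0 <= g w by have /andP[] := g01 w.
apply: filterS2 aeOm (E_eq0_ae ig g0 Eg0) => w Ow.
rewrite /g /m /a !incrementE//; case: (leP 1 (clip_potential _)) => _.
  by move=> /eqP; rewrite oner_eq0.
by move=> /clip_potential_eq0; rewrite subr_ge0.
Unshelve. all: by end_near.
Qed.

End interval.

End drift.

Section drift_all_times.
Context {R : realType} {d : measure_display} {Omega : measurableType d}.
Variable P : probability Omega R.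
Variables (T : \bar R) (F : \bar R -> set (set Omega)).
Variables (G N D Dp Dm S M A : \bar R -> Omega -> R).
Hypothesis usualF : usual_filtration T F P.
Hypothesis cG : cadlag_process T F P G.
Hypothesis S1G : in_S1 T P G.
Hypothesis decG : canonical_decomposition T F P G N D.
Hypothesis varD : variation_components T F P D Dp Dm.
Hypothesis snellS : snell_envelope T F P G S.
Hypothesis decS : doob_meyer_decomposition T F P S M A.

(* q is replaced by T beyond T, so that these countably many times contain T *)
Let cap (q : rat) : R := if ((ratr q)%:E <= T)%E then ratr q else fine T.

(** The comparison extends from rational times by right-continuity; a finite [T]
    is one of the countably many times, since no time is to the right of it. *)
Lemma drift_le_all_times : (0 < T)%E -> \forall w \ae P, forall r r',
  finite_times T r -> finite_times T r' -> r <= r' ->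
  A r'%:E w - A r%:E w <= Dm r'%:E w - Dm r%:E w.
Proof.
move=> T0.
have h : \forall w \ae P, forall q : rat * rat, 0 <= cap q.1 -> cap q.1 < cap q.2 ->
    ((cap q.2)%:E <= T)%E ->
    A (cap q.2)%:E w - A (cap q.1)%:E w <= Dm (cap q.2)%:E w - Dm (cap q.1)%:E w.
  apply: ae_forall_countable => q.
  have [q0|q0] := leP 0 (cap q.1); last by apply: aeW.
  have [q12|q12] := ltP (cap q.1) (cap q.2); last by apply: aeW.
  have [qT|qT] := leP (cap q.2)%:E T; last by apply: aeW.
  by apply: filterS (drift_increment_le usualF cG S1G decG varD snellS decS q0 q12 qT) => w.
have [_ [_ cDm] _ _ _] := varD.
have [_ _ [[_ cA] _] _ _] := decS.
apply: filterS3 h cDm cA => w h cDmw cAw r r' [r0 rT] [r'0 r'T].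
rewrite le_eqVlt => /orP[/eqP ->|rr']; first by rewrite !subrr.
pose k u := Dm u%:E w - A u%:E w.
suff : k r <= k r' by rewrite /k; lra.
have kc u : 0 <= u -> (u%:E < T)%E -> k x @[x --> u^'+] --> k u.
  move=> u0 uT; have fu : finite_times T u by split => //; exact: ltW.
  by apply: cvgB; [apply: (cDmw u fu).1|apply: (cAw u fu).1].
have ltr'T x : x < r' -> (x%:E < T)%E by move=> xr'; apply: lt_le_trans r'T; rewrite lte_fin.
have capE q : ((ratr q : R)%:E <= T)%E -> cap q = ratr q by rewrite /cap => ->.
have step1 q : r < ratr q -> r' <= cap q -> ((cap q)%:E <= T)%E -> k r <= k (cap q).
  move=> rq r'q qT; rewrite -subr_ge0.
  apply: (@right_limit_ge0 R (fun x => k (cap q) - k x) r r' _ rr').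
    by apply: cvgB; [exact: cvg_cst|exact: kc r0 (ltr'T _ rr')].
  move=> p /andP[rp pr'].
  have pT : ((ratr p : R)%:E <= T)%E by rewrite ltW// ltr'T.
  have := h (p, q); rewrite /= (capE p pT) => /(_ (le_trans r0 (ltW rp)) (lt_le_trans pr' r'q) qT).
  by rewrite /k; lra.
move: r'T; rewrite le_eqVlt => /orP[/eqP r'T|r'T].
  have [q] : exists q : rat, ratr q \in `]r', (r' + 1)[ by apply: rat_in_itvoo; rewrite ltrDl.
  rewrite in_itv /= => /andP[r'q _].
  have cq : cap q = r' by rewrite /cap -r'T lee_fin leNgt r'q.
  by rewrite -cq; apply: step1; rewrite ?cq ?r'T// (lt_trans rr').
have [v r'v vT] : exists2 v, r' < v & (v%:E <= T)%E.
  case: (T) r'T => [x| |] //; first by rewrite lte_fin => r'x; exists x.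
  by move=> _; exists (r' + 1); rewrite ?ltrDl ?leey.
rewrite -subr_ge0; apply: (@right_limit_ge0 R (fun x => k x - k r) r' v _ r'v).
  by apply: cvgB; [exact: kc|exact: cvg_cst].
move=> q /andP[r'q qv].
have qT : ((ratr q : R)%:E <= T)%E by apply: le_trans vT; rewrite lee_fin ltW.
by rewrite subr_ge0 -(capE q qT); apply: step1; rewrite ?capE// ?(lt_trans rr')// ltW.
Qed.

End drift_all_times.

(** * Comparison of Lebesgue-Stieltjes measures *)

Section stieltjes_comparison.
Context {R : realType}.

Local Notation LS := lebesgue_stieltjes_measure.

Lemma stieltjes_ocitv (f : cumulative R R) (x y : R) : x <= y ->
  LS f `]x, y] = (f y - f x)%:E.
Proof.
move=> xy; rewrite /LS /measure_extension measurable_mu_extE/=; last exact: is_ocitv.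
by rewrite wlength_itv_bnd.
Qed.

(** The measure of [g] is the sum of those of [f] and of [g - f]. *)
Lemma stieltjes_le (f g : cumulative R R) :
  (forall x y, x <= y -> f y - f x <= g y - g x) ->
  forall B, measurable B -> (LS f B <= LS g B)%E.
Proof.
move=> fg.
pose h x := g x - f x.
have ndh : nondecreasing h by move=> x y xy; rewrite /h; have := fg x y xy; lra.
have rch : right_continuous h.
  by move=> x; apply: cvgB; exact: cumulative_is_right_continuous.
pose hC := isCumulative.Build R _ R h ndh rch.
pose H : cumulative R R := HB.pack h hC.
have E : forall B, measurable B -> LS g B = measure_add (LS f) (LS H) B.
  apply: lebesgue_stieltjes_measure_unique => _ [[x y] /= _ <-].
  rewrite -[RHS]/(measure_add (LS f) (LS H) _) measure_addE; have [xy|yx] := leP x y; last first.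
    by rewrite set_itv_ge ?measure0 ?adde0// bnd_simp -leNgt ltW.
  rewrite (stieltjes_ocitv g xy); transitivity ((f y - f x)%:E + (h y - h x)%:E)%E.
    by rewrite -EFinD /h; congr EFin; lra.
  by congr (_ + _)%E; symmetry; [exact: stieltjes_ocitv|exact: (stieltjes_ocitv H)].
by move=> B mB; rewrite E// measure_addE leeDl.
Qed.

Lemma stieltjes_finite (f : cumulative R R) (K : R) :
  (forall x y, x <= y -> f y - f x <= K) -> (LS f setT < +oo)%E.
Proof.
move=> fK; apply: (@le_lt_trans _ _ K%:E); last exact: ltry.
have U : \bigcup_n `](- n%:R)%R, n%:R%R]%classic = [set: R].
  rewrite -subTset => x _; exists (Num.bound `|x|) => //=.
  have := archi_boundP (normr_ge0 x); rewrite ltr_norml in_itv /= => /andP[-> /ltW ->].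
  by [].
have mI n : measurable `](- n%:R)%R, (n%:R : R)]%classic by exact: measurable_itv.
have cv : LS f `](- n%:R)%R, (n%:R : R)]%classic @[n --> \oo] --> LS f setT.
  rewrite -U; apply: nondecreasing_cvg_mu => //; first exact: bigcupT_measurable.
  move=> m n mn; apply/subsetPset; apply: subset_itv; rewrite bnd_simp ?lerN2 ler_nat//.
apply: (lee_cvg_to cv (cvg_cst K%:E)); apply: nearW => n.
by rewrite stieltjes_ocitv ?lee_fin ?fK// ge0_cp.
Qed.

(** Over the set where the derivative is negative its integral is a value of [nu],
    hence nonnegative; over the set where it exceeds [1], the integral of the
    excess is a value of [nu - mu], hence nonpositive. *)
Lemma Radon_Nikodym_le1 (mu : {sigma_finite_measure set (measurableTypeR R) -> \bar R})
    (nu : {charge set (measurableTypeR R) -> \bar R}) :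
  (forall B, measurable B -> (0 <= nu B <= mu B)%E) ->
  nu `<< mu /\ \forall x \ae mu, (0 <= Radon_Nikodym nu mu x <= 1)%E.
Proof.
move=> numu.
have dom : nu `<< mu.
  apply/null_content_dominatesP => B mB B0; apply/eqP; rewrite eq_le.
  by have := numu B mB; rewrite B0 => /andP[-> ->].
split => //; set f := Radon_Nikodym nu mu.
have iff : mu.-integrable setT f by exact: Radon_Nikodym_integrable.
have mf : measurable_fun setT f := measurable_int _ iff.
have nuE B : measurable B -> nu B = (\int[mu]_(x in B) f x)%E by exact: Radon_Nikodym_integral.
have ge0 : \forall x \ae mu, (0 <= f x)%E.
  pose B := [set x | (f x < 0)%E].
  have mB : measurable B by rewrite /B -[X in measurable X]setTI; exact: emeasurable_fun_infty_o.
  have nuB : nu B = (- \int[mu]_(x in B) `|f x|)%E.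
    rewrite nuE// -integral_ge0N//; apply: eq_integral => x /set_mem fx.
    by rewrite lte0_abs// oppeK.
  have : (\int[mu]_(x in B) `|f x| = 0)%E.
    apply/eqP; rewrite eq_le integral_ge0// andbT -oppe_ge0 -nuB.
    by have /andP[] := numu B mB.
  move=> /(ae_eq_integral_abs mu mB (measurable_funTS mf)).
  apply: filterS => x h; rewrite leNgt; apply/negP => fx; have := h fx => fx0.
  by rewrite fx0 ltxx in fx.
have le1 : \forall x \ae mu, (f x <= 1)%E.
  pose B := [set x | (1 < f x)%E].
  have mB : measurable B by rewrite /B -[X in measurable X]setTI; exact: emeasurable_fun_o_infty.
  have mf1 : measurable_fun B (fun x => f x - 1)%E.
    by apply: emeasurable_funB => //; exact: measurable_funTS.
  have nuB : nu B = (mu B + \int[mu]_(x in B) `|f x - 1|)%E.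
    rewrite nuE// -[X in (X + _)%E]mul1e -integral_cst// -ge0_integralD//; last first.
      exact: measurableT_comp.
    apply: eq_integral => x /set_mem fx; rewrite gee0_abs ?sube_ge0 ?(ltW fx)//.
    by rewrite addeC subeK.
  have finB : nu B \is a fin_num by exact: fin_num_measure.
  have int0 : (0 <= \int[mu]_(x in B) `|f x - 1|)%E by exact: integral_ge0.
  have finmu : mu B \is a fin_num.
    rewrite ge0_fin_numE//; apply: (@le_lt_trans _ _ (nu B)); first by rewrite nuB leeDl.
    by rewrite ltey_eq finB.
  have : (\int[mu]_(x in B) `|f x - 1| = 0)%E.
    apply/eqP; rewrite eq_le int0 andbT; have /andP[_] := numu B mB.
    by rewrite nuB -[leRHS]adde0 leeD2lE.
  move=> /(ae_eq_integral_abs mu mB mf1).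
  apply: filterS => x h; rewrite leNgt; apply/negP => fx; have := h fx; move: fx.
  by case: (f x) => [r| |] //=; rewrite -EFinB lte_fin -subr_gt0 => + [r0]; rewrite r0 ltxx.
by apply: filterS2 ge0 le1 => x -> ->.
Qed.

End stieltjes_comparison.

(** * Paths extended to the line *)
Section extended_paths.
Context {R : realType}.
Variable T : \bar R.
Hypothesis T0 : (0 < T)%E.

Definition time_clamp (x : R) : R := fine (Order.min T (Order.max 0%E x%:E)).

Lemma time_clampE x : (time_clamp x)%:E = Order.min T (Order.max 0%E x%:E).
Proof.
rewrite /time_clamp fineK// fin_numElt; apply/andP; split.
  by rewrite lt_min lt_max ltNy0 /= (lt_trans _ T0).
by rewrite gt_min gt_max ltry ltry orbT.
Qed.

Lemma finite_time_clamp x : finite_times T (time_clamp x).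
Proof.
split; rewrite -?lee_fin time_clampE; last by rewrite ge_min lexx.
by rewrite le_min (ltW T0) le_max lexx.
Qed.

Lemma le_time_clamp x y : x <= y -> time_clamp x <= time_clamp y.
Proof.
move=> xy; rewrite -lee_fin !time_clampE le_min ge_min lexx /= ge_min.
by rewrite ge_max !le_max lexx /= [(x%:E <= y%:E)%E]lee_fin xy !orbT.
Qed.

Lemma time_clamp_id x : 0 <= x -> (x%:E <= T)%E -> time_clamp x = x.
Proof. by move=> x0 xT; apply: EFin_inj; rewrite time_clampE max_r ?lee_fin// min_r. Qed.

Lemma time_clamp_neg x : x <= 0 -> time_clamp x = 0.
Proof. by move=> x0; apply: EFin_inj; rewrite time_clampE max_l ?lee_fin// min_r// ltW. Qed.

Lemma time_clamp_late x y : (T <= x%:E)%E -> x <= y -> time_clamp y = time_clamp x.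
Proof.
move=> Tx xy; apply: EFin_inj; rewrite !time_clampE !min_l// le_max ?Tx ?orbT//.
by rewrite (le_trans Tx (_ : (x%:E <= y%:E)%E)) ?orbT ?lee_fin.
Qed.

Lemma time_clamp_cumulative (f : R -> R) :
  (forall r r', finite_times T r -> finite_times T r' -> r <= r' -> f r <= f r') ->
  (forall r, finite_times T r -> (r%:E < T)%E -> f x @[x --> r^'+] --> f r) ->
  exists g : cumulative R R, (g : R -> R) = f \o time_clamp.
Proof.
move=> nd rc.
have ndg : nondecreasing (f \o time_clamp).
  by move=> x y xy /=; apply: nd; [exact: finite_time_clamp|exact: finite_time_clamp|exact: le_time_clamp].
have rcg : right_continuous (f \o time_clamp).
  move=> x /=; have [x0|x0] := ltP x 0.
    apply: cvg_near_cst; apply/near_rightP; exists 0 => // y /andP[_ y0] /=.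
    by rewrite !time_clamp_neg// ltW.
  have [xT|Tx] := ltP x%:E T; last first.
    apply: cvg_near_cst; apply/near_rightP; exists (x + 1); first by rewrite ltrDl.
    by move=> y /andP[xy _] /=; rewrite (time_clamp_late Tx)// ltW.
  rewrite time_clamp_id ?(ltW xT)//; apply: cvg_trans (rc x _ xT); last by split => //; exact: ltW.
  apply: near_eq_cvg; apply/near_rightP.
  have [v xv vT] : exists2 v, x < v & (v%:E <= T)%E.
    case: (T) xT => [z| |] //; first by rewrite lte_fin => xz; exists z.
    by move=> _; exists (x + 1); rewrite ?ltrDl ?leey.
  exists v => // y /andP[xy yv] /=; rewrite time_clamp_id//.
    by rewrite (le_trans x0)// ltW.
  by apply: le_trans vT; rewrite lee_fin ltW.
by exists (HB.pack_for (cumulative R R) (f \o time_clamp)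
  (isCumulative.Build R _ R (f \o time_clamp) ndg rcg)).
Qed.

Lemma stieltjes_derivative_le1 (f g : R -> R) (K : R) :
  (forall r r', finite_times T r -> finite_times T r' -> r <= r' -> 0 <= f r' - f r <= g r' - g r) ->
  (forall r, finite_times T r -> (r%:E < T)%E -> f x @[x --> r^'+] --> f r) ->
  (forall r, finite_times T r -> (r%:E < T)%E -> g x @[x --> r^'+] --> g r) ->
  (forall r, finite_times T r -> f r - f 0 <= K) ->
  exists (a dm : cumulative R R) (nu : {charge set (measurableTypeR R) -> \bar R}),
    [/\ (a : R -> R) = f \o time_clamp, (dm : R -> R) = g \o time_clamp,
        stieltjes_charge a nu, nu `<< lebesgue_stieltjes_measure dm &
        \forall x \ae lebesgue_stieltjes_measure dm,
          (0 <= Radon_Nikodym nu (lebesgue_stieltjes_measure dm) x <= 1)%E].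
Proof.
move=> fg rf rg fK.
have [a ea] : exists a : cumulative R R, (a : R -> R) = f \o time_clamp.
  apply: time_clamp_cumulative => // r r' hr hr' rr'.
  by have /andP[] := fg r r' hr hr' rr'; rewrite subr_ge0.
have [dm edm] : exists dm : cumulative R R, (dm : R -> R) = g \o time_clamp.
  apply: time_clamp_cumulative => // r r' hr hr' rr'.
  by have /andP[h1 h2] := fg r r' hr hr' rr'; rewrite -subr_ge0 (le_trans h1).
have fin : (lebesgue_stieltjes_measure a setT < +oo)%E.
  apply: (@stieltjes_finite _ _ K) => x y xy; rewrite ea /=.
  have h0 := fg 0 (time_clamp x) _ (finite_time_clamp x); have := fK _ (finite_time_clamp y).
  have ft0 : finite_times T 0 by split => //; exact: ltW.
  have x0 : 0 <= time_clamp x by have [] := finite_time_clamp x.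
  have := h0 ft0 x0; lra.
pose nu : {charge set (measurableTypeR R) -> \bar R} :=
  charge_of_finite_measure (mfrestr measurableT fin).
have nuE B : measurable B -> nu B = lebesgue_stieltjes_measure a B.
  by move=> mB; rewrite /nu /charge_of_finite_measure /= /mfrestr /mrestr setIT.
have [dom RN] : nu `<< lebesgue_stieltjes_measure dm /\
    \forall x \ae lebesgue_stieltjes_measure dm,
      (0 <= Radon_Nikodym nu (lebesgue_stieltjes_measure dm) x <= 1)%E.
  apply: Radon_Nikodym_le1 => B mB.
  rewrite [X in (_ <= X <= _)%E](nuE B mB) measure_ge0 /=.
  apply: stieltjes_le => // x y xy; rewrite ea edm /=.
  have := fg _ _ (finite_time_clamp x) (finite_time_clamp y) (le_time_clamp xy).
  by move=> /andP[].
by exists a, dm, nu; split.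
Qed.

End extended_paths.

Section bounded_increasing.
Context {R : realType} {d : measure_display} {Omega : measurableType d}.
Variable P : probability Omega R.
Variables (T : \bar R) (F : \bar R -> set (set Omega)) (A : \bar R -> Omega -> R).

(** The whole variation need not be measurable, but it is bounded below by the
    supremum of the increments since [0] along a sequence of times, and for an
    increasing path this bounds all increments. *)
Lemma ae_bounded_increasing : (0 < T)%E -> usual_filtration T F P ->
  adapted T F A -> increasing T P A -> (\int[P]_w whole_variation T A w < +oo)%E ->
  \forall w \ae P, exists K : R, forall r, finite_times T r -> A r%:E w - A 0%E w <= K.
Proof.
move=> T0 usualF aA iA VA.
pose r (n : nat) := time_clamp T n%:R.
have fr n : finite_times T (r n) by exact: finite_time_clamp.
pose Z n w := `|A (r n)%:E w - A 0%E w|.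
pose Ze w := esups (fun n => (Z n w)%:E) 0.
have ZeP w n : ((Z n w)%:E <= Ze w)%E by apply: ereal_sup_ubound; exists n.
have Ze0 w : (0 <= Ze w)%E by apply: le_trans (ZeP w 0%N); rewrite lee_fin normr_ge0.
have mA u : times T u -> measurable_fun setT (A u).
  move=> tu; have [_ sub] : sigma_algebra setT (F u) /\ F u `<=` measurable.
    by have [+ _ _ _] := usualF; apply.
  exact: (measurable_wrt_measurable sub (aA _ tu)).
have mZe : measurable_fun setT Ze.
  apply: measurable_fun_esups => n; apply/measurable_EFinP; apply: measurableT_comp => //.
  apply: measurable_funB; apply: mA; first by have [h1 h2] := fr n; split.
  by split => //; exact: ltW.
have iZe : P.-integrable setT Ze.
  apply/integrableP; split => //; apply: le_lt_trans VA.
  apply: ge0_le_integralT => w; first exact: abse_ge0.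
  rewrite gee0_abs//; apply: ge_ereal_sup => _ [n _ <-].
  apply: (@le_trans _ _ (path_variation A w (r n))).
    by apply: (total_variation_ge (fun x => A x%:E w)); have [] := fr n.
  by apply: ereal_sup_ubound; exists (r n).
apply: filterS2 iA (integrable_ae measurableT iZe) => w ndA /(_ Logic.I) finZ.
exists (fine (Ze w)) => u fu; rewrite -lee_fin fineK//.
pose n := Num.bound u; have [u0 uT] := fu.
have un : u <= r n.
  rewrite -lee_fin time_clampE// le_min uT le_max !lee_fin.
  by rewrite (ltW (archi_boundP u0)) orbT.
apply: le_trans (ZeP w n); rewrite lee_fin.
by apply: le_trans (ler_norm _); rewrite lerD2r; exact: ndA.
Qed.

End bounded_increasing.

Local Open Scope charge_scope.

Theorem theorem3p3 (R : realType) (d : measure_display)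
    (Omega : measurableType d) (P : probability Omega R)
    (T : \bar R) (F : \bar R -> set (set Omega))
    (G N D Dp Dm S M A : \bar R -> Omega -> R) :
  (0 < T)%E ->
  usual_filtration T F P ->
  terminal_sigma_algebra T F ->
  initially_trivial F P ->
  semimartingale T F P G ->
  terminal_value T P G ->
  in_S1 T P G ->
  in_H1_loc T F P G ->
  canonical_decomposition T F P G N D ->
  variation_components T F P D Dp Dm ->
  snell_envelope T F P G S ->
  doob_meyer_decomposition T F P S M A ->
  \forall w \ae P,
    exists (a dm : cumulative R R)
           (nu : {charge set (measurableTypeR R) -> \bar R}),
      [/\ (a : R -> R) = extended_path T A w,
          (dm : R -> R) = extended_path T Dm w,
          stieltjes_charge a nu,
          nu `<< lebesgue_stieltjes_measure dm &
          \forall t \ae lebesgue_stieltjes_measure dm,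
            (0 <= ('d nu '/d (lebesgue_stieltjes_measure dm)) t <= 1)%E].
Proof.
move=> T0 usualF _ _ [cG _] _ S1G _ decG varD snellS decS.
have [_ _ [[aA cA] _] iA [VA _]] := decS.
have [_ [_ cDm] _ _ _] := varD.
have le_drift := drift_le_all_times usualF cG S1G decG varD snellS decS T0.
have finV := ae_bounded_increasing T0 usualF aA iA VA.
apply: filterS3 (filterI le_drift iA) (filterI cA cDm) finV => w [w1 w2] [w3 w4] [K wK].
have h : forall r r', finite_times T r -> finite_times T r' -> r <= r' ->
    0 <= A r'%:E w - A r%:E w <= Dm r'%:E w - Dm r%:E w.
  by move=> r r' hr hr' rr'; rewrite subr_ge0 w2// w1.
have pathE X : extended_path T X w = (fun u => X u%:E w) \o time_clamp T.
  by apply/funext => x; rewrite /extended_path /= time_clampE.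
have [a [dm [nu [h1 h2 h3 h4 h5]]]] :=
  @stieltjes_derivative_le1 R T T0 (fun u => A u%:E w) (fun u => Dm u%:E w) K h
   (fun r hr => (w3 r hr).1) (fun r hr => (w4 r hr).1) wK.
by exists a, dm, nu; rewrite !pathE; split.
Qed.
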